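(* Let $K$ be a local field of characteristic $p$ with finite residue field $\overline{K}$, and let $L/K$ be a totally ramified Galois extension with $\mathrm{Gal}(L/K)\cong(\mathbb{Z}/p\mathbb{Z})^{\nu}$, $\nu\ge1$, having a single ramification break $b$ with $1\le b\le p-1$. Let $w_0,\dots,w_{\nu-1}$ be as defined in the context. Then for $0\le j\le \nu-1$, $$i_j=bp^{\nu}+\min\{p^{j'}v_K(w_{j'}): 0\le j'\le j\}.$$
   Context: $v_K$ is the normalized valuation ($v_K(0)=\infty$), $\mathcal{M}_K$ the maximal ideal. ''Single ramification break $b$'' means $v_L(\sigma(\pi_L)-\pi_L)=b+1$ for every $\sigma\ne1$ in $\mathrm{Gal}(L/K)$. Identify $\overline{K}$ with the subfield of Teichmüller representatives of $K$. Indices of inseparability: for uniformizers $\pi_K,\pi_L$ write $\pi_K=\sum_{h\ge0}c_h\pi_L^{h+p^\nu}$ with $c_h\in\overline{K}$, and set $i_j=\min\{h\ge0: c_h\ne0,\ v_p(h+p^\nu)\le j\}$ for $0\le j\le\nu$ (independent of the choices). Definition of $w_j$: fix a uniformizer $\pi_L$ and let $t={\rm N}_{L/K}(\pi_L)$, so $K=\overline{K}((t))$. Let $\wp(x)=x^p-x$ and $B=\{\beta\in K: X^p-X-\beta \text{ splits over } L\}$. Fix an additive complement $\overline{K}_0$ of $\wp\overline{K}$ in $\overline{K}$ and let $K_0=\{x_0+x_1t^{-1}+\dots+x_st^{-s}: s\ge0,\ x_0\in\overline{K}_0,\ x_i\in\overline{K},\ x_{pi}=0 \text{ for } i\ge1\}$,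 $B_0=B\cap K_0$. Every element of $B_0$ has the form $\sum_{k=1}^b x_kt^{-k}$ with $x_k\in\overline{K}$, and the map $B_0\to\overline{K}$, $\sum x_kt^{-k}\mapsto x_b$, is injective; let $V$ be its image and $\psi:V\to B_0$ the inverse map. Then $w_0,\dots,w_{\nu-1}$ are the unique elements of $\bigoplus_{k=1}^b\overline{K}t^{-k}$ with $\psi(x)=\sum_{j=0}^{\nu-1}w_jx^{p^{\nu-j}}$ for all $x\in V$. *)

(* Defs.v *)
From HB Require Import structures.
From mathcomp Require Import all_boot all_order all_fingroup all_algebra.
From mathcomp Require Import all_solvable all_field.
From mathcomp Require Import boolp classical_sets constructive_ereal.

Set Implicit Arguments.
Unset Strict Implicit.
Unset Printing Implicit Defensive.

Import Order.TTheory GRing.Theory Num.Theory.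

Local Open Scope ring_scope.

Section Valuation.
Variables (F : fieldType) (v : F -> \bar int).

(* [\bar int] is int with +oo and -oo adjoined; -oo is not a value of v. *)
Record normalized_valuation : Prop := NormalizedValuation {
  val0 : v 0 = +oo%E;
  val_fin : forall x, x != 0 -> v x \is a fin_num;
  valM : forall x y, v (x * y) = (v x + v y)%E;
  valD : forall x y, (Order.min (v x) (v y) <= v (x + y))%E;
  val_surj : exists x, v x = 1%E
}.

Definition uniformizer (x : F) : Prop := v x = 1%E.

Definition val_cvg (u : nat -> F) (l : F) : Prop :=
  forall N : int, exists n0 : nat,
    forall n, (n0 <= n)%N -> (N%:E <= v (u n - l))%E.

Definition val_cauchy (u : nat -> F) : Prop :=
  forall N : int, exists n0 : nat,
    forall m n, (n0 <= m)%N -> (n0 <= n)%N -> (N%:E <= v (u m - u n))%E.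

Definition val_complete : Prop :=
  forall u, val_cauchy u -> exists l, val_cvg u l.

(* The residue field {0 <= v} / {0 < v} has exactly q elements: r lists one
   representative of each class. *)
Definition residue_card (q : nat) : Prop :=
  exists r : 'I_q -> F,
    (forall i, (0 <= v (r i))%E) /\
    (forall x, (0 <= v x)%E -> exists! i, (0 < v (x - r i))%E).

(* A local field with residue field of cardinality q. *)
Definition local_field (q : nat) : Prop :=
  [/\ normalized_valuation, val_complete & residue_card q].

End Valuation.

(* The Teichmuller representatives of the elements of a residue field with q
   elements are the roots of X^q - X; in characteristic p they form a subfield
   isomorphic to the residue field. *)
Definition teichmuller (F : fieldType) (q : nat) : set F :=
  [set x | x ^+ q = x].

Section Extension.
Variables (K : fieldType) (L : splittingFieldType K).
Variables (vK : K -> \bar int) (vL : L -> \bar int).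

(* vL extends vK with ramification index [L : K]. *)
Definition totally_ramified : Prop :=
  forall x : K, vL x%:A = ((\dim {:L})%:Z%:E * vK x)%E.

Definition single_break (b : nat) : Prop :=
  exists2 piL : L, uniformizer vL piL &
    forall sigma, sigma \in 'Gal({:L} / 1%AS)%g -> sigma != 1%g ->
      vL (sigma piL - piL) = b.+1%:Z%:E.

Definition insep_expansion (p q nu : nat) (piK : K) (piL : L)
    (c : nat -> K) : Prop :=
  (forall h, teichmuller q (c h)) /\
  val_cvg vL (fun n => \sum_(h < n) c h *: piL ^+ (h + p ^ nu)) piK%:A.

(* The minimum of the empty set is +oo. *)
Definition insep_index (p nu : nat) (c : nat -> K) (j : nat) : \bar int :=
  match pselect (exists h, (c h != 0) && (logn p (h + p ^ nu) <= j)%N) with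
  | left exh => (ex_minn exh)%:Z%:E
  | right _ => +oo%E
  end.

End Extension.

Section ArtinSchreier.
Variables (K : fieldType) (L : splittingFieldType K) (p q b : nat).

Definition wp (x : K) : K := x ^+ p - x.

(* C is an additive complement of wp(k) in k, for k the subfield of
   Teichmuller representatives. *)
Definition wp_complement (C : set K) : Prop :=
  [/\ forall x, C x -> teichmuller q x,
      C 0 /\ (forall x y, C x -> C y -> C (x - y)),
      forall x, teichmuller q x ->
        exists c y, [/\ C c, teichmuller q y & x = c + wp y]
    & forall y, teichmuller q y -> C (wp y) -> wp y = 0].

Definition AS_split : set K :=
  [set beta | exists rs : seq L,
    map_poly (in_alg L) ('X^p - 'X - beta%:P) = \prod_(a <- rs) ('X - a%:P)].

Variables (C : set K) (t : K).

Definition AS_reduced : set K :=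
  [set y | exists s (x : nat -> K),
    [/\ C (x 0), forall i, teichmuller q (x i),
        forall i, (1 <= i)%N -> x (p * i)%N = 0
      & y = \sum_(0 <= k < s.+1) x k * t ^- k]].

Definition AS_B0 : set K := (AS_split `&` AS_reduced)%classic.

Definition polar_expansion (x : nat -> K) (y : K) : Prop :=
  (forall k, teichmuller q (x k)) /\
  y = \sum_(1 <= k < b.+1) x k * t ^- k.

(* The span of t^-1, ..., t^-b over the Teichmuller subfield. *)
Definition polar_part : set K := [set y | exists x, polar_expansion x y].

(* The map B_0 -> k taking the coefficient of t^-b, as a graph. *)
Definition top_coef (beta a : K) : Prop :=
  AS_B0 beta /\ exists2 x, polar_expansion x beta & x b = a.

Definition AS_V : set K := [set a | exists beta, top_coef beta a].

Definition AS_psi (a : K) : K := xget 0 [set beta | top_coef beta a].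

(* The defining property of (w_0, ..., w_(nu-1)). *)
Definition AS_coefs (nu : nat) (w : 'I_nu -> K) : Prop :=
  (forall j, polar_part (w j)) /\
  (forall x, AS_V x -> AS_psi x = \sum_(j < nu) w j * x ^+ (p ^ (nu - j))).

End ArtinSchreier.

(* Main.v *)
(** Let v be the valuation of L and N = p^nu. Since k is perfect, i_j + N is the
    best order v(pi_K - y^(p^(j+1))), y in L, to which a uniformizer of K can be
    approximated by p^(j+1)-th powers of L; as b is prime to p, one may replace
    pi_K by t^-b and i_j + N by i_j - b N.

    Interpolate the Artin-Schreier roots of psi(x), x in V, by an additive
    polynomial in x with coefficients in L. Eliminating all its coefficients but
    the lowest one, Y, gives Y^N = sum_j (a_j Y + w_j)^(p^j), where a_j is the
    coefficient of t^-b in w_j. Inductively in m <= nu this equation shows that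
    Z = Y + t^-b and every a_j Y + w_j are p^m-th powers modulo the maximal ideal.
    Hence t^-b = z^N - sum_j W_j^(p^j) up to positive valuation, with
    v(W_j) = v_K(w_j) prime to p, and the best approximation of t^-b by
    p^(j+1)-th powers has order min_{j' <= j} p^j' v_K(w_j').

    That B_0 contains nu independent elements, all of the form
    sum_{1 <= k <= b} x_k t^-k with x_b <> 0, requires two facts on K(y)/K for
    y^p - y = beta in B_0. The order of the pole of beta is the ramification break
    of K(y)/K, which equals b by comparison with L/K (Serre, Local Fields, IV,
    Prop. 3). The constant coefficient of beta is in wp(k) because t is a norm:
    Jacobson's formula for p-th powers in the Weyl algebra of J = rho sigma gives
    beta = sum_{l < p} g_l^p t^l - g_0 for some g_l in K. *)

Require Import Defs.
From HB Require Import structures.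
From mathcomp Require Import all_boot all_order all_fingroup all_algebra.
From mathcomp Require Import all_solvable all_field.
From mathcomp Require Import boolp classical_sets constructive_ereal.
From mathcomp Require Import ring zify.

Set Implicit Arguments.
Unset Strict Implicit.
Unset Printing Implicit Defensive.

Import Order.TTheory GRing.Theory Num.Theory.

Local Open Scope ring_scope.

(** * Discretely valued fields *)

(** The bound b <= p - 1 shapes the argument. All pole orders 1, ..., b are prime to p, so for w_j
    <> 0 the integer p^j v_K(w_j) has p-adic valuation exactly j: the terms W_j^(p^j) with j <= j0
    can cancel neither each other nor a p^(j0+1)-th power, and the minimum is attained. The pole of
    a_j Y has order at most b N/p <= N - N/p, whereas a nonzero w_j has a pole of order at least N
    in L; hence w_j always dominates. In Jacobson's formula the same bound makes g_0 integral and
    leaves the other g_l at most a simple pole.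

    The equation for Y improves the approximation of w_0 only. What carries it to the other elements
    of K, and later from t^-b to pi_K and back, is precision relative to the valuation: it is
    preserved by products, so a single element of K of valuation prime to p passes it on to every
    element of K. *)

Section Valuations.
Variables (F : fieldType) (v : F -> \bar int).
Hypothesis vv : normalized_valuation v.

(** At [x = 0] the bound holds for every [n], so error terms are estimated with plain integers and
    without a case split on vanishing. *)
Definition vge (x : F) (n : int) : Prop := (n%:E <= v x)%E.

Lemma vge0 n : vge 0 n.
Proof. by rewrite /vge (Defs.val0 vv) leey. Qed.

Lemma val_ex x : x != 0 -> exists n, v x = n%:E.
Proof. by move=> /(val_fin vv)/EFin_fin_numP. Qed.

Lemma val_neq0 x n : v x = n%:E -> x != 0.
Proof. by move=> vx; apply/eqP => x0; move: vx; rewrite x0 (Defs.val0 vv). Qed.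

Lemma val_vge x n m : v x = n%:E -> vge x m <-> (m <= n).
Proof. by rewrite /vge => ->; rewrite lee_fin. Qed.

Lemma val_vge_refl x n : v x = n%:E -> vge x n.
Proof. by move=> vx; apply/(val_vge _ vx). Qed.

Lemma vge_le x n m : m <= n -> vge x n -> vge x m.
Proof. by rewrite /vge -lee_fin => mn; exact: le_trans. Qed.

Lemma vgeD x y n : vge x n -> vge y n -> vge (x + y) n.
Proof.
rewrite /vge => hx hy; apply: le_trans (Defs.valD vv x y).
by rewrite le_min hx hy.
Qed.

Lemma vge_sum (I : Type) (r : seq I) (P : pred I) (f : I -> F) n :
  (forall i, P i -> vge (f i) n) -> vge (\sum_(i <- r | P i) f i) n.
Proof.
by move=> h; elim/big_rec: _ => [|i x Pi]; [exact: vge0 | apply/vgeD/h].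
Qed.

Lemma valMn x y n m : v x = n%:E -> v y = m%:E -> v (x * y) = (n + m)%:E.
Proof. by move=> vx vy; rewrite (Defs.valM vv) vx vy. Qed.

Lemma val1 : v 1 = 0%:E.
Proof.
have [n vn] := val_ex (oner_neq0 F).
have := valMn vn vn; rewrite mulr1 vn => -[] h.
by congr EFin; lia.
Qed.

Lemma valX x n k : v x = n%:E -> v (x ^+ k) = (n * k%:Z)%:E.
Proof.
move=> vx; elim: k => [|k IH]; first by rewrite expr0 mulr0 val1.
by rewrite exprS (valMn vx IH); congr EFin; lia.
Qed.

Lemma valV x n : v x = n%:E -> v x^-1 = (- n)%:E.
Proof.
move=> vx; have x0 := val_neq0 vx.
have [m vm] := val_ex (invr_neq0 x0).
have := valMn vx vm; rewrite divff // val1 => -[] h.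
by rewrite vm; congr EFin; lia.
Qed.

Lemma valMz x y n m : v x = n%:E -> v y = m%:E -> v (x / y) = (n - m)%:E.
Proof. by move=> vx /valV; exact: valMn. Qed.

Lemma valXz x n (k : int) : v x = n%:E -> v (x ^ k) = (n * k)%:E.
Proof.
move=> vx; case: k => k; first by rewrite -exprnP (valX _ vx).
rewrite NegzE -exprnN (valV (valX k.+1 vx)); congr EFin; lia.
Qed.

Lemma val_prod (I : Type) (r : seq I) (P : pred I) (f : I -> F) (g : I -> int) :
  (forall i, P i -> v (f i) = (g i)%:E) ->
  v (\prod_(i <- r | P i) f i) = (\sum_(i <- r | P i) g i)%:E.
Proof.
move=> h; elim/big_rec2: _ => [|i x y Pi]; first exact: val1.
by move=> vy; apply: valMn => //; exact: h.
Qed.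

Lemma valN1 : v (-1) = 0%:E.
Proof.
have h : (-1 : F) != 0 by rewrite oppr_eq0 oner_neq0.
have [n vn] := val_ex h.
have := valMn vn vn; rewrite mulrNN mulr1 val1 vn => -[] {}h.
by congr EFin; lia.
Qed.

Lemma valN x : v (- x) = v x.
Proof. by rewrite -mulN1r (Defs.valM vv) valN1 add0e. Qed.

Lemma vgeN x n : vge x n -> vge (- x) n.
Proof. by rewrite /vge valN. Qed.

Lemma vgeB x y n : vge x n -> vge y n -> vge (x - y) n.
Proof. by move=> hx hy; apply/vgeD/vgeN. Qed.

Lemma vgeBC x y n : vge (x - y) n -> vge (y - x) n.
Proof. by move/vgeN; rewrite opprB. Qed.

Lemma vgeM x y n m : vge x n -> vge y m -> vge (x * y) (n + m).
Proof.
have [->|/val_ex[a va]] := eqVneq x 0; first by rewrite mul0r => _ _; exact: vge0.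
have [->|/val_ex[b vb]] := eqVneq y 0; first by rewrite mulr0 => _ _; exact: vge0.
move=> /(val_vge _ va) h1 /(val_vge _ vb) h2.
by apply/(val_vge _ (valMn va vb)); lia.
Qed.

Lemma vgeMl x y n : vge x 0 -> vge y n -> vge (x * y) n.
Proof. by move=> hx hy; have := vgeM hx hy; rewrite add0r. Qed.

Lemma vge1 : vge 1 0.
Proof. exact: (val_vge_refl val1). Qed.

Lemma vgeX x n k : vge x n -> vge (x ^+ k) (n * k%:Z).
Proof.
move=> hx; elim: k => [|k IH]; first by rewrite expr0 mulr0; exact: vge1.
rewrite exprS; apply: vge_le (vgeM hx IH); lia.
Qed.

Lemma vgeX0 x k : vge x 0 -> vge (x ^+ k) 0.
Proof. by move=> /(vgeX k); rewrite mul0r. Qed.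

Lemma vge_prod (I : Type) (r : seq I) (P : pred I) (f : I -> F) :
  (forall i, P i -> vge (f i) 0) -> vge (\prod_(i <- r | P i) f i) 0.
Proof.
by move=> h; elim/big_rec: _ => [|i x Pi]; [exact: vge1 | apply/vgeMl/h].
Qed.

Lemma vge_rootX x n k : (0 < k)%N -> vge (x ^+ k) (n * k%:Z) -> vge x n.
Proof.
move=> k0; have [->|/val_ex[a va]] := eqVneq x 0; first by move=> _; exact: vge0.
move/(val_vge _ (valX k va)) => h; apply/(val_vge _ va).
by move: h; rewrite ler_pM2r // ltz_nat.
Qed.

Lemma vge_rootX_gt0 x k : (0 < k)%N -> vge (x ^+ k) 1 -> vge x 1.
Proof.
move=> k0; have [->|/val_ex[a va]] := eqVneq x 0; first by move=> _; exact: vge0.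
move/(val_vge _ (valX k va)) => h; apply/(val_vge _ va); nia.
Qed.

Lemma valD_eq x y n : v x = n%:E -> vge y (n + 1) -> v (x + y) = n%:E.
Proof.
move=> vx hy; have hD : vge (x + y) n.
  by apply: vgeD; [exact: val_vge_refl | apply: vge_le hy; lia].
have [h0|/val_ex[m vm]] := eqVneq (x + y) 0.
  have xy : x = - y by apply/eqP; rewrite -addr_eq0 h0.
  by have := vgeN hy; rewrite -xy => /(val_vge _ vx); lia.
have h1 := (val_vge _ vm).1 hD; rewrite vm.
case: (ltrP n m) => [nm|mn]; last by congr EFin; lia.
have : vge (x + y - y) (n + 1).
  by apply: vgeB => //; apply/(val_vge _ vm); lia.
by rewrite addrK => /(val_vge _ vx); lia.
Qed.

Lemma valB_eq x y n : v x = n%:E -> vge (x - y) (n + 1) -> v y = n%:E.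
Proof. by move=> vx h; rewrite -[y](subKr x) (valD_eq vx) //; exact: vgeN. Qed.

Lemma vge_eq0 x : (forall n, vge x n) -> x = 0.
Proof.
move=> h; apply/eqP/contraT => /val_ex[n vn].
by have /(val_vge _ vn) := h (n + 1); lia.
Qed.

(** Nonzero terms of distinct valuations cannot cancel, so the smallest one decides. [None] stands
    for the family that is zero throughout. *)
Lemma val_dominant (I : finType) (f : I -> F) :
  (forall i j, i != j -> f i != 0 -> v (f i) <> v (f j)) ->
  exists2 i : option I, v (\sum_j f j) = oapp (fun i => v (f i)) +oo%E i &
    forall j, (oapp (fun i => v (f i)) +oo%E i <= v (f j))%E.
Proof.
move=> dist; have [i0 i0P|none] := pickP (fun i => f i != 0); last first.
  exists None => /= [|j].
    by rewrite big1 ?(Defs.val0 vv) // => i _; apply/eqP/negPn; rewrite none.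
  by have /negbT := none j; rewrite negbK => /eqP ->; rewrite (Defs.val0 vv).
case: (@arg_minP _ _ _ i0 predT (fun i => v (f i)) isT) => i _ imin.
exists (Some i) => //= [|j]; last exact: imin.
have fi0 : f i != 0.
  apply/eqP => fi0; have := imin i0 isT; rewrite fi0 (Defs.val0 vv).
  by have [n ->] := val_ex i0P.
have [n vn] := val_ex fi0.
rewrite (bigD1 i) //= vn (valD_eq vn) //; apply: vge_sum => j ji.
have [->|fj0] := eqVneq (f j) 0; first exact: vge0.
have [m vm] := val_ex fj0; apply/(val_vge _ vm).
have := imin j isT; rewrite vn vm lee_fin.
have := dist _ _ ji fj0; rewrite vn vm => nm.
by rewrite le_eqVlt => /orP[/eqP nm'|]; [case: nm; rewrite nm' | lia].
Qed.

Lemma vge_dominant (I : finType) (f : I -> F) n :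
  (forall i j, i != j -> f i != 0 -> v (f i) <> v (f j)) ->
  vge (\sum_j f j) n -> forall j, vge (f j) n.
Proof.
move=> dist; rewrite /vge; have [i -> imin] := val_dominant dist.
by move=> ni j; exact: le_trans ni (imin j).
Qed.

Lemma dominant_eq0 (I : finType) (f : I -> F) :
  (forall i j, i != j -> f i != 0 -> v (f i) <> v (f j)) ->
  \sum_j f j = 0 -> forall j, f j = 0.
Proof.
move=> dist s0 j; apply: vge_eq0 => n.
by apply: vge_dominant => //; rewrite s0; exact: vge0.
Qed.

End Valuations.

(** * Characteristic p *)

Section FrobeniusPowers.
Variables (R : comNzRingType) (p : nat).
Hypothesis charR : p \in [pchar R].

Lemma exprD_pchar m (x y : R) :
  (x + y) ^+ (p ^ m) = x ^+ (p ^ m) + y ^+ (p ^ m).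
Proof.
apply: exprDn_pchar; rewrite pnatX; apply/orP; left.
by rewrite pnatE ?(pcharf_prime charR).
Qed.

Lemma exprN_pchar m (x : R) : (- x) ^+ (p ^ m) = - x ^+ (p ^ m).
Proof.
apply/eqP; rewrite -subr_eq0 opprK -exprD_pchar addNr expr0n.
by rewrite expn_eq0 (gtn_eqF (prime_gt0 (pcharf_prime charR))).
Qed.

Lemma exprB_pchar m (x y : R) :
  (x - y) ^+ (p ^ m) = x ^+ (p ^ m) - y ^+ (p ^ m).
Proof. by rewrite exprD_pchar exprN_pchar. Qed.

Lemma expr0_pchar m : (0 : R) ^+ (p ^ m) = 0.
Proof. by have := exprB_pchar m 0 0; rewrite !subrr. Qed.

Lemma expr_sum_pchar m (I : Type) (r : seq I) (P : pred I) (f : I -> R) :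
  (\sum_(i <- r | P i) f i) ^+ (p ^ m) = \sum_(i <- r | P i) f i ^+ (p ^ m).
Proof.
elim/big_rec2: _ => [|i x y _ <-]; first exact: expr0_pchar.
exact: exprD_pchar.
Qed.

Lemma natr_pchar m k : (k%:R : R) ^+ (p ^ m) = k%:R.
Proof.
elim: k => [|k IH]; first exact: expr0_pchar.
by rewrite -addn1 natrD exprD_pchar IH expr1n.
Qed.

Lemma exprD1_pchar (x y : R) : (x + y) ^+ p = x ^+ p + y ^+ p.
Proof. exact: (exprD_pchar 1). Qed.

Lemma exprB1_pchar (x y : R) : (x - y) ^+ p = x ^+ p - y ^+ p.
Proof. exact: (exprB_pchar 1). Qed.

Lemma natr1_pchar k : (k%:R : R) ^+ p = k%:R.
Proof. exact: (natr_pchar 1). Qed.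

End FrobeniusPowers.

Section AddPoly.
Variables (F : fieldType) (p : nat).
Hypothesis charF : p \in [pchar F].

Lemma natr_inj_pchar (i j : nat) :
  (i < p)%N -> (j < p)%N -> i%:R = j%:R :> F -> i = j.
Proof.
move=> ip jp; wlog ij : i j ip jp / (i <= j)%N => [hw h|].
  by case/orP: (leq_total i j) => ij; [apply: hw | apply/esym/hw].
move/esym/eqP; rewrite -subr_eq0 -natrB // -(dvdn_pcharf charF) => d.
by have := dvdn_leq _ d; lia.
Qed.

Lemma AS_poly_prod (a : F) :
  'X^p - 'X - (a ^+ p - a)%:P = \prod_(i < p) ('X - (a + i%:R)%:P) :> {poly F}.
Proof.
have pp := pcharf_prime charF; have p1 := prime_gt1 pp.
set P := LHS; have sX : size (- 'X - (a ^+ p - a)%:P : {poly F}) = 2.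
  by rewrite -opprD size_polyN size_XaddC.
have szP : size P = p.+1.
  by rewrite /P -addrA size_polyDl ?size_polyXn // sX.
have lP : lead_coef P = 1.
  by rewrite /P -addrA lead_coefDl ?lead_coefXn // size_polyXn sX.
rewrite [P](@all_roots_prod_XsubC _ _ [seq a + (i : nat)%:R | i : 'I_p]).
- rewrite lP scale1r big_map big_enum /=; apply: eq_bigr => i _.
  by [].
- by rewrite size_map -cardE card_ord.
- apply/allP => _ /mapP[i _ ->]; rewrite /root /P !hornerE.
  rewrite exprD1_pchar // natr1_pchar //.
  by rewrite subr_eq0 opprD addrACA subrr addr0.
rewrite uniq_rootsE map_inj_uniq ?enum_uniq // => i j /addrI h.
by apply/val_inj/(natr_inj_pchar _ _ h).
Qed.

Lemma AS_roots (a b : F) : a ^+ p - a = b ^+ p - b ->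
  exists2 i, (i < p)%N & b = a + i%:R.
Proof.
move=> h; have : root ('X^p - 'X - (a ^+ p - a)%:P) b.
  by rewrite /root !hornerE h subrr.
rewrite AS_poly_prod /root horner_prod prodf_seq_eq0.
case/hasP => i _ /andP[_]; rewrite !hornerE subr_eq0 => /eqP ->.
by exists (i : nat).
Qed.

End AddPoly.

(** * The residue field and Artin-Schreier reduction *)

Section LocalField.
Variables (p q : nat) (K : fieldType) (v : K -> \bar int).
Hypotheses (charK : p \in [pchar K]) (localK : local_field v q).

Let vv : normalized_valuation v. Proof. by case: localK. Qed.
Let complK : val_complete v. Proof. by case: localK. Qed.
Let pp : prime p. Proof. exact: pcharf_prime charK. Qed.

Lemma vge1_gt0 x : vge v x 1 <-> (0 < v x)%E.
Proof.
rewrite /vge; case: (v x) => [n| |] //=; rewrite ?leey ?lee_fin ?lte_fin ?ltry //.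
all: by split=> //; lia.
Qed.

Lemma residue_class : exists (r : 'I_q -> K) (cl : K -> 'I_q),
  [/\ forall i, vge v (r i) 0, forall x, vge v x 0 -> vge v (x - r (cl x)) 1
    & forall x i, vge v x 0 -> vge v (x - r i) 1 -> cl x = i].
Proof.
case: localK => _ _ [r [r0 rex]]; have [i0 _] := rex 0 (vge0 vv 0).
have h x : {i | vge v x 0 ->
    vge v (x - r i) 1 /\ forall j, vge v (x - r j) 1 -> i = j}.
  apply/cid; have [x0|x0] := pselect (vge v x 0); last by exists i0 => /x0.
  case: (rex x x0) => i ri; case: ri => xi iu.
  exists i => _; split=> [|j]; first exact/vge1_gt0.
  by move/vge1_gt0; exact: iu.
exists r, (fun x => sval (h x)); split=> // [x x0|x i x0 hi].
  by case: (h x) => i /= /(_ x0)[].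
by case: (h x) => j /= /(_ x0)[_ hj]; exact/hj.
Qed.

(** Translations by residue classes form a permutation group of order q, killed by p because K has
    characteristic p. Cauchy's theorem then excludes every other prime divisor of q. *)
Lemma residue_card_pnat : p.-nat q.
Proof.
have [r [cl [r0 clP clu]]] := residue_class.
have q0 : (0 < q)%N := leq_ltn_trans (leq0n _) (ltn_ord (cl 0)).
have cleq x y : vge v x 0 -> vge v (x - y) 1 -> cl x = cl y.
  move=> x0 xy; have y0 : vge v y 0.
    by rewrite -[y](subKr x); apply: vgeB => //; apply: vge_le xy.
  apply: clu => //; rewrite -[x](subrK y) -addrA.
  by apply: vgeD => //; exact: clP.
have clr i : cl (r i) = i by apply: clu; rewrite ?subrr //; exact: vge0.
pose tr i j := cl (r j + r i).
have trE i j : vge v (r j + r i - r (tr i j)) 1 by apply/clP/vgeD.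
have tr_inj i : injective (tr i).
  move=> j k e; rewrite -[j]clr -[k]clr; apply: cleq => //.
  have := vgeB vv (trE i j) (trE i k); rewrite -e.
  by congr (vge v _ _); ring.
pose T i := perm (@tr_inj i).
have T_mul i j : (T i * T j)%g = T (cl (r i + r j)).
  apply/permP => k; rewrite permM !permE /tr; apply: cleq; first exact: vgeD.
  have := vgeD vv (vgeN vv (trE i k)) (clP (r i + r j) (vgeD vv (r0 i) (r0 j))).
  by congr (vge v _ _); rewrite /tr; ring.
have T_inj : injective T.
  move=> i j /permP/(_ (cl 0)); rewrite !permE /tr => e.
  have c0 : vge v (r (cl 0)) 1.
    by have := vgeN vv (clP 0 (vge0 vv 0)); rewrite sub0r opprK.
  have h k : cl (r (cl 0) + r k) = k.
    rewrite -[RHS]clr; apply: cleq; first exact: vgeD.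
    by rewrite addrK.
  by rewrite -(h i) e h.
have gT : group_set [set T i | i : 'I_q].
  apply/group_setP; split=> [|_ _ /imsetP[i _ ->] /imsetP[j _ ->]].
    apply/imsetP; exists (cl 0) => //; apply/permP => k.
    rewrite perm1 permE /tr -[LHS]clr; apply: cleq => //.
    by rewrite opprD addrA subrr; exact: clP (vge0 vv 0).
  by apply/imsetP; exists (cl (r i + r j)).
apply/pnatP => // l pl lq; rewrite /= inE /=.
have cT : #|Group gT| = q by rewrite card_imset // card_ord.
have [x] : {x | x \in Group gT & #[x]%g = l} by apply: Cauchy; rewrite ?cT.
case/imsetP => i _ -> oT; rewrite -(dvdn_prime2 pl pp) -oT order_dvdn.
have TX k : ((T i) ^+ k)%g = T (cl (k%:R * r i)).
  elim: k => [|k IH].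
    rewrite expg0 mul0r; apply/permP => k; rewrite perm1 permE /tr.
    rewrite -[LHS]clr; apply: cleq => //.
    by rewrite opprD addrA subrr; exact: clP (vge0 vv 0).
  rewrite expgSr IH T_mul; congr T.
  have k0 : vge v (k%:R * r i) 0.
    rewrite mulr_natl; elim: (k) => [|n]; first by rewrite mulr0n; exact: vge0.
    by rewrite mulrS => ?; apply: vgeD.
  have h := clP _ k0; apply/esym/cleq.
    by rewrite mulrSr mulrDl mul1r; exact: vgeD.
  by move: h; congr (vge v _ _); rewrite mulrSr; ring.
rewrite TX (pcharf0 charK) mul0r; apply/eqP/permP => k; rewrite perm1 permE /tr.
rewrite -[RHS]clr; apply/esym/cleq => //.
by rewrite opprD addrA subrr; exact: clP (vge0 vv 0).
Qed.

Lemma residue_card_pfactor : exists2 f, (0 < f)%N & q = (p ^ f)%N.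
Proof.
have [f qf] := p_natP residue_card_pnat.
exists f => //; case: f qf => // q1.
have [r [cl [_ clP _]]] := residue_class.
have cl01 : cl 0 = cl 1.
  by apply: val_inj; case: (cl 0) (cl 1) => i ip [j jp] /=; lia.
have := vgeB vv (clP 1 (vge1 vv)) (clP 0 (vge0 vv 0)); rewrite -cl01.
by rewrite sub0r opprK subrK => /(val_vge _ (val1 vv)).
Qed.

Let q1 : (1 < q)%N.
Proof.
have [f f0 ->] := residue_card_pfactor.
by rewrite -{1}(exp1n f) ltn_exp2r // prime_gt1.
Qed.

Lemma vge_prodB (I : Type) (r : seq I) (P : pred I) (f g : I -> K) n :
  (forall i, P i -> [/\ vge v (f i) 0, vge v (g i) 0 & vge v (f i - g i) n]) ->
  vge v (\prod_(i <- r | P i) f i - \prod_(i <- r | P i) g i) n.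
Proof.
move=> h; elim: r => [|i r IH]; first by rewrite !big_nil subrr; exact: vge0.
rewrite !big_cons; case: ifP => // Pi; have [fi gi fg] := h i Pi.
rewrite (_ : _ - _ = (f i - g i) * \prod_(j <- r | P j) f j
  + g i * (\prod_(j <- r | P j) f j - \prod_(j <- r | P j) g j)); last by ring.
apply: vgeD => //; last exact: vgeMl.
by rewrite mulrC; apply: vgeMl => //; apply: vge_prod => // j /h[].
Qed.

(** Fermat's argument: multiplication by a unit x permutes the nonzero classes, so x^(q-1) R is
    congruent to R for the product R of their representatives, and R is a unit. *)
Lemma residue_expq x : vge v x 0 -> vge v (x ^+ q - x) 1.
Proof.
have [r [cl [r0 clP clu]]] := residue_class => x0.
have [x1|x1] := pselect (vge v x 1).
  by apply: vgeB => //; rewrite -(prednK (ltnW q1)) exprSr; apply/vgeMl/x1/vgeX0.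
have vx : v x = 0%:E.
  have [x00|/(val_ex vv)[n vn]] := eqVneq x 0; first by case: x1; rewrite x00; exact: vge0.
  by move/(val_vge _ vn): x0 x1; rewrite vn => n0 /(val_vge _ vn) h; congr EFin; lia.
pose m i := cl (x * r i).
have mP i : vge v (x * r i - r (m i)) 1 by apply/clP/vgeMl.
have m_inj : injective m.
  move=> i j e; rewrite -[i](clu (r i)) ?subrr //; last exact: vge0.
  apply: clu => //.
  have := vgeB vv (mP i) (mP j); rewrite e opprB addrA subrK -mulrBr.
  have [->|/(val_ex vv)[n vn]] := eqVneq (r i - r j) 0; first by move=> _; exact: vge0.
  move/(val_vge _ (valMn vv vx vn)); rewrite add0r => h.
  exact/(val_vge _ vn).
have m0 i : (m i == cl 0) = (i == cl 0).
  have {1}<- : m (cl 0) = cl 0; last by rewrite (inj_eq m_inj).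
  apply: clu; first exact: vgeMl.
  have := clP 0 (vge0 vv 0); rewrite sub0r => h.
  rewrite (_ : _ - _ = - (x * - r (cl 0)) + (- r (cl 0))); last by ring.
  by apply: vgeD => //; apply/vgeN/vgeMl.
have vR : v (\prod_(i | i != cl 0) r i) = 0%:E.
  rewrite (@val_prod _ _ vv _ _ _ _ (fun=> 0)) ?sumr_const ?mul0rn // => i i0.
  have nr : ~ vge v (r i) 1.
    move=> ri; case/eqP: i0; apply/esym/clu; first exact: vge0.
    by rewrite sub0r; exact: vgeN.
  have [x00|/(val_ex vv)[n vn]] := eqVneq (r i) 0; first by case: nr; rewrite x00; exact: vge0.
  have /(val_vge _ vn) ? := r0 i; rewrite vn; congr EFin.
  by move: nr => /(val_vge _ vn); lia.
set R := \prod_(i | _) _ in vR.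
have hR : vge v (x ^+ q.-1 * R - R) 1.
  have -> : x ^+ q.-1 * R = \prod_(i | i != cl 0) (x * r i).
    rewrite big_split prodr_const /= -/R; congr (_ ^+ _ * _).
    have := cardC1 (cl 0); rewrite card_ord => <-.
    by apply: eq_card.
  have -> : R = \prod_(i | i != cl 0) r (m i).
    rewrite /R (reindex_inj m_inj); apply: eq_bigl => i.
    by rewrite m0.
  by apply: vge_prodB => i _; split=> //; apply: vgeMl.
have h : vge v (x ^+ q.-1 - 1) 1.
  have [->|/(val_ex vv)[n vn]] := eqVneq (x ^+ q.-1 - 1) 0; first exact: vge0.
  move: hR; rewrite -{2}[R]mul1r -mulrBl => /(val_vge _ (valMn vv vn vR)).
  by rewrite addr0 => ?; apply/(val_vge _ vn).
have -> : x ^+ q - x = x * (x ^+ q.-1 - 1).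
  by rewrite mulrBr mulr1 -exprS prednK // ltnW.
exact: vgeMl.
Qed.

Local Notation k := (@teichmuller K q).

Lemma teich0 : k 0.
Proof. by rewrite /teichmuller /= expr0n; case: q q1. Qed.

Lemma teich1 : k 1.
Proof. by rewrite /teichmuller /= expr1n. Qed.

Lemma teichB x y : k x -> k y -> k (x - y).
Proof.
have [f _ qf] := residue_card_pfactor; rewrite /teichmuller /= qf => kx ky.
by rewrite (exprB_pchar charK) kx ky.
Qed.

Lemma teichN x : k x -> k (- x).
Proof. by rewrite -sub0r; apply/teichB/teich0. Qed.

Lemma teichD x y : k x -> k y -> k (x + y).
Proof. by move=> kx ky; rewrite -[y]opprK; apply/teichB/teichN. Qed.

Lemma teichM x y : k x -> k y -> k (x * y).
Proof. by rewrite /teichmuller /= exprMn => -> ->. Qed.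

Lemma teichV x : k x -> k x^-1.
Proof. by rewrite /teichmuller /= exprVn => ->. Qed.

Lemma teichX x n : k x -> k (x ^+ n).
Proof.
by move=> kx; elim: n => [|n IH]; rewrite ?exprS; [exact: teich1 | apply: teichM].
Qed.

Lemma teichMn x n : k x -> k (x *+ n).
Proof.
by move=> kx; elim: n => [|n IH]; rewrite ?mulrS; [exact: teich0 | apply: teichD].
Qed.

Lemma teich_sum (I : Type) (r : seq I) (P : pred I) (f : I -> K) :
  (forall i, P i -> k (f i)) -> k (\sum_(i <- r | P i) f i).
Proof. by move=> h; elim/big_rec: _ => [|i x Pi]; [exact: teich0 | apply/teichD/h]. Qed.

Lemma teich_root m c : k c -> exists2 d, k d & d ^+ (p ^ m) = c.
Proof.
have [f f0 qf] := residue_card_pfactor => kc.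
(* A root exists because c = c^(q^m) = c^(p^(f m)), and f > 0 makes the exponent f m - m
   meaningful. *)
exists (c ^+ (p ^ (f * m - m))); first exact: teichX.
rewrite -exprM -expnD subnK; last by rewrite leq_pmull.
elim: m => [|m IH]; first by rewrite muln0 expr1.
by rewrite mulnSr expnD exprM IH -qf.
Qed.

Lemma val_teich c : k c -> c != 0 -> v c = 0%:E.
Proof.
rewrite /teichmuller /= => kc /(val_ex vv)[n vn].
have := valX vv q vn; rewrite kc vn => -[] h.
by congr EFin; nia.
Qed.

Lemma vge_teich c : k c -> vge v c 0.
Proof.
by move=> kc; have [->|c0] := eqVneq c 0; [exact: vge0 | apply/(val_vge _ (val_teich kc c0))].
Qed.

Lemma teich_eq0 c : k c -> vge v c 1 -> c = 0.
Proof. by move=> kc h; apply/eqP/contraT => /(val_teich kc) vc; move/(val_vge _ vc): h. Qed.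

(** The Teichmuller lift is the limit of x^(q^n); consecutive terms differ by (x^q - x)^(q^n), whose
    valuation is at least q^n. *)
Lemma teich_lift x : vge v x 0 -> exists2 c, k c & vge v (x - c) 1.
Proof.
move=> x0; have [f f0 qf] := residue_card_pfactor.
have xq := residue_expq x0.
pose u n := x ^+ (q ^ n).
have uS n : vge v (u n.+1 - u n) (q ^ n)%:Z.
  have -> : u n.+1 - u n = (x ^+ q - x) ^+ (q ^ n).
    by rewrite /u expnS exprM qf -expnM (exprB_pchar charK).
  by have := vgeX vv (q ^ n) xq; rewrite mul1r.
have un N n d : (N <= n)%N -> vge v (u (n + d)%N - u n) N%:Z.
  move=> Nn; elim: d => [|d IH]; first by rewrite addn0 subrr; exact: vge0.
  rewrite -[_ - _](subrKA (u (n + d)%N)) addnS; apply: vgeD => //.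
  apply: vge_le (uS _); rewrite lez_nat.
  apply: leq_trans (leq_addr d N) (leq_trans _ (ltnW (ltn_expl _ q1))).
  by rewrite leq_add2r.
have cu : val_cauchy v u.
  move=> N; exists `|N|%N => m n Nm Nn.
  apply: (vge_le (n := `|N|%N%:Z)); first by lia.
  case: (leqP m n) => mn.
    by apply: vgeBC => //; rewrite -(subnKC mn); exact: un.
  by rewrite -(subnKC (ltnW mn)); exact: un.
have [c cP] := complK cu; exists c; rewrite /teichmuller /=.
  apply/eqP; rewrite -subr_eq0; apply/eqP/(vge_eq0 vv) => N.
  have [n0 h] := cP `|N|%N%:Z; apply: (vge_le (n := `|N|%N%:Z)); first by lia.
  rewrite -[_ - _](subrKA (u n0.+1)); apply: vgeD => //; last by apply: h.
  have qB (a b : K) : a ^+ q - b ^+ q = (a - b) ^+ q.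
    by rewrite qf (exprB_pchar charK).
  rewrite /u expnSr exprM qB -/(u n0).
  apply: vge_le (vgeX vv q (vgeBC vv (h n0 (leqnn _)))); nia.
have [n0 h] := cP 1; rewrite -[_ - _](subrKA (u n0)); apply: vgeD => //; last exact: h.
apply: vgeBC => //; elim: n0 {h} => [|n IH].
  by rewrite /u expr1 subrr; exact: vge0.
rewrite -[_ - _](subrKA (u n)); apply: vgeD => //.
by apply: vge_le (uS n); rewrite lez_nat expn_gt0 ltnW.
Qed.

Lemma wp_surj m : vge v m 1 -> exists z, wp p z = m.
Proof.
(* The solution is the series - (m + m^p + m^(p^2) + ...), on which wp telescopes. *)
move=> m1; pose u n := - \sum_(i < n) m ^+ (p ^ i).
have mX i : vge v (m ^+ (p ^ i)) i%:Z.
  apply: vge_le (vgeX vv _ m1); rewrite mul1r lez_nat ltnW //.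
  by rewrite ltn_expl // prime_gt1.
have wu n : wp p (u n) = m - m ^+ (p ^ n).
  elim: n => [|n IH].
    by rewrite /wp /u big_ord0 oppr0 expr1 (expr0_pchar charK 1) !subrr.
  rewrite /wp /u big_ord_recr /= opprD -/(u n).
  rewrite (exprB1_pchar charK) -exprM -expnSr.
  by move: IH; rewrite /wp => /eqP; rewrite subr_eq => /eqP ->; ring.
have un N n d : (N <= n)%N -> vge v (u (n + d)%N - u n) N%:Z.
  move=> Nn; elim: d => [|d IH]; first by rewrite addn0 subrr; exact: vge0.
  rewrite -[_ - _](subrKA (u (n + d)%N)) addnS; apply: vgeD => //.
  rewrite /u big_ord_recr /= opprD addrAC subrr sub0r.
  apply: vgeN => //; apply: vge_le (mX _); lia.
have cu : val_cauchy v u.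
  move=> N; exists `|N|%N => i j Nm Nn.
  apply: (vge_le (n := `|N|%N%:Z)); first by lia.
  case: (leqP i j) => mn.
    by apply: vgeBC => //; rewrite -(subnKC mn); exact: un.
  by rewrite -(subnKC (ltnW mn)); exact: un.
have [z zP] := complK cu; exists z.
apply/eqP; rewrite -subr_eq0; apply/eqP/(vge_eq0 vv) => N.
have [n0 h] := zP `|N|%N%:Z; apply: (vge_le (n := `|N|%N%:Z)); first by lia.
pose n := maxn n0 `|N|%N; have hn := vgeBC vv (h n (leq_maxl _ _)).
have -> : wp p z - m = (z - u n) ^+ p - (z - u n) - m ^+ (p ^ n).
  rewrite (exprB1_pchar charK); have := wu n; rewrite /wp => /eqP.
  by rewrite subr_eq => /eqP ->; ring.
apply: vgeB => //; last by apply: vge_le (mX _); rewrite lez_nat leq_maxr.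
apply: vgeB => //; apply: vge_le (vgeX vv p hn); have := prime_gt0 pp; nia.
Qed.

End LocalField.

Section PolarParts.
Variables (p q : nat) (K : fieldType) (v : K -> \bar int) (t : K) (C : set K).
Hypotheses (charK : p \in [pchar K]) (localK : local_field v q).
Hypotheses (vt : v t = 1%:E) (complC : wp_complement p q C).

Let vv : normalized_valuation v. Proof. by case: localK. Qed.
Let pp : prime p. Proof. exact: pcharf_prime charK. Qed.

Local Notation k := (@teichmuller K q).
Let vteich := val_teich charK localK.

Lemma wpD (x y : K) : wp p (x + y) = wp p x + wp p y.
Proof. by rewrite /wp (exprD1_pchar charK); ring. Qed.

Lemma val_monom x n : k x -> x != 0 -> v (x * t ^- n) = (- n%:Z)%:E.
Proof.
move=> kx x0; rewrite (valMn vv (vteich kx x0) (valV vv (valX vv n vt))).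
by congr EFin; lia.
Qed.

Lemma vge_monom x n : k x -> vge v (x * t ^- n) (- n%:Z).
Proof.
move=> kx; have [->|x0] := eqVneq x 0; first by rewrite mul0r; exact: vge0.
exact: val_vge_refl (val_monom n kx x0).
Qed.

Lemma polar_vge (x : nat -> K) s m : (forall i, k (x i)) ->
  vge v (\sum_(i < s.+1) x i * t ^- i) (1 - m%:Z) ->
  forall i, (m <= i <= s)%N -> x i = 0.
Proof.
move=> kx h i /andP[mi si]; apply/eqP/contraT => xi0.
have dist (i1 j : 'I_s.+1) : i1 != j -> x i1 * t ^- i1 != 0 ->
    v (x i1 * t ^- i1) <> v (x j * t ^- j).
  move=> ij; rewrite mulf_eq0 negb_or => /andP[xi _].
  have [->|xj] := eqVneq (x j) 0.
    by rewrite mul0r (Defs.val0 vv) (val_monom _ (kx i1)).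
  rewrite !val_monom // => -[] e; case/eqP: ij; apply: val_inj => /=; lia.
have /= := vge_dominant vv dist h (Ordinal (si : (i < s.+1)%N)).
by move/(val_vge _ (val_monom _ (kx i) xi0)); lia.
Qed.

Lemma polar_val (x : nat -> K) s : (forall i, k (x i)) -> x s != 0 ->
  v (\sum_(i < s.+1) x i * t ^- i) = (- s%:Z)%:E.
Proof.
move=> kx xs; rewrite big_ord_recr /= addrC; apply: valD_eq => //.
  exact: val_monom.
apply: vge_sum => // i _; apply: vge_le (vge_monom _ (kx i)).
have := ltn_ord i; lia.
Qed.

Lemma polar_val_ex (x : nat -> K) m : (forall i, k (x i)) ->
  \sum_(1 <= i < m.+1) x i * t ^- i != 0 ->
  exists2 i, (1 <= i <= m)%N & v (\sum_(1 <= i < m.+1) x i * t ^- i) = (- i%:Z)%:E.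
Proof.
move=> kx; elim: m => [|m IH]; first by rewrite big_geq ?eqxx.
rewrite big_nat_recr //=; have [->|xm] := eqVneq (x m.+1) 0.
  rewrite mul0r addr0 => /IH[i /andP[i1 im] vi]; exists i => //.
  by rewrite i1 leqW.
move=> _; exists m.+1; rewrite ?leqnn // addrC; apply: valD_eq => //.
  exact: val_monom.
rewrite big_nat_cond; apply: vge_sum => // i /andP[/andP[_ im] _].
by apply: vge_le (vge_monom _ (kx i)); lia.
Qed.

Lemma polar_lift x m : vge v x (- m%:Z) ->
  exists2 c, k c & vge v (x - c * t ^- m) (1 - m%:Z).
Proof.
move=> hx; have vm := valX vv m vt.
have h0 : vge v (x * t ^+ m) 0.
  by apply: vge_le (vgeM vv hx (val_vge_refl vm)); lia.
have [c kc hc] := teich_lift charK localK h0; exists c => //.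
have t0 : t ^+ m != 0 := val_neq0 vv vm.
have -> : x - c * t ^- m = (x * t ^+ m - c) * t ^- m by rewrite mulrBl mulfK.
by apply: vge_le (vgeM vv hc (val_vge_refl (valV vv vm))); lia.
Qed.

(** Poles are treated from the highest order down. A term c t^-n with p | n is traded modulo wp for
    d t^-(n/p), where d^p = c; any other term is kept. At the end the constant is split along C, and
    the part of positive valuation lies in wp(K). *)
Lemma AS_reduction n (beta : K) : vge v beta (- n%:Z) ->
  exists z x, [/\ C (x 0%N), forall i, k (x i),
    forall i, (1 <= i)%N -> x (p * i)%N = 0,
    forall i, (n < i)%N -> x i = 0
    & beta - wp p z = \sum_(i < n.+1) x i * t ^- i].
Proof.
have [Ck _ Cex _] := complC; have p1 := prime_gt1 pp.
elim: n beta => [|n IH] beta hb.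
  rewrite oppr0 in hb; have [c kc hc] := teich_lift charK localK hb.
  have [z0 wz0] := wp_surj charK localK hc.
  have [c0 [d [Cc0 kd cE]]] := Cex c kc.
  exists (z0 + d), (fun i => if i == 0%N then c0 else 0); split=> //.
  - by move=> [|i] /=; [exact: Ck | exact: (teich0 charK localK)].
  - by move=> i i0; rewrite muln_eq0; case: p p1 i i0 => [|?] // ? [].
  - by case.
  rewrite big_ord_recr big_ord0 /= add0r expr0 invr1 mulr1 wpD wz0 cE; ring.
have [c kc hc] := polar_lift hb.
have [/dvdnP[m nm]|pn] := boolP (p %| n.+1)%N.
  have [d kd dc] := teich_root charK localK 1 kc; rewrite expn1 in dc.
  have wdt : wp p (d * t ^- m) = c * t ^- n.+1 - d * t ^- m.
    by rewrite /wp exprMn dc exprVn -exprM -nm.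
  have [|z [x [C0x kx px xn bz]]] := IH (beta - wp p (d * t ^- m)).
    rewrite wdt opprB addrCA; apply: vgeD => //; last by apply: vge_le hc; lia.
    apply: vge_le (vge_monom m kd); nia.
  exists (z + d * t ^- m), x; split=> //.
    by move=> i ni; apply: xn; apply: leq_trans ni.
  rewrite big_ord_recr /= xn // mul0r addr0 -bz wpD; ring.
have [|z [x [C0x kx px xn bz]]] := IH (beta - c * t ^- n.+1).
  by apply: vge_le hc; lia.
exists z, (fun i => if i == n.+1 then c else x i); split=> //=.
- by move=> i; case: ifP.
- move=> i i1; case: eqP => [e|_]; last exact: px.
  by case/negP: pn; rewrite -e dvdn_mulr.
- by move=> i ni; rewrite gtn_eqF //; apply: xn; apply: leq_trans ni.
rewrite big_ord_recr /= eqxx.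
have -> : \sum_(i < n.+1) (if (i : nat) == n.+1 then c else x i) * t ^- i =
    \sum_(i < n.+1) x i * t ^- i.
  by apply: eq_bigr => i _; rewrite ltn_eqF.
by rewrite -bz; ring.
Qed.

Lemma val_ge_nat (beta : K) : exists n : nat, vge v beta (- n%:Z).
Proof.
have [->|/(val_ex vv)[n vn]] := eqVneq beta 0; first by exists 0%N; exact: vge0.
by exists `|n|%N; apply/(val_vge _ vn); lia.
Qed.

Lemma AS_reduction_ex (beta : K) : exists z, AS_reduced p q C t (beta - wp p z).
Proof.
have [n hn] := val_ge_nat beta.
have [z [x [C0x kx px xn bz]]] := AS_reduction hn.
by exists z; exists n, x; split=> //; rewrite bz big_mkord.
Qed.

Lemma AS_reducedB x y : AS_reduced p q C t x -> AS_reduced p q C t y ->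
  AS_reduced p q C t (x - y).
Proof.
have [_ [_ CB] _ _] := complC.
have k0 := teich0 charK localK.
move=> [s [f [f0 kf pf ->]]] [r [g [g0 kg pg ->]]].
pose trunc n (h : nat -> K) i := if (i <= n)%N then h i else 0.
have truncE n m (h : nat -> K) : (n <= m)%N ->
    \sum_(0 <= i < n.+1) h i * t ^- i = \sum_(0 <= i < m.+1) trunc n h i * t ^- i.
  move=> nm; rewrite [RHS](big_cat_nat _ (n := n.+1)) //= [X in _ = _ + X]big1_seq.
    rewrite addr0 [RHS]big_nat_cond [LHS]big_nat_cond.
    apply: eq_bigr => i; rewrite andbT ltnS => /andP[_ i_n].
    by rewrite /trunc i_n.
  move=> i /andP[_]; rewrite mem_index_iota => /andP[ni _].
  by rewrite /trunc leqNgt ni /= mul0r.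
exists (maxn s r), (fun i => trunc s f i - trunc r g i); split.
- exact: CB.
- move=> i; apply: (teichB charK localK); rewrite /trunc; case: ifP => //.
- move=> i i1; rewrite /trunc pf // pg //; do 2 case: ifP => _; exact: subrr.
rewrite (truncE s (maxn s r)) ?leq_maxl // (truncE r (maxn s r)) ?leq_maxr //.
by rewrite -sumrB; apply: eq_bigr => i _; rewrite mulrBl.
Qed.

End PolarParts.

(** * Totally ramified extensions and the break *)

Lemma ord_dist n (i j : 'I_n) (d : int) :
  i != j -> (i : nat)%:Z - (j : nat)%:Z <> n%:Z * d.
Proof.
move=> ij h; case/eqP: ij; apply: val_inj => /=.
have := ltn_ord i; have := ltn_ord j.
case: (ltrgtP d 0) h => [d0|d0|->]; last by lia.
  have : n%:Z * d <= - n%:Z by nia.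
  lia.
have : n%:Z <= n%:Z * d by nia.
lia.
Qed.

Section RamifiedExtension.
Variables (K : fieldType) (L : splittingFieldType K).
Variables (vK : K -> \bar int) (v : L -> \bar int).
Hypotheses (vvK : normalized_valuation vK) (vv : normalized_valuation v).
Hypothesis ramLK : totally_ramified vK v.

Local Notation n := (\dim {:L}).

Lemma dim_fullv_gt0 : (0 < n)%N.
Proof. exact: adim_gt0. Qed.

Lemma val_alg x m : vK x = m%:E -> v x%:A = (n%:Z * m)%:E.
Proof. by move=> vx; rewrite ramLK vx. Qed.

Lemma val_alg_inv x m : v x%:A = (n%:Z * m)%:E -> vK x = m%:E.
Proof.
have n0 := dim_fullv_gt0.
have [->|/(val_ex vvK)[a va]] := eqVneq x 0; first by rewrite scale0r (Defs.val0 vv).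
by rewrite (val_alg va) va => -[] h; congr EFin; nia.
Qed.

Lemma vge_alg x m : vge vK x m <-> vge v x%:A (n%:Z * m).
Proof.
have n0 := dim_fullv_gt0.
have [->|/(val_ex vvK)[a va]] := eqVneq x 0.
  by rewrite scale0r; split=> _; exact: vge0.
split; first by move/(val_vge _ va) => h; apply/(val_vge _ (val_alg va)); nia.
by move/(val_vge _ (val_alg va)) => h; apply/(val_vge _ va); nia.
Qed.

Lemma vge_alg0 x : vge vK x 0 <-> vge v x%:A 0.
Proof. by rewrite vge_alg mulr0. Qed.

Lemma vge_alg1 x : vge vK x 1 <-> vge v x%:A 1.
Proof.
have n0 := dim_fullv_gt0.
rewrite vge_alg mulr1; split; first by apply: vge_le; lia.
have [->|/(val_ex vvK)[a va]] := eqVneq x 0; first by rewrite scale0r => _; exact: vge0.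
move/(val_vge _ (val_alg va)) => h; have a1 : 1 <= a by nia.
by apply/(val_vge _ (val_alg va)); nia.
Qed.

Section Independent.
Variables (m : nat) (z : 'I_m -> L) (a : 'I_m -> int).
Hypothesis vz : forall i, v (z i) = (a i)%:E.
Hypothesis a_dist : forall (i j : 'I_m) (d : int), i != j -> a i - a j <> n%:Z * d.

Lemma val_scaled x i : v (x *: z i) = (v x%:A + (a i)%:E)%E.
Proof. by rewrite -[x *: z i]mulr_algl (Defs.valM vv) vz. Qed.

(** Scalars from K have valuations in [L : K] Z, so multiples of elements with incongruent
    valuations never meet. Such elements are therefore free over K, and a bound on a combination
    bounds each of its terms. *)
Lemma val_scaled_dist (c : 'I_m -> K) (i j : 'I_m) :
  i != j -> c i *: z i != 0 -> v (c i *: z i) <> v (c j *: z j).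
Proof.
move=> ij; have [->|ci] := eqVneq (c i) 0; first by rewrite scale0r eqxx.
move=> _; rewrite !val_scaled.
have [ai vi] := val_ex vvK ci; rewrite (val_alg vi).
have [->|/(val_ex vvK)[aj vj]] := eqVneq (c j) 0.
  by rewrite scale0r (Defs.val0 vv).
rewrite (val_alg vj) => -[] h; apply: (a_dist (d := aj - ai) ij); rewrite mulrBr. lia.
Qed.

Lemma vge_scaled (c : 'I_m -> K) e :
  vge v (\sum_i c i *: z i) e -> forall i, vge v (c i *: z i) e.
Proof. by apply: vge_dominant => // i j; exact: val_scaled_dist. Qed.

Lemma scaled_sum_ex (U : {vspace L}) : m = \dim U -> (forall i, z i \in U) ->
  forall x, x \in U -> exists c : 'I_m -> K, x = \sum_i c i *: z i.
Proof.
move=> mU zU x xU; pose Z := [tuple z i | i < m].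
have ZE (i : 'I_m) : Z`_i = z i by rewrite -tnth_nth tnth_mktuple.
have fZ : free Z.
  apply/freeP => c; under eq_bigr do rewrite ZE.
  move=> s0 i; have := dominant_eq0 vv (@val_scaled_dist c) s0 i.
  move/eqP; rewrite scaler_eq0 => /orP[/eqP //|/eqP z0].
  by have := vz i; rewrite z0 (Defs.val0 vv).
have bZ : basis_of U Z.
  rewrite basisEfree fZ size_tuple -mU leqnn andbT /=.
  by apply/span_subvP => _ /mapP[i _ ->].
exists (fun i => coord Z i x); rewrite {1}(coord_basis bZ xU).
by apply: eq_bigr => i _; rewrite ZE.
Qed.

End Independent.

Lemma pi_expansion pi x : v pi = 1%:E ->
  exists2 c : 'I_n -> K, x = \sum_i c i *: pi ^+ i &
    forall e, vge v x e -> forall i, vge v (c i *: pi ^+ i) e.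
Proof.
move=> vpi; have vX (i : 'I_n) : v (pi ^+ i) = (i : nat)%:Z%:E.
  by rewrite (valX vv _ vpi) mul1r.
have [c xE] := scaled_sum_ex vX (@ord_dist n) (erefl _) (fun i => memvf _) (memvf x).
by exists c => // e; rewrite {1}xE => h i; exact: (vge_scaled vX (@ord_dist n) h).
Qed.

Lemma pi_expansion_ge0 pi c i : v pi = 1%:E -> (i < n)%N ->
  vge v (c *: pi ^+ i) 0 -> vge vK c 0.
Proof.
move=> vpi iN; have [->|/(val_ex vvK)[a va]] := eqVneq c 0; first by move=> _; exact: vge0.
rewrite -mulr_algl => /(val_vge _ (valMn vv (val_alg va) (valX vv i vpi))) h.
by apply/(val_vge _ va); nia.
Qed.

(** Total ramification makes the residue extension trivial: the constant coefficient of the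
    expansion in powers of a uniformizer represents the residue class. *)
Lemma residue_ext x : vge v x 0 ->
  exists2 c, vge vK c 0 & vge v (x - c%:A) 1.
Proof.
have [pi vpi] := val_surj vv.
have [c -> ce] := pi_expansion x vpi; move/ce => c0.
pose i0 := Ordinal dim_fullv_gt0.
exists (c i0); first exact: pi_expansion_ge0 vpi dim_fullv_gt0 (c0 i0).
rewrite (bigD1 i0) //= expr0 addrAC subrr add0r; apply: vge_sum => // i ii0.
have /vge_alg0 h := pi_expansion_ge0 vpi (ltn_ord i) (c0 i).
rewrite -mulr_algl; apply: vgeMl => //.
apply/(val_vge _ (valX vv _ vpi)); rewrite mul1r lez_nat lt0n.
by apply: contraNneq ii0 => e; apply/eqP/val_inj.
Qed.

Lemma gal_alg (s : gal_of {:L}) x : s x%:A = x%:A.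
Proof. by rewrite linearZ /= rmorph1. Qed.

Variable b : nat.
Hypothesis b1 : (1 <= b)%N.
Hypothesis breakLK : single_break v b.

(** The break makes [s pi] a uniformizer too, so the expansions of x in powers of [pi] and of s x in
    powers of [s pi] have termwise equal valuations, and each is decided by its smallest term. *)
Lemma val_gal (s : gal_of {:L}) x : s \in 'Gal({:L} / 1%AS)%g -> v (s x) = v x.
Proof.
have [pi vpi piP] := breakLK => sG.
have [->|s1] := eqVneq s 1%g; first by rewrite gal_id.
have vspi : v (s pi) = 1%:E.
  rewrite -[s pi](subrK pi) addrC; apply: valD_eq => //.
  by rewrite /vge piP // lee_fin; lia.
have vX y (i : 'I_n) : v y = 1%:E -> v (y ^+ i) = (i : nat)%:Z%:E.
  by move=> vy; rewrite (valX vv _ vy) mul1r.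
have [c -> _] := pi_expansion x vpi.
have vc i : v (c i *: s pi ^+ i) = v (c i *: pi ^+ i).
  by rewrite -[in LHS]mulr_algl -[in RHS]mulr_algl !(Defs.valM vv) !vX.
rewrite rmorph_sum /=; under eq_bigr do rewrite linearZ rmorphXn /=.
have [i -> imin] :=
  val_dominant vv (val_scaled_dist (fun i => vX _ i vspi) (@ord_dist n) (c := c)).
have [j -> jmin] :=
  val_dominant vv (val_scaled_dist (fun i => vX _ i vpi) (@ord_dist n) (c := c)).
apply/eqP; rewrite eq_le; apply/andP; split.
  by case: j jmin => [j|] //= _; [rewrite -vc | rewrite leey].
by case: i imin => [i|] //= _; [rewrite vc | rewrite leey].
Qed.

Lemma vge_gal (s : gal_of {:L}) x m :
  s \in 'Gal({:L} / 1%AS)%g -> vge v x m -> vge v (s x) m.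
Proof. by move=> sG; rewrite /vge val_gal. Qed.

End RamifiedExtension.

(** * Integral polynomials and binomial estimates *)

Section IntegralPolynomials.
Variables (F : fieldType) (v : F -> \bar int).
Hypothesis vv : normalized_valuation v.

Definition integral_poly (f : {poly F}) := forall i, vge v f`_i 0.

Lemma integral_polyM f g :
  integral_poly f -> integral_poly g -> integral_poly (f * g).
Proof. by move=> hf hg i; rewrite coefM; apply: vge_sum => // j _; apply: vgeMl. Qed.

Lemma integral_polyXsubC a : vge v a 0 -> integral_poly ('X - a%:P).
Proof.
move=> ha i; rewrite coefB coefX coefC; apply: vgeB => //.
  by case: eqP => _; [exact: vge1 | exact: vge0].
by case: eqP => _ //; exact: vge0.
Qed.

Lemma integral_poly_prod (I : Type) (r : seq I) (P : pred I) (f : I -> {poly F}) :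
  (forall i, P i -> integral_poly (f i)) ->
  integral_poly (\prod_(i <- r | P i) f i).
Proof.
move=> h; elim/big_rec: _ => [i|i g Pi]; last by apply/integral_polyM/h.
by rewrite coef1; case: eqP => _; [exact: vge1 | exact: vge0].
Qed.

Lemma integral_poly_horner f a : integral_poly f -> vge v a 0 -> vge v f.[a] 0.
Proof.
move=> hf ha; rewrite horner_coef; apply: vge_sum => // i _.
by apply: vgeMl => //; exact: vgeX0.
Qed.

(** Coefficients of the quotient are recovered from the top: f_i is the coefficient of degree i + 1
    of the product plus a f_(i+1). *)
Lemma integral_poly_quo f a :
  vge v a 0 -> integral_poly (f * ('X - a%:P)) -> integral_poly f.
Proof.
move=> ha hf; suff h m i : (size f <= i + m)%N -> vge v f`_i 0.
  by move=> i; apply: (h (size f)); exact: leq_addl.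
elim: m i => [|m IH] i hi.
  by rewrite addn0 in hi; rewrite nth_default //; exact: vge0.
have := hf i.+1; rewrite mulrBr coefB coefMX coefMC /= => h1.
rewrite -[f`_i](subrK (f`_i.+1 * a)); apply: vgeD => //.
by rewrite mulrC; apply/vgeMl/IH => //; rewrite addSnnS.
Qed.

Lemma integral_poly_roots f rs : integral_poly f -> uniq rs ->
  (forall a, a \in rs -> vge v a 0) -> (forall a, a \in rs -> root f a) ->
  exists2 h, integral_poly h & f = h * \prod_(a <- rs) ('X - a%:P).
Proof.
elim: rs f => [|a rs IH] f hf; first by exists f; rewrite // big_nil mulr1.
rewrite cons_uniq => /andP[ars urs] rs0 fr.
have [g fg] : exists g, f = g * ('X - a%:P).
  by apply/factor_theorem/fr; rewrite inE eqxx.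
have hg : integral_poly g.
  by apply: (@integral_poly_quo _ a); [apply: rs0; rewrite inE eqxx | rewrite -fg].
have [||h hh gh] := IH g hg urs.
- by move=> c crs; apply: rs0; rewrite inE crs orbT.
- move=> c crs; have := fr c; rewrite inE crs orbT => /(_ isT).
  rewrite fg rootM => /orP[//|]; rewrite root_XsubC => /eqP ca.
  by move: ars; rewrite -ca crs.
exists h => //; rewrite big_cons {1}fg {1}gh; ring.
Qed.

Lemma vge_expr1D e (x : F) i : 0 <= e -> vge v x e -> vge v ((1 + x) ^+ i - 1) e.
Proof.
move=> e0 hx; have x0 : vge v x 0 := vge_le e0 hx.
elim: i => [|i IH]; first by rewrite expr0 subrr; exact: vge0.
rewrite exprS (_ : _ - 1 = (1 + x) * ((1 + x) ^+ i - 1) + x); last by ring.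
by apply: vgeD => //; apply: vgeMl => //; apply: vgeD => //; exact: vge1.
Qed.

Lemma vge_expr1D2 e (x : F) i : 0 <= e -> vge v x e ->
  vge v ((1 + x) ^+ i - 1 - i%:R * x) (e + e).
Proof.
move=> e0 hx; have x0 : vge v x 0 := vge_le e0 hx.
elim: i => [|i IH]; first by rewrite expr0 mul0r !subrr; exact: vge0.
rewrite exprS (_ : _ - _ = ((1 + x) ^+ i - 1 - i%:R * x)
   + x * ((1 + x) ^+ i - 1)); last by rewrite -natr1; ring.
by apply: vgeD => //; apply: vgeM => //; exact: vge_expr1D.
Qed.

Lemma val_natr p i : p \in [pchar F] -> ~~ (p %| i)%N -> v i%:R = 0%:E.
Proof.
move=> charF pi; have i0 : i%:R != 0 :> F by rewrite -(dvdn_pcharf charF).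
have [n vn] := val_ex vv i0.
have := valX vv p vn; rewrite (natr1_pchar charF) vn => -[] h.
have := prime_gt1 (pcharf_prime charF) => p1.
by congr EFin; nia.
Qed.

End IntegralPolynomials.

(** * The pole of an Artin-Schreier generator and the ramification break *)

Section RamificationBreak.
Variables (p nu : nat) (K : fieldType) (L : splittingFieldType K).
Variables (vK : K -> \bar int) (v : L -> \bar int).
Hypotheses (charK : p \in [pchar K]).
Hypotheses (vvK : normalized_valuation vK) (vv : normalized_valuation v).
Hypothesis ramLK : totally_ramified vK v.
Hypothesis galLK : galois 1%AS {:L}.
Hypothesis oG : #|'Gal({:L} / 1%AS)%g| = (p ^ nu.+1)%N.

Let pp : prime p. Proof. exact: pcharf_prime charK. Qed.
Let p0 : (0 < p)%N. Proof. exact: prime_gt0. Qed.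
Local Notation G := 'Gal({:L} / 1%AS)%g.

Lemma pchar_ext : p \in [pchar L].
Proof. by rewrite pchar_lalg. Qed.
Let charL := pchar_ext.

(** The rank is positive and from here on written [nu.+1]; thus [p ^ nu] is the degree of L over a
    subfield K(y) of degree p. *)
Lemma dim_ext : \dim {:L} = (p ^ nu.+1)%N.
Proof. by rewrite -oG -(galois_dim galLK) dimv1 divn1. Qed.

Section Generator.
Variables (y : L) (beta : K) (s : nat).
Hypotheses (yP : y ^+ p - y = beta%:A) (ps : ~~ (p %| s)%N).
Hypothesis vy : v y = (- (s * p ^ nu)%N%:Z)%:E.

Local Notation M := <<1%AS; y>>%AS.
Local Notation H := 'Gal({:L} / M)%g.

Let P1 : (0 < p ^ nu)%N. Proof. by rewrite expn_gt0 p0. Qed.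
Let PZ0 : (p ^ nu)%N%:Z != 0. Proof. by rewrite lt0r_neq0. Qed.

(** The degree is a power of p and at most p. It is not 1, since elements of K have valuations
    divisible by p^(nu+1) while p does not divide s. *)
Lemma AS_gen_dim : \dim M = p.
Proof.
have rp : root ('X^p - 'X - (beta%:A)%:P) y.
  by rewrite /root !hornerE -yP subrr.
have op : 'X^p - 'X - (beta%:A)%:P \is a polyOver (1%VS : {vspace L}).
  by rewrite rpredB ?rpredB ?rpredX ?polyOverX // polyOverC rpredZ // rpred1.
have sz : size ('X^p - 'X - (beta%:A)%:P : {poly L}) = p.+1.
  rewrite -addrA size_polyDl ?size_polyXn //.
  by rewrite -opprD size_polyN size_XaddC ltnS prime_gt1.
have hle : (\dim M <= p)%N.
  rewrite dim_Fadjoin dimv1 muln1 -ltnS -size_minPoly -sz.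
  apply: dvdp_leq; first by rewrite -size_poly_gt0 sz.
  exact: minPoly_dvdp.
have : (\dim M %| p ^ nu.+1)%N by rewrite -dim_ext field_dimS ?subvf.
case/(dvdn_pfactor _ _ pp) => m _ mE.
have m0 : m != 0%N.
  apply/eqP => m0; rewrite m0 in mE.
  have yM : y \in M by exact: memv_adjoin.
  have M1 : (1%VS <= M)%VS by exact: sub1v.
  have : (M : {vspace L}) == 1%VS by rewrite eq_sym eqEdim M1 mE dimv1.
  move/eqP => e; rewrite e in yM; case/vlineP: yM => c yc.
  have c0 : c != 0.
    apply/eqP => c0; move: (val_neq0 vv vy).
    by rewrite yc c0 scale0r eqxx.
  have [a va] := val_ex vvK c0; move: vy; rewrite yc (val_alg ramLK va) dim_ext.
  move=> -[]; rewrite expnS !PoszM => h.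
  case/negP: ps; suff: (p%:Z %| s%:Z)%Z by [].
  apply/dvdzP; exists (- a); apply: (mulIf PZ0); lia.
by move: hle; rewrite mE -{2}[p]expn1 leq_exp2l ?prime_gt1 //; case: m m0 {mE} => [|[|]].
Qed.

Lemma AS_gen_card : #|H| = (p ^ nu)%N.
Proof.
have gM : galois M {:L}.
  by apply: galoisS galLK; rewrite sub1v subvf.
by rewrite -(galois_dim gM) AS_gen_dim dim_ext expnS mulKn.
Qed.

Lemma AS_gen_fixed x : (forall tau, tau \in H -> tau x = x) -> x \in M.
Proof.
have gM : galois M {:L} by apply: galoisS galLK; rewrite sub1v subvf.
by move=> h; have /galois_fixedField <- := gM; apply/fixedFieldP; rewrite ?memvf.
Qed.

(** As p does not divide s, the valuations of y^i for i < p are incongruent modulo p^(nu+1). *)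
Lemma AS_gen_expansion x : x \in M ->
  exists2 c : 'I_p -> K, x = \sum_i c i *: y ^+ i &
    forall e, vge v x e -> forall i, vge v (c i *: y ^+ i) e.
Proof.
move=> xM.
have vX (i : 'I_p) : v (y ^+ i) = (- (s * p ^ nu)%N%:Z * (i : nat)%:Z)%:E.
  by rewrite (valX vv _ vy).
have dist (i j : 'I_p) (d : int) : i != j ->
    - (s * p ^ nu)%N%:Z * (i : nat)%:Z - - (s * p ^ nu)%N%:Z * (j : nat)%:Z
      <> (\dim {:L})%:Z * d.
  move=> ij; rewrite dim_ext expnS !PoszM => h.
  have e : s%:Z * ((j : nat)%:Z - (i : nat)%:Z) = d * p%:Z.
    by apply: (mulIf PZ0); lia.
  have : (p %| s * `|(j : nat)%:Z - (i : nat)%:Z|)%N.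
    rewrite -[s]absz_nat -abszM.
    by suff: (p%:Z %| s%:Z * ((j : nat)%:Z - (i : nat)%:Z))%Z; [|apply/dvdzP; exists d].
  rewrite Euclid_dvdM // (negPf ps) /= => dij; case/eqP: ij; apply: val_inj => /=.
  have := ltn_ord i; have := ltn_ord j.
  case: (posnP `|(j : nat)%:Z - (i : nat)%:Z|) => [|j0]; first by lia.
  by have := dvdn_leq j0 dij; lia.
have [|c xE] := scaled_sum_ex vvK vv ramLK vX dist (esym AS_gen_dim) _ xM.
  by move=> i; rewrite rpredX // memv_adjoin.
by exists c => // e; rewrite {1}xE => h i; exact: (vge_scaled vvK vv ramLK vX dist h).
Qed.

Variable sigma : gal_of {:L}.
Hypotheses (sG : sigma \in G) (sy : sigma y != y).

Let delta := sigma y - y.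

Lemma AS_gen_delta : exists2 i, ~~ (p %| i)%N & delta = i%:R.
Proof.
have [i ip syi] : exists2 i, (i < p)%N & sigma y = y + i%:R.
  apply: (AS_roots charL).
  by have := congr1 sigma yP; rewrite rmorphB rmorphXn /= gal_alg -yP.
exists i; last by rewrite /delta syi addrAC subrr add0r.
by rewrite (dvdn_pcharf charL); apply: contraNneq sy => i0; rewrite syi i0 addr0.
Qed.

Lemma val_AS_gen_delta : v delta = 0%:E.
Proof. by have [i pi ->] := AS_gen_delta; exact: val_natr charL pi. Qed.

Lemma vge_AS_gen_quo : v (delta / y) = (s * p ^ nu)%N%:Z%:E.
Proof. by rewrite (valMz vv val_AS_gen_delta vy); congr EFin; lia. Qed.

Lemma AS_gen_galE i : sigma y ^+ i - y ^+ i = y ^+ i * ((1 + delta / y) ^+ i - 1).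
Proof.
have y0 := val_neq0 vv vy.
have {1}-> : sigma y = y * (1 + delta / y).
  by rewrite mulrDr mulr1 mulrCA divff // mulr1 /delta addrC subrK.
by rewrite exprMn mulrBr mulr1.
Qed.

(** A term c_i y^i with 0 < i < p has valuation p^nu (p a - s i), which is nonnegative and nonzero,
    hence at least p^nu. Replacing y by [sigma y] = y (1 + delta / y) gains another s p^nu. *)
Lemma vge_gal_AS_gen x : x \in M -> vge v x 0 ->
  vge v (sigma x - x) ((s.+1 * p ^ nu)%N%:Z).
Proof.
move=> xM x0; have [c xE hc] := AS_gen_expansion xM.
rewrite xE rmorph_sum -sumrB; apply: vge_sum => // i _ /=.
rewrite linearZ rmorphXn -scalerBr /= AS_gen_galE scalerAl.
have hq := val_vge_refl vge_AS_gen_quo.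
have [i0|i0] := posnP i; first by rewrite i0 expr0 subrr mulr0; exact: vge0.
have [->|ci] := eqVneq (c i) 0; first by rewrite scale0r mul0r; exact: vge0.
have [a va] := val_ex vvK ci.
have h1 : vge v (c i *: y ^+ i) (p ^ nu)%N%:Z.
  have := hc 0 x0 i; rewrite -[_ *: _]mulr_algl.
  have vw := valMn vv (val_alg ramLK va) (valX vv i vy).
  move/(val_vge _ vw) => h; apply/(val_vge _ vw); move: h.
  rewrite dim_ext expnS !PoszM => h.
  have PZ : 0 < (p ^ nu)%N%:Z by rewrite ltz_nat.
  have h2 : 0 <= p%:Z * a - s%:Z * (i : nat)%:Z.
    by rewrite -(pmulr_rge0 _ PZ); lia.
  have h3 : p%:Z * a - s%:Z * (i : nat)%:Z != 0.
    apply/eqP => e; have : (p %| s * i)%N.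
      suff: (p%:Z %| (s * i)%N%:Z)%Z by [].
      by apply/dvdzP; exists a; lia.
    rewrite Euclid_dvdM // (negPf ps) /= => /(dvdn_leq i0).
    by have := ltn_ord i; lia.
  have h4 : 1 <= p%:Z * a - s%:Z * (i : nat)%:Z by lia.
  have : (p ^ nu)%N%:Z * 1 <= (p ^ nu)%N%:Z * (p%:Z * a - s%:Z * (i : nat)%:Z).
    by rewrite ler_pM2l.
  lia.
apply: vge_le (vgeM vv h1 (vge_expr1D vv i _ hq)); last by lia.
by rewrite mulSn PoszD.
Qed.

Variable b : nat.
Hypothesis b1 : (1 <= b)%N.
Hypothesis breakLK : single_break v b.

Lemma val_gal_coset (pi : L) tau :
  (forall rho, rho \in G -> rho != 1%g -> v (rho pi - pi) = b.+1%:Z%:E) ->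
  tau \in H -> v (sigma (tau pi) - pi) = b.+1%:Z%:E.
Proof.
move=> piP tH; rewrite -galM ?memvf //; apply: piP.
  by rewrite groupM // (fintype.subsetP (galS _ _) _ tH) ?sub1v.
apply/eqP => ts1; case/eqP: sy.
have : (tau * sigma)%g y = y by rewrite ts1 gal_id.
by rewrite galM ?memvf // (fixed_gal _ tH) ?subvf ?memv_adjoin.
Qed.

Let sum_coset : (\sum_(tau in H) b.+1%:Z = (b.+1 * p ^ nu)%N%:Z :> int).
Proof. by rewrite sumr_const AS_gen_card pmulrn mulrzz -PoszM. Qed.

(* The minimal polynomial f of pi over K(y) has integral coefficients in K(y), so
   that sigma f - f is divisible by y^-1 times a uniformizer of K(y); evaluate at pi. *)
Lemma AS_break_le : (s <= b)%N.
Proof.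
have [pi vpi piP] := breakLK.
have pi0 : vge v pi 0 by apply/(val_vge _ vpi).
pose f := \prod_(tau in H) ('X - (tau pi)%:P).
have HG tau : tau \in H -> tau \in G by apply/fintype.subsetP/galS; exact: sub1v.
have fint : integral_poly v f.
  apply: integral_poly_prod => // tau /HG tG; apply: integral_polyXsubC => //.
  exact: (vge_gal vvK vv ramLK b1 breakLK).
have fM i : f`_i \in M.
  apply: AS_gen_fixed => tau tH; rewrite -[LHS]coef_map /=.
  suff -> : map_poly tau f = f by [].
  rewrite /f rmorph_prod [RHS](reindex_inj (mulIg tau)) /=.
  apply: eq_big => [rho|rho _]; first by rewrite groupMr.
  by rewrite rmorphB /= map_polyX map_polyC /= galM ?memvf.
have f0 : f.[pi] = 0.
  rewrite /f (bigD1 1%g) //= gal_id hornerM hornerXsubC subrr mul0r //.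
have vsf : v (map_poly sigma f).[pi] = (b.+1 * p ^ nu)%N%:Z%:E.
  rewrite /f rmorph_prod horner_prod /= -sum_coset.
  apply: (val_prod vv) => tau tH.
  rewrite rmorphB /= map_polyX map_polyC hornerXsubC /= -(val_gal_coset piP tH).
  by rewrite -opprB (valN vv).
have : vge v ((map_poly sigma f).[pi] - f.[pi]) (s.+1 * p ^ nu)%N%:Z.
  rewrite !horner_coef size_map_poly -sumrB; apply: vge_sum => // i _.
  rewrite coef_map /= -mulrBl mulrC; apply: vgeMl => //; first exact: vgeX0.
  exact: vge_gal_AS_gen.
by rewrite f0 subr0 => /(val_vge _ vsf); rewrite lez_nat leq_pmul2r // ltnS.
Qed.

(* x = y^a t^c is a uniformizer of K(y). Writing x = g(pi) with g over K, the
   polynomial g - sigma x vanishes at every sigma tau pi with tau fixing y. *)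
Lemma AS_break_ge : (0 < s)%N -> (b <= s)%N.
Proof.
move=> s0; have [pi vpi piP] := breakLK.
have pi0 : vge v pi 0 by apply/(val_vge _ vpi).
have HG tau : tau \in H -> tau \in G by apply/fintype.subsetP/galS; exact: sub1v.
have [t vt] := val_surj vvK.
(* Bezout gives c p = a s + 1. This makes the valuation of y^a t^c equal to p^nu and keeps a prime
   to p. *)
have [c a ca _] := egcdnP s p0.
have gps : gcdn p s = 1%N by apply/eqP; rewrite -/(coprime p s) prime_coprime.
rewrite gps in ca.
have pa : ~~ (p %| a)%N.
  apply/negP => pa; have : (p %| 1)%N.
    by rewrite -(@dvdn_addr (a * s)%N) ?dvdn_mulr // -ca dvdn_mull.
  by rewrite dvdn1 => /eqP p1; move: pp; rewrite p1.
pose x := y ^+ a * (t ^+ c)%:A.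
have vx : v x = (p ^ nu)%N%:Z%:E.
  rewrite (valMn vv (valX vv a vy) (val_alg ramLK (valX vvK c vt))).
  congr EFin; rewrite dim_ext expnS !PoszM.
  have {}ca : c%:Z * p%:Z = a%:Z * s%:Z + 1 by lia.
  have : (p ^ nu)%N%:Z * (c%:Z * p%:Z) = (p ^ nu)%N%:Z * (a%:Z * s%:Z + 1).
    by rewrite ca.
  lia.
have sx : sigma x - x = x * ((1 + delta / y) ^+ a - 1).
  rewrite /x rmorphM /= gal_alg rmorphXn /= -mulrBl AS_gen_galE.
  by ring.
have vsx : v (sigma x - x) = (s.+1 * p ^ nu)%N%:Z%:E.
  have hq := val_vge_refl vge_AS_gen_quo.
  (* The linear term a delta / y dominates, a being a unit and delta / y of positive valuation. *)
  have va : v ((1 + delta / y) ^+ a - 1) = (s * p ^ nu)%N%:Z%:E.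
    have vaq := valMn vv (val_natr vv charL pa) vge_AS_gen_quo.
    rewrite add0r in vaq.
    rewrite -[X in v X](subrK (a%:R * (delta / y))) addrC.
    apply: (valD_eq vv vaq); apply: vge_le (vge_expr1D2 vv a _ hq) => //.
    by rewrite lerD2l lez_nat muln_gt0 s0.
  by rewrite sx (valMn vv vx va) mulSn PoszD.
have [g xE hg] := pi_expansion vvK vv ramLK x vpi.
pose f := \sum_i (g i)%:A *: 'X^i : {poly L}.
have fE z : f.[z] = \sum_i g i *: z ^+ i.
  rewrite /f horner_sum; apply: eq_bigr => i _.
  by rewrite hornerZ hornerXn mulr_algl.
have fint : integral_poly v f.
  move=> i; rewrite /f coef_sum; apply: vge_sum => // j _.
  rewrite coefZ coefXn; apply: vgeMl => //.
    apply/(vge_alg0 vvK vv ramLK)/(pi_expansion_ge0 vvK vv ramLK vpi (ltn_ord j)).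
    by apply: hg; apply/(val_vge _ vx).
  by case: eqP => _; [exact: vge1 | exact: vge0].
have sx0 : vge v (sigma x) 0.
  by apply: (vge_gal vvK vv ramLK b1 breakLK) => //; apply/(val_vge _ vx).
pose f1 := f - (sigma x)%:P.
have f1int : integral_poly v f1.
  move=> i; rewrite coefB coefC; apply: vgeB => //.
  by case: eqP => _ //; exact: vge0.
have tx tau : tau \in H -> tau x = x.
  move=> tH; rewrite /x rmorphM /= gal_alg rmorphXn /= (fixed_gal _ tH) ?subvf //.
  exact: memv_adjoin.
have pi_inj : {in H &, injective (fun tau : gal_of {:L} => sigma (tau pi))}.
  move=> t1 t2 t1H t2H /fmorph_inj e; apply/eqP/contraT => t12.
  have := piP (t1 * t2^-1)%g; rewrite groupM ?groupV ?HG // => /(_ isT).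
  rewrite -eq_mulgV1 => /(_ t12); rewrite galM ?memvf // e -galM ?memvf //.
  by rewrite mulgV gal_id subrr (Defs.val0 vv).
have [|||h hint f1h] := @integral_poly_roots _ _ vv f1
    [seq sigma (tau pi) | tau : gal_of {:L} <- enum H] f1int.
- rewrite map_inj_in_uniq ?enum_uniq // => t1 t2.
  by rewrite !mem_enum; exact: pi_inj.
- move=> z /mapP[tau]; rewrite mem_enum => /HG tG ->.
  by do 2 apply: (vge_gal vvK vv ramLK b1 breakLK) => //.
- move=> z /mapP[tau]; rewrite mem_enum => tH ->.
  rewrite /root /f1 !hornerE fE -(tx _ tH) subr_eq0; apply/eqP.
  rewrite xE !rmorph_sum; apply: eq_bigr => i _.
  by rewrite /= !linearZ /= !rmorphXn.
have : vge v (f1.[pi]) (b.+1 * p ^ nu)%N%:Z.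
  rewrite f1h hornerM; apply: vgeMl => //; first exact: integral_poly_horner.
  rewrite horner_prod big_map big_enum /= -sum_coset; apply: val_vge_refl.
  apply: (val_prod vv) => tau tH.
  rewrite hornerXsubC -(val_gal_coset piP tH).
  by rewrite -opprB (valN vv).
rewrite /f1 !hornerE fE -xE => /(vgeBC vv) /(val_vge _ vsx).
by rewrite lez_nat leq_pmul2r // ltnS.
Qed.

End Generator.

End RamificationBreak.

(** * Jacobson's formula and the constant coefficient *)

Section Jacobson.
Variables (p : nat) (K : fieldType) (R : algType K).
Hypothesis charK : p \in [pchar K].

Let pp : prime p. Proof. exact: pcharf_prime charK. Qed.

(** The falling factorial x (x - 1) ... (x - n + 1). For n = p it is the Artin-Schreier polynomial
    x^p - x, which thereby acquires a binomial expansion at e + c. *)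
Fixpoint falling (n : nat) (x : R) : R :=
  if n is m.+1 then (x - m%:R) * falling m x else 1.

Lemma falling_prime x : falling p x = x ^+ p - x.
Proof.
have h n : falling n x = horner_alg x (\prod_(i < n) ('X - (i%:R)%:P)).
  elim: n => [|n IH] /=; first by rewrite big_ord0 rmorph1.
  rewrite big_ord_recr /= mulrC rmorphM /= -IH rmorphB /=.
  by rewrite horner_algX horner_algC scaler_nat.
have := AS_poly_prod charK 0; rewrite h; under eq_bigr do rewrite add0r.
move <-; rewrite expr0n (gtn_eqF (prime_gt0 pp)) subrr rmorph0 subr0.
by rewrite rmorphB rmorphXn /= !horner_algX.
Qed.

(* Modelled on e = x d/dx and c = x, for which e + c = exp(-x) e exp(x). *)
Lemma falling_shift (e c : R) n : e * c = c * (e + 1) ->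
  falling n (e + c) = \sum_(i < n.+1) 'C(n, i)%:R * c ^+ (n - i) * falling i e.
Proof.
move=> ec; have ecX m : e * c ^+ m = c ^+ m * (e + m%:R).
  elim: m => [|m IH]; first by rewrite expr0 mul1r mulr1 addr0.
  rewrite exprSr mulrA IH -mulrA -[RHS]mulrA; congr (_ * _).
  by rewrite mulrDl ec -(commr_nat c) -mulrDr -addrA nat1r.
elim: n => [|n IH]; first by rewrite big_ord1 /= bin0 expr0 !mul1r.
rewrite /= IH mulr_sumr.
have step (i : 'I_n.+1) : (e + c - n%:R) * ('C(n, i)%:R * c ^+ (n - i) * falling i e) =
    'C(n, i)%:R * c ^+ (n - i) * falling i.+1 e
    + 'C(n, i)%:R * c ^+ (n.+1 - i) * falling i e.
  rewrite -!mulrA !(mulrA _ 'C(n, i)%:R) (commr_nat (e + c - n%:R)) -!mulrA.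
  rewrite -mulrDr; congr (_ * _); rewrite subSn; last by rewrite -ltnS.
  rewrite exprS -mulrA addrAC mulrDl; congr (_ + _).
  rewrite mulrA mulrBl ecX -(commr_nat (c ^+ _)) -mulrBr /= -!mulrA.
  congr (_ * (_ * _)).
  by rewrite -addrA -opprB -natrB ?leq_subr // subKn // -ltnS.
rewrite (eq_bigr _ (fun i _ => step i)) big_split /= [RHS]big_ord_recl /=.
rewrite [X in _ + X]big_ord_recl addrCA; congr (_ + _).
  by rewrite !bin0.
rewrite [RHS](eq_bigr (fun i : 'I_n.+1 =>
    'C(n, i.+1)%:R * c ^+ (n - i) * falling i.+1 e
    + 'C(n, i)%:R * c ^+ (n - i) * falling i.+1 e)); last first.
  by move=> i _; rewrite /bump add1n binS natrD subSS -!mulrDl.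
rewrite [RHS]big_split /= addrC; congr (_ + _).
rewrite [RHS]big_ord_recr /= bin_small // !mul0r addr0.
by apply: eq_bigr => i _; rewrite /bump /= add1n subSS.
Qed.

(** Modulo p only the two extreme binomial coefficients survive; they contribute c^p and the falling
    factorial of e. *)
Lemma wp_shift1 (e c : R) : e * c = c * (e + 1) ->
  (e + c) ^+ p - (e + c) = e ^+ p - e + c ^+ p.
Proof.
move=> ec; rewrite -!falling_prime falling_shift //.
have charR : p \in [pchar R] by rewrite pchar_lalg.
case: p pp charR => [//|m] pm charR.
rewrite big_ord_recr big_ord_recl big1 => [|i _].
  by rewrite /= bin0 binn subnn subn0 expr0 !mul1r mulr1 addr0 addrC.
have -> : 'C(m.+1, widen_ord (leqnSn m.+1) (lift ord0 i))%:R = 0 :> R.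
  apply/eqP; rewrite -(dvdn_pcharf charR) prime_dvd_bin //.
  by rewrite /= /bump add1n ltnS ltn_ord.
by rewrite !mul0r.
Qed.

(** If p | m, then e and c commute and Frobenius is additive, which leaves the term - c. Otherwise
    dividing e and c by m, an element fixed by Frobenius, reduces to the eigenvalue 1. *)
Lemma wp_shift (e c : R) m : e * c = c * e + m%:R * c ->
  (e + c) ^+ p - (e + c) = e ^+ p - e + c ^+ p - (if (p %| m)%N then c else 0).
Proof.
move=> ec; case: ifP => [pm|/negbT pm].
  have charR : p \in [pchar R] by rewrite pchar_lalg.
  have m0 : m%:R = 0 :> R by apply/eqP; rewrite -(dvdn_pcharf charR).
  rewrite m0 mul0r addr0 in ec.
  rewrite -(pFrobenius_autE charR) pFrobenius_autD_comm // !pFrobenius_autE.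
  by rewrite opprD addrACA addrA.
pose l : K := m%:R.
have l0 : l != 0 by rewrite /l -(dvdn_pcharf charK).
have lp : l ^+ p = l by rewrite /l (natr1_pchar charK).
have lR : m%:R = l *: 1 :> R by rewrite /l scaler_nat.
have hs : l ^-1 *: e * (l^-1 *: c) = l^-1 *: c * (l^-1 *: e + 1).
  rewrite mulrDr mulr1 -!scalerAl -!scalerAr ec lR -scalerAl mul1r.
  by rewrite !scalerDr (scalerA _ l) mulVf // scale1r.
move: hs; pose e' := l^-1 *: e; pose c' := l^-1 *: c.
rewrite -/e' -/c' => hs.
have eE : e = l *: e' by rewrite scalerA divff // scale1r.
have cE : c = l *: c' by rewrite scalerA divff // scale1r.
clearbody e' c'; rewrite {}eE {}cE {ec} -scalerDr !exprZn lp -!scalerBr subr0.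
by rewrite -scalerDr wp_shift1.
Qed.

End Jacobson.

(* - D behaves like J d/dJ, so every g_l J^l is an eigenvector of ad D and wp_shift
   applies to one summand at a time. *)
Lemma wp_weyl_sum (p : nat) (K : fieldType) (R : algType K) (J D : R)
    (g : nat -> K) n : p \in [pchar K] -> D * J = J * D - J ->
  let E := - D + \sum_(l < n) g l *: J ^+ l in
  E ^+ p - E = (- D) ^+ p - (- D) +
    \sum_(l < n) (g l ^+ p *: J ^+ (l * p) -
                  (if (p %| l)%N then g l *: J ^+ l else 0)).
Proof.
move=> charK DJ; elim: n => [|n IH] /=; first by rewrite !big_ord0 !addr0.
have DJX l : - D * J ^+ l = J ^+ l * - D + l%:R * J ^+ l.
  elim: l => [|l IHl]; first by rewrite expr0 mul1r !mulr1 addr0.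
  have NDJ : - D * J = J * - D + J by rewrite mulNr DJ opprB mulrN addrC.
  rewrite exprSr [LHS]mulrA IHl mulrDl -[J ^+ l * _ * J]mulrA NDJ mulrDr mulrA.
  by rewrite -addrA -[_%:R * _ * J]mulrA -[X in _ + (X + _)]mul1r -mulrDl nat1r.
rewrite !big_ord_recr /= !addrA (@wp_shift p K R charK _ _ n).
  by rewrite IH exprZn exprM -!addrA.
rewrite -!scalerAl -!scalerAr -scalerDr; congr (_ *: _).
rewrite mulrDl mulrDr DJX addrAC; congr (_ + _ + _).
rewrite mulr_suml mulr_sumr; apply: eq_bigr => i _.
by rewrite -scalerAl -scalerAr -!exprD addnC.
Qed.

(** * Multiplication by y in a basis adapted to the norm *)

Section NormConstantTerm.
Variables (p q nu b : nat) (K : fieldType) (L : splittingFieldType K).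
Variables (vK : K -> \bar int) (v : L -> \bar int).
Hypotheses (charK : p \in [pchar K]) (localK : local_field vK q).
Hypotheses (vv : normalized_valuation v).
Hypothesis ramLK : totally_ramified vK v.
Hypothesis galLK : galois 1%AS {:L}.
Hypothesis oG : #|'Gal({:L} / 1%AS)%g| = (p ^ nu.+1)%N.
Hypothesis abelG : abelian 'Gal({:L} / 1%AS)%g.
Hypotheses (b1 : (1 <= b)%N) (bp : (b <= p - 1)%N).
Hypothesis breakLK : single_break v b.

Let vvK : normalized_valuation vK. Proof. by case: localK. Qed.
Let pp : prime p. Proof. exact: pcharf_prime charK. Qed.
Let p0 : (0 < p)%N. Proof. exact: prime_gt0. Qed.
Let charL : p \in [pchar L]. Proof. exact: pchar_ext. Qed.
Local Notation G := 'Gal({:L} / 1%AS)%g.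

Variables (y : L) (beta : K).
Hypothesis yP : y ^+ p - y = beta%:A.
Hypothesis vy : v y = (- (b * p ^ nu)%N%:Z)%:E.

Let pb : ~~ (p %| b)%N.
Proof. by apply/negP => /dvdn_leq; move: bp b1; have := p0; lia. Qed.

Local Notation M := <<1%AS; y>>%AS.
Local Notation H := 'Gal({:L} / M)%g.

Variable sigma : gal_of {:L}.
Hypotheses (sG : sigma \in G) (sy : sigma y = y + 1).

Variables (piL : L) (t : K).
Hypotheses (vpi : v piL = 1%:E) (normt : t%:A = galNorm 1%AS {:L} piL).

Let rho0 := \prod_(tau in H) tau piL.

(** A product of i successive conjugates of [rho0], the norm of [piL] to K(y). Compared with powers
    of [rho0], these elements have the same valuations but are merely shifted by the semilinear
    operator [rho0 * sigma]. *)
Fixpoint rho (i : nat) : L := if i is j.+1 then rho0 * sigma (rho j) else 1.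

Let HG tau : tau \in H -> tau \in G.
Proof. by apply/fintype.subsetP/galS; exact: sub1v. Qed.

Let val_galG := val_gal vvK vv ramLK b1 breakLK.

Lemma val_rho i : v (rho i) = (i%:Z * (p ^ nu)%N%:Z)%:E.
Proof.
have v0 : v rho0 = (p ^ nu)%N%:Z%:E.
  rewrite (val_prod vv _ (g := fun=> 1)).
    by rewrite sumr_const (AS_gen_card charK vvK vv ramLK galLK oG yP pb vy) natz.
  by move=> tau /HG tG; rewrite val_galG.
elim: i => [|i IH] /=; first by rewrite mul0r (val1 vv).
rewrite (valMn vv v0 (m := i%:Z * (p ^ nu)%N%:Z)); last by rewrite val_galG.
by congr EFin; rewrite -addn1 PoszD mulrDl mul1r addrC.
Qed.

Lemma rho_mem i : rho i \in M.
Proof.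
have fix_gal x : (forall tau, tau \in H -> tau x = x) -> x \in M.
  exact: AS_gen_fixed.
elim: i => [|i IH] /=; first exact: mem1v.
rewrite rpredM //; apply: fix_gal => tau tH.
  rewrite /rho0 rmorph_prod [RHS](reindex_inj (mulIg tau)) /=.
  apply: eq_big => [s|s _]; first by rewrite groupMr.
  by rewrite galM ?memvf.
(* Commutativity of the Galois group keeps sigma (rho i) fixed by tau. *)
rewrite -galM ?memvf // -(centsP abelG _ (HG tH) _ sG) galM ?memvf //.
by rewrite (fixed_gal _ tH) ?subvf.
Qed.

Lemma rho_prod i : rho i = \prod_(l < i) (sigma ^+ l)%g rho0.
Proof.
elim: i => [|i IH] /=; first by rewrite big_ord0.
rewrite big_ord_recl /= expg0 gal_id IH rmorph_prod; congr (_ * _).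
by apply: eq_bigr => l _; rewrite /= -galM ?memvf // -expgSr.
Qed.

Lemma sigmaX_gen l : (sigma ^+ l)%g y = y + l%:R.
Proof.
elim: l => [|l IH]; first by rewrite expg0 gal_id addr0.
by rewrite expgSr galM ?memvf // IH rmorphD rmorph_nat /= sy -addrA nat1r.
Qed.

(** Transitivity of the norm: sorting the Galois group by the l with tau y = y + l yields the cosets
    of H represented by sigma^l, l < p. *)
Lemma rho_norm : rho p = t%:A.
Proof.
have clP tau : tau \in G -> exists l : 'I_p, tau y = y + (l : nat)%:R.
  move=> tG; have [l lp ty] : exists2 l, (l < p)%N & tau y = y + l%:R.
    apply: (AS_roots charL).
    by have := congr1 tau yP; rewrite rmorphB rmorphXn /= gal_alg -yP.
  by exists (Ordinal lp).
pose cl (tau : gal_of {:L}) : 'I_p :=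
  odflt (Ordinal p0) [pick l : 'I_p | tau y == y + (l : nat)%:R].
have clE tau (l : 'I_p) : tau \in G -> (cl tau == l) = (tau y == y + (l : nat)%:R).
  move=> tG; rewrite /cl; case: pickP => [m /eqP mP|none] /=; last first.
    by have [m mP] := clP tau tG; have := none m; rewrite mP eqxx.
  rewrite mP (inj_eq (addrI y)); apply/eqP/eqP => [-> //|h].
  exact/val_inj/(natr_inj_pchar charL (ltn_ord m) (ltn_ord l) h).
rewrite normt /galNorm rho_prod [RHS](partition_big cl predT) //=.
apply: eq_bigr => l _; rewrite /rho0 rmorph_prod /=.
rewrite [RHS](reindex_inj (mulIg (sigma ^+ l)%g)) /=.
apply: eq_big => [tau|tau _]; last by rewrite galM ?memvf.
rewrite groupMr ?groupX //; apply/idP/andP => [tH|[tG]].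
  split; first exact: HG.
  have tsG : (tau * sigma ^+ l)%g \in G.
    exact: groupM (HG tH) (groupX l sG).
  rewrite clE // galM ?memvf //.
  by rewrite (fixed_gal _ tH) ?subvf ?memv_adjoin // sigmaX_gen.
have tsG : (tau * sigma ^+ l)%g \in G.
  exact: groupM tG (groupX l sG).
rewrite clE // galM ?memvf // -sigmaX_gen.
rewrite (inj_eq (fmorph_inj _)) => /eqP ty.
have sM : (M <= fixedField [set tau])%VS.
  apply/FadjoinP; split; first exact: sub1v.
  by apply/fixedFieldP; rewrite ?memvf // => s /set1P ->.
by rewrite -finset.sub1set galois_connection ?subvf.
Qed.

Lemma rho_period i : rho (i + p) = t *: rho i.
Proof.
elim: i => [|i IH]; first by rewrite add0n rho_norm.
by rewrite addSn /= IH linearZ /= scalerAr.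
Qed.

(* On the K-basis rho_i = (rho0 sigma)^i 1 of K(y), let J be the matrix of
   rho0 sigma, so that J^p = N(rho0) = t, and D = diag(i). If y = sum_l g_l rho_l
   then multiplication by y has matrix sum_l g_l J^l - D. *)
Lemma AS_norm_formula : exists g : nat -> K,
  beta = \sum_(l < p) (g l ^+ p * t ^+ l - (if (p %| l)%N then g l else 0)) /\
  forall l, (l < p)%N -> vge v (g l *: rho l) (- (b * p ^ nu)%N%:Z).
Proof.
have pE : p = p.-1.+1 by rewrite prednK.
pose a (i : 'I_p) : int := (i : nat)%:Z * (p ^ nu)%N%:Z.
have vrho (i : 'I_p) : v (rho i) = (a i)%:E := val_rho i.
have dimL := dim_ext galLK oG.
have dist (i j : 'I_p) (d : int) : i != j -> a i - a j <> (\dim {:L})%:Z * d.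
  move=> ij; rewrite dimL expnS PoszM -mulrBl -mulrA [_ * d]mulrC mulrA.
  have PZ0 : (p ^ nu)%N%:Z != 0 by rewrite lt0r_neq0 // ltz_nat expn_gt0 p0.
  by move/(mulIf PZ0); exact: ord_dist.
have dimM := AS_gen_dim charK vvK vv ramLK galLK oG yP pb vy.
have [g0 yE] := scaled_sum_ex vvK vv ramLK vrho dist (esym dimM)
  (fun i => rho_mem i) (memv_adjoin _ _).
pose g l := if insub l is Some i then g0 i else 0.
have gE (i : 'I_p) : g i = g0 i by rewrite /g valK.
exists g; split; last first.
  move=> l lp; rewrite -[l]/(nat_of_ord (Ordinal lp)) gE.
  apply: (vge_scaled vvK vv ramLK vrho dist (c := g0)).
  by rewrite -yE; exact: val_vge_refl.
have {}yE : y = \sum_(l < p) g l *: rho l.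
  by rewrite {1}yE; apply: eq_bigr => i _; rewrite gE.
(* Each application of [rho0 * sigma] raises y by 1, so the i-th shift of the expansion gives
   multiplication by y + i; the matrix [- D] removes the excess i. *)
have yrho i : \sum_(l < p) g l *: rho (l + i) = rho i * (y + i%:R).
  elim: i => [|i IH].
    by rewrite addr0 mul1r [RHS]yE; apply: eq_bigr => l _; rewrite addn0.
  have := congr1 (fun z => rho0 * sigma z) IH => /=.
  rewrite rmorph_sum mulr_sumr rmorphM rmorphD rmorph_nat /= sy mulrA.
  rewrite -addrA nat1r => <-; apply: eq_bigr => l _.
  by rewrite addnS /= linearZ /= scalerAr.
move: (p.-1) pE => n pE.
pose J : 'M[K]_n.+1 := \matrix_(i, j)
  (if (i : nat) == n then (if (j : nat) == 0%N then t else 0)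
   else ((j : nat) == i.+1)%:R).
pose D : 'M[K]_n.+1 := diag_mx (\row_i (i : nat)%:R).
pose r m : 'cV[L]_n.+1 := \col_i rho (m + i).
pose act (A : 'M[K]_n.+1) (u : 'cV[L]_n.+1) := map_mx (in_alg L) A *m u.
have actM A B u : act (A * B) u = act A (act B u).
  by rewrite /act map_mxM mulmxA.
have actD A B u : act (A + B) u = act A u + act B u.
  by rewrite /act map_mxD mulmxDl.
have actN A u : act (- A) u = - act A u by rewrite /act map_mxN mulNmx.
have actZ c A u : act (c *: A) u = c%:A *: act A u.
  by rewrite /act map_mxZ scalemxAl.
have act1 u : act 1 u = u by rewrite /act map_mx1 mul1mx.
have act_sum m (A : nat -> 'M[K]_n.+1) u :
    act (\sum_(l < m) A l) u = \sum_(l < m) act (A l) u.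
  by rewrite /act map_mx_sum mulmx_suml.
have actZu A z u : act A (z *: u) = z *: act A u by rewrite /act scalemxAr.
have actJ m : act J (r m) = r m.+1.
  apply/colP => i; rewrite !mxE.
  case: (eqVneq (i : nat) n) => [iN|iN].
    rewrite (bigD1 ord0) //= big1 => [|j j0].
      rewrite !mxE iN !eqxx /= addr0 addn0 mulr_algl -rho_period.
      by rewrite pE addnS.
    rewrite !mxE iN eqxx; case: eqP => [j00|_]; last by rewrite /= scale0r mul0r.
    by case/eqP: j0; apply: val_inj.
  have iS : (i.+1 < n.+1)%N by rewrite ltnS; have := ltn_ord i; rewrite ltnS leq_eqVlt (negPf iN).
  rewrite (bigD1 (Ordinal iS)) //= big1 => [|j jS].
    by rewrite !mxE (negPf iN) /= eqxx scale1r mul1r addr0 addnS.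
  rewrite !mxE (negPf iN); case: eqP => [jS1|_]; last by rewrite /= scale0r mul0r.
  by case/eqP: jS; apply: val_inj.
  have {}actJX l m : act (J ^+ l) (r m) = r (l + m)%N.
  elim: l m => [|l IH] m; first by rewrite expr0 act1.
  by rewrite exprSr actM actJ IH addnS.
(* The rho_i are free over K, so a matrix over K is determined by its action on the column [r 0];
   matrix identities can be checked there. *)
have act_inj A : act A (r 0) = 0 -> A = 0.
  move=> A0; apply/matrixP => i j; rewrite mxE.
  pose c (k : 'I_p) := A i (cast_ord pE k).
  have s0 : \sum_k c k *: rho k = 0.
    have := congr1 (fun u : 'cV[L]_n.+1 => u i 0) A0; rewrite !mxE.
    move=> {2}<-; rewrite (reindex (cast_ord pE)) /=.
      by apply: eq_bigr => k _; rewrite !mxE mulr_algl.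
    by exists (cast_ord (esym pE)) => k _; rewrite (cast_ordK, cast_ordKV).
  have := dominant_eq0 vv (val_scaled_dist vvK vv ramLK vrho dist (c := c)) s0.
  move/(_ (cast_ord (esym pE) j))/eqP; rewrite scaler_eq0 /c cast_ordKV.
  case/orP => [/eqP //|/eqP r0].
  by have := vrho (cast_ord (esym pE) j); rewrite r0 (Defs.val0 vv).
have act_eq A B : act A (r 0) = act B (r 0) -> A = B.
  move=> AB; apply/eqP; rewrite -subr_eq0; apply/eqP/act_inj.
  by rewrite actD actN AB subrr.
have actr c m : act (c *: J ^+ m) (r 0) = c%:A *: r m.
  by rewrite actZ actJX addn0.
have JXp l : J ^+ (l * p) = t ^+ l *: 1.
  elim: l => [|l IH]; first by rewrite expr0 scale1r.
  rewrite mulSn exprD IH -scalerAr mulr1 exprS -scalerA.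
  rewrite [X in _ *: X](_ : _ = t *: 1) ?scalerA 1?mulrC //.
  apply: act_eq; rewrite actJX actZ act1 addn0; apply/colP => i.
  by rewrite !mxE addnC rho_period add0n mulr_algl.
have DJ : D * J = J * D - J.
  rewrite -mulmxE; apply/matrixP => i j; rewrite /D mul_diag_mx mul_mx_diag !mxE.
  case: (eqVneq (i : nat) n) => [iN|iN].
    case: eqP => [->|_]; last by rewrite mulr0 mul0r subr0.
    (* The last row wraps around from p - 1 to 0; the commutation relation survives because p = 0 in
       K. *)
    rewrite mulr0 sub0r iN; have : p%:R = 0 :> K := pcharf0 charK.
    by rewrite pE -natr1 => /eqP; rewrite addr_eq0 => /eqP ->; rewrite mulN1r.
  case: eqP => [->|_]; last by rewrite mulr0 mul0r subr0.
  by rewrite mulr1 mul1r -natr1 addrK.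
have DX : (- D) ^+ p - (- D) = 0.
  have -> : (- D) ^+ p = - D.
    have DE : - D = diag_mx (\row_i - (i : nat)%:R).
      by apply/matrixP => i j; rewrite !mxE mulNrn.
    rewrite DE; have dX m (d : 'rV[K]_n.+1) :
        diag_mx d ^+ m = diag_mx (\row_i d 0 i ^+ m).
      elim: m => [|m IH].
        by apply/matrixP => i j; rewrite !mxE expr0.
      rewrite exprS IH -mulmxE; apply/matrixP => i j.
      by rewrite mul_diag_mx !mxE exprS mulrnAr.
    rewrite dX; congr diag_mx; apply/rowP => i; rewrite !mxE.
    have /= := exprN_pchar charK 1 (i : nat)%:R; rewrite expn1 => ->.
    by rewrite (natr1_pchar charK).
  exact: subrr.
have := @wp_weyl_sum p K _ J D g p charK DJ.
rewrite DX add0r; set E := - D + _ => EE.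
have actE m : act (E ^+ m) (r 0) = y ^+ m *: r 0.
  elim: m => [|m IH]; first by rewrite !expr0 act1 scale1r.
  rewrite exprSr actM (_ : act E (r 0) = y *: r 0); last first.
    rewrite /E actD actN (act_sum p (fun l => g l *: J ^+ l)).
    rewrite (eq_bigr (fun l : 'I_p => (g l)%:A *: r l)); last by move=> l _; exact: actr.
    apply/colP => i; rewrite /act /D map_diag_mx mul_diag_mx !mxE summxE.
    under eq_bigr do rewrite !mxE mulr_algl.
    rewrite yrho add0n /=.
    by rewrite scaler_nat; ring.
  by rewrite actZu IH scalerA exprS.
pose c := \sum_(l < p) (g l ^+ p * t ^+ l - (if (p %| l)%N then g l else 0)).
have {}EE : E ^+ p - E = c *: 1.
  rewrite EE scaler_suml; apply: eq_bigr => l _.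
  rewrite scalerBl JXp scalerA; congr (_ - _).
  case: ifP => pl; last by rewrite scale0r.
  have [l0|l0] := posnP l; first by rewrite l0 expr0.
  by have := dvdn_leq l0 pl; rewrite leqNgt ltn_ord.
(* The top entry of [r 0] is rho_0 = 1, so this entry reads y^p - y = c. *)
have := congr1 (fun A => act A (r 0) 0 0) EE.
rewrite actD actN actE -{1}[E]expr1 actE actZ act1 !mxE /= !mulr1 expr1 yP.
by move/(fmorph_inj (in_alg L)).
Qed.

End NormConstantTerm.
(** * The group B_0 *)

Section ArtinSchreierGroup.
Variables (p q nu b : nat) (K : fieldType) (L : splittingFieldType K).
Variables (vK : K -> \bar int) (v : L -> \bar int).
Hypotheses (charK : p \in [pchar K]) (localK : local_field vK q).
Hypotheses (vv : normalized_valuation v).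
Hypothesis ramLK : totally_ramified vK v.
Hypothesis galLK : galois 1%AS {:L}.
Hypothesis oG : #|'Gal({:L} / 1%AS)%g| = (p ^ nu.+1)%N.
Hypothesis abelG : abelian 'Gal({:L} / 1%AS)%g.
Hypotheses (b1 : (1 <= b)%N) (bp : (b <= p - 1)%N).
Hypothesis breakLK : single_break v b.

Let vvK : normalized_valuation vK. Proof. by case: localK. Qed.
Let pp : prime p. Proof. exact: pcharf_prime charK. Qed.
Let p0 : (0 < p)%N. Proof. exact: prime_gt0. Qed.
Let charL : p \in [pchar L]. Proof. exact: pchar_ext. Qed.
Local Notation G := 'Gal({:L} / 1%AS)%g.
Local Notation k := (@teichmuller K q).

Let pb : ~~ (p %| b)%N.
Proof. by apply/negP => /dvdn_leq; move: bp b1; have := p0; lia. Qed.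

Variables (piL : L) (t : K) (C : set K).
Hypotheses (vpi : v piL = 1%:E) (normt : t%:A = galNorm 1%AS {:L} piL).
Hypothesis complC : wp_complement p q C.

Lemma val_norm : vK t = 1%:E.
Proof.
apply: (val_alg_inv vvK vv ramLK); rewrite normt (dim_ext galLK oG) mulr1 -oG.
rewrite /galNorm (val_prod vv _ (g := fun=> 1)).
  by rewrite sumr_const natz.
by move=> s sG; rewrite (val_gal vvK vv ramLK b1 breakLK).
Qed.
Let vt := val_norm.

(** One root is enough, since the others are its translates by the prime field. *)
Lemma AS_splitP beta : AS_split L p beta <-> exists y : L, y ^+ p - y = beta%:A.
Proof.
have mapE : map_poly (in_alg L) ('X^p - 'X - beta%:P) = 'X^p - 'X - (beta%:A)%:P.
  by rewrite !rmorphB /= map_polyXn map_polyX map_polyC.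
rewrite /AS_split /= mapE; split=> [[rs rsE]|[y yE]].
  have : (1 < size ('X^p - 'X - (beta%:A)%:P : {poly L})%R)%N.
    rewrite -addrA size_polyDl size_polyXn ?ltnS //.
    by rewrite -opprD size_polyN size_XaddC prime_gt1.
  case: rs rsE => [|y rs] E; first by rewrite E big_nil size_poly1.
  move=> _; exists y; apply/eqP; rewrite -subr_eq0.
  have := congr1 (horner^~ y) E; rewrite big_cons hornerM !hornerE.
  by rewrite subrr mul0r => ->.
exists [seq y + (i : nat)%:R | i : 'I_p].
by rewrite -yE (AS_poly_prod charL) big_map big_enum.
Qed.

Lemma AS_B0B x y : AS_B0 L p q C t x -> AS_B0 L p q C t y ->
  AS_B0 L p q C t (x - y).
Proof.
move=> [/AS_splitP[a aE] rx] [/AS_splitP[c cE] ry]; split.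
  apply/AS_splitP; exists (a - c).
  by rewrite (exprB1_pchar charL) scalerBl -aE -cE; ring.
exact: (AS_reducedB charK localK complC).
Qed.

Lemma AS_gen_moved (y : L) (beta : K) s : y ^+ p - y = beta%:A -> ~~ (p %| s)%N ->
  v y = (- (s * p ^ nu)%N%:Z)%:E -> exists2 sigma, sigma \in G & sigma y != y.
Proof.
move=> yE ps vy; apply/exists_inP/contraT.
rewrite negb_exists_in => /forall_inP fixy.
have y1 : y \in (1%AS : {vspace L}).
  have /galois_fixedField <- := galLK; apply/fixedFieldP; rewrite ?memvf //.
  by move=> s1 /fixy; rewrite negbK => /eqP.
have := AS_gen_dim charK vvK vv ramLK galLK oG yE ps vy.
have /Fadjoin_idP /= e := y1; rewrite /= e dimv1 => p1.
by move: pp; rewrite -p1.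
Qed.

Lemma AS_gen_val (y : L) (beta : K) s : y ^+ p - y = beta%:A -> (0 < s)%N ->
  vK beta = (- s%:Z)%:E -> v y = (- (s * p ^ nu)%N%:Z)%:E.
Proof.
move=> yE s0 vb; have := val_alg ramLK vb; rewrite -yE (dim_ext galLK oG) => vyp.
have P0 : 0 < (p ^ nu)%N%:Z by rewrite ltz_nat expn_gt0 p0.
have PS : (p ^ nu.+1)%N%:Z = p%:Z * (p ^ nu)%N%:Z by rewrite expnS PoszM.
rewrite PS in vyp; have p1 := prime_gt1 pp.
have neg : p%:Z * (p ^ nu)%N%:Z * - s%:Z < 0.
  by rewrite mulrN oppr_lt0 !mulr_gt0 // ltz_nat.
have [y00|/(val_ex vv)[a va]] := eqVneq y 0.
  by move: vyp; rewrite y00 expr0n gtn_eqF // subrr (Defs.val0 vv).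
have [a0|a0] := lerP 0 a.
  have : vge v (y ^+ p - y) 0.
    by apply: vgeB => //; [apply: vgeX0 | ] => //; apply/(val_vge _ va).
  by move/(val_vge _ vyp); rewrite leNgt neg.
have := valD_eq vv (valX vv p va) (y := - y); rewrite vyp => h.
have /h [] : vge v (- y) (a * p%:Z + 1).
  by apply: vgeN => //; apply/(val_vge _ va); nia.
have -> : p%:Z * (p ^ nu)%N%:Z * - s%:Z = (- (s * p ^ nu)%N%:Z) * p%:Z by lia.
have pz : p%:Z != 0 by lia.
by move/(mulIf pz) => e; rewrite va -e.
Qed.

(* Here it matters that t is a norm: replacing t by another uniformizer of K can
   produce a constant term outside wp(k). *)
Lemma AS_const_coef (y : L) (beta : K) (x : nat -> K) :
  y ^+ p - y = beta%:A -> v y = (- (b * p ^ nu)%N%:Z)%:E ->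
  (forall i, k (x i)) -> beta = \sum_(i < b.+1) x i * t ^- i ->
  exists2 c, k c & x 0%N = wp p c.
Proof.
move=> yE vy kx bE.
have [s1 s1G s1y] := AS_gen_moved yE pb vy.
(* Some automorphism shifts y by a nonzero i of the prime field; a suitable power of it shifts y by
   1. *)
have [sigma sG sy] : exists2 sigma, sigma \in G & sigma y = y + 1.
  have [i pi di] := AS_gen_delta charK yE s1y.
  have i0 : (0 < i)%N by case: i pi {di} => //; rewrite dvdn0.
  have [m m' mE _] := egcdnP p i0.
  have gip : gcdn i p = 1%N by rewrite gcdnC; apply/eqP; rewrite -/(coprime p i) prime_coprime.
  rewrite gip in mE.
  have sX l : (s1 ^+ l)%g y = y + (l * i)%:R.
    elim: l => [|l IH]; first by rewrite expg0 gal_id addr0.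
    rewrite expgSr galM ?memvf // IH rmorphD rmorph_nat /= mulSnr natrD -di.
    by ring.
  exists (s1 ^+ m)%g; first exact: groupX.
  by rewrite sX mE natrD natrM (pcharf0 charL) mulr0 add0r.
have [g [gE gv]] := AS_norm_formula charK localK vv ramLK galLK oG abelG b1 bp
  breakLK yE vy sG sy vpi normt.
have dimL := dim_ext galLK oG.
have P0 : 0 < (p ^ nu)%N%:Z by rewrite ltz_nat expn_gt0 p0.
(* The estimate of g_l rho_l gives v_K(g_l) >= - (b + l) / p. As b and l are below p, this is
   greater than -1 for l = 0 and greater than -2 in general. *)
have g_ge l : (l < p)%N -> vge vK (g l) (if l == 0%N then 0 else -1).
  move=> lp; have [->|/(val_ex vvK)[a va]] := eqVneq (g l) 0; first exact: vge0.
  have vr := val_rho charK localK vv ramLK galLK oG abelG b1 bp breakLK yE vy sG vpi l.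
  have := gv l lp; rewrite -mulr_algl => /(val_vge _ (valMn vv (val_alg ramLK va) vr)).
  rewrite dimL expnS !PoszM => h.
  have {h} h : 0 <= (p ^ nu)%N%:Z * (p%:Z * a + l%:Z + b%:Z) by lia.
  rewrite pmulr_rge0 // in h; apply/(val_vge _ va).
  clear -h bp lp p0; case: eqP => [l0|_]; nia.
have [c [kc gc]] : exists c : nat -> K, (forall l, k (c l)) /\ forall l, (l < p)%N ->
    if l == 0%N then vge vK (g l - c l) 1 else vge vK (g l - c l * t ^- 1) 0.
  have h l : exists c, k c /\ ((l < p)%N ->
      if l == 0%N then vge vK (g l - c) 1 else vge vK (g l - c * t ^- 1) 0).
    case: (ltnP l p) => [lp|_]; last by exists 0; split=> //; exact: teich0 charK localK.
    have := g_ge l lp; case: eqP => _ gl.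
      by have [c kc hc] := teich_lift charK localK gl; exists c.
    have [c kc hc] := polar_lift charK localK vt (m := 1) gl.
    by exists c.
  have [c cP] := choice h; by exists c; split=> l; case: (cP l).
have [n pE] : exists n, p = n.+1 by exists p.-1; rewrite prednK.
(* With g_l close to c_l / t for l > 0, the term g_l^p t^l contributes c_l^p at t^-(p-l), while
   g_0^p - g_0 contributes wp(c_0). The errors have positive valuation. *)
pose z i := if i == 0%N then wp p (c 0%N) else c (p - i)%N ^+ p.
have kz i : k (z i).
  rewrite /z; case: ifP => _; last exact: teichX.
  by apply: (teichB charK localK) => //; exact: teichX.
have bz : vge vK (beta - \sum_(i < n.+1) z i * t ^- i) 1.
  rewrite gE pE big_ord_recl [X in _ - X]big_ord_recl opprD addrACA.
  apply: vgeD => //.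
    rewrite /= ?dvdn0 !expr0 invr1 !mulr1 /z eqxx -pE.
    have h : vge vK (g 0%N - c 0%N) 1 by exact: (gc 0%N p0).
    rewrite (_ : _ - _ = (g 0%N - c 0%N) ^+ p - (g 0%N - c 0%N)).
      apply: vgeB => //; apply: vge_le (vgeX vvK p h); lia.
    by rewrite (exprB1_pchar charK) /wp; ring.
  rewrite [X in _ - X](reindex_inj rev_ord_inj) -sumrB; apply: vge_sum => // i _.
  rewrite /= /bump /= add1n add1n.
  have ip := ltn_ord i.
  have -> : (n.+1 %| i.+1)%N = false.
    by apply/negP => /dvdn_leq; lia.
  rewrite subr0 /z /= pE.
  have -> : (n.+1 - (n - i.+1).+1 = i.+1)%N by rewrite subSS subKn.
  have hi : vge vK (g i.+1 - c i.+1 * t ^- 1) 0 by apply: (gc i.+1); lia.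
  have t0 : t != 0 := val_neq0 vvK vt.
  have -> : g i.+1 ^+ n.+1 * t ^+ i.+1 - c i.+1 ^+ n.+1 * t ^- (n - i.+1).+1 =
      (g i.+1 - c i.+1 * t ^- 1) ^+ p * t ^+ i.+1.
    rewrite (exprB1_pchar charK) exprMn mulrBl pE; congr (_ - _).
    rewrite -mulrA; congr (_ * _).
    have -> : t ^+ i.+1 = t ^+ n.+1 / t ^+ (n - i.+1).+1.
      apply: (mulIf (expf_neq0 (n - i.+1).+1 t0)).
      by rewrite mulfVK ?expf_neq0 // -exprD addnS subnKC.
    by rewrite expr1 exprVn mulrA mulVf ?mul1r // expf_neq0.
  apply: vge_le (vgeM vvK (vgeX vvK p hi) (val_vge_refl (valX vvK i.+1 vt))); lia.
pose x' i := if (i <= b)%N then x i else 0.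
have k0 := teich0 charK localK.
have bE' : beta = \sum_(i < n.+1) x' i * t ^- i.
  rewrite bE (big_ord_widen n.+1 (fun i => x i * t ^- i)); last by move: bp b1; lia.
  rewrite big_mkcond; apply: eq_bigr => i _; rewrite ltnS /x'.
  by case: ifP => _ //; rewrite mul0r.
have h : vge vK (\sum_(i < n.+1) (x' i - z i) * t ^- i) (1 - 0%N%:Z).
  by rewrite subr0; under eq_bigr do rewrite mulrBl; rewrite sumrB -bE'.
have kxz i : k (x' i - z i).
  by apply: (teichB charK localK) => //; rewrite /x'; case: ifP.
have := polar_vge charK localK vt kxz h (i := 0%N) isT.
by rewrite /x' /z /= => /subr0_eq ->; exists (c 0%N).
Qed.

(** The second conclusion says that the coefficient of t^-b detects vanishing; applied to
    differences and sums, it yields the injectivity behind [AS_psi] and the independence of top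
    coefficients. *)
Lemma AS_B0_polar beta : AS_B0 L p q C t beta ->
  exists x, polar_expansion q b t x beta /\ (x b = 0 -> beta = 0).
Proof.
move=> [/AS_splitP[y yE] [s [x [Cx kx px]]]]; rewrite big_mkord => bE.
have [Ck _ _ Cwp] := complC; have k0 := teich0 charK localK.
elim: s bE => [|s IH] bE.
  rewrite big_ord_recl big_ord0 expr0 invr1 mulr1 addr0 in bE.
  suff b0 : beta = 0.
    exists (fun=> 0); split=> //; split=> //.
    by rewrite b0 big1 // => i _; rewrite mul0r.
  have y0 : vge v y 0.
    have [->|/(val_ex vv)[a va]] := eqVneq y 0; first exact: vge0.
    apply/(val_vge _ va); rewrite leNgt; apply/negP => a0.
    have := valD_eq vv (valX vv p va) (y := - y); rewrite yE => h.
    have p1 := prime_gt1 pp.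
    have hy : vge v (- y) (a * p%:Z + 1).
      by apply: vgeN => //; apply/(val_vge _ va); nia.
    have /(vge_alg0 vvK vv ramLK) : vge vK beta 0.
      by rewrite bE; exact: vge_teich charK localK _ (kx _).
    by move/(val_vge _ (h hy)); nia.
  (* For constant beta the root y is integral, and its residue lifts to c in k. Then beta = wp(c),
     as both lie in k, and C meets wp(k) only in 0. *)
  have [c' c'0 yc'] := residue_ext vvK vv ramLK y0.
  have [c kc cc'] := teich_lift charK localK c'0.
  have yc : vge v (y - c%:A) 1.
    rewrite -[_ - _](subrKA c'%:A); apply: vgeD => //.
    by rewrite -scalerBl; apply/(vge_alg1 vvK vv ramLK).
  have h : vge vK (beta - wp p c) 1.
    apply/(vge_alg1 vvK vv ramLK).
    have -> : (beta - wp p c)%:A = (y - c%:A) ^+ p - (y - c%:A).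
      rewrite (exprB1_pchar charL) scalerBl -yE /wp scalerBl.
      by rewrite -[(c ^+ p)%:A]/(in_alg L (c ^+ p)) rmorphXn /=; ring.
    apply: vgeB => //; apply: vge_le (vgeX vv p yc); have := p0; lia.
  have kwp : k (wp p c).
    by apply: (teichB charK localK) => //; exact: teichX.
  have bw : beta = wp p c.
    apply/subr0_eq/(teich_eq0 charK localK) => //.
    by rewrite bE; exact: teichB charK localK _ _ (kx _) kwp.
  by rewrite bw; apply: Cwp => //; rewrite -bw bE.
have [xs|xs] := eqVneq (x s.+1) 0.
  by apply: IH; rewrite bE big_ord_recr /= xs mul0r addr0.
have ps : ~~ (p %| s.+1)%N.
  apply/negP => /dvdnP[m mE]; case/eqP: xs; rewrite mE mulnC px //.
  by case: m mE.
have vb : vK beta = (- s.+1%:Z)%:E.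
  by rewrite bE; exact: (polar_val charK localK vt).
have vy := AS_gen_val yE (ltn0Sn s) vb.
have [sigma sG sy] := AS_gen_moved yE ps vy.
have sb : s.+1 = b.
  apply/eqP; rewrite eqn_leq.
  rewrite (AS_break_le charK vvK vv ramLK galLK oG yE ps vy sG sy b1 breakLK).
  by rewrite (AS_break_ge charK vvK vv ramLK galLK oG yE ps vy sG sy b1 breakLK).
rewrite sb in vy bE xs.
have [c kc x0c] := AS_const_coef yE vy kx bE.
have x00 : x 0%N = 0 by rewrite x0c; apply: Cwp => //; rewrite -x0c.
exists x; split; last by move=> xb; rewrite xb eqxx in xs.
split=> //; rewrite bE -(big_mkord xpredT (fun i => x i * t ^- i)).
by rewrite big_nat_recl // x00 mul0r add0r big_add1.
Qed.

(** The range of i matters: [polar_expansion] does not constrain the value of [x] at 0 or beyond b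
    to represent anything. *)
Lemma polar_expansion_uniq x x' y i : polar_expansion q b t x y ->
  polar_expansion q b t x' y -> (1 <= i <= b)%N -> x i = x' i.
Proof.
move=> [kx yx] [kx' yx'] /andP[i1 ib].
have sumE (z : nat -> K) : \sum_(1 <= j < b.+1) z j * t ^- j =
    \sum_(j < b.+1) (if (j : nat) == 0%N then 0 else z j) * t ^- j.
  by rewrite big_ord_recl /= mul0r add0r big_add1 big_mkord.
pose d j := if j == 0%N then 0 else x j - x' j.
have kd j : k (d j).
  rewrite /d; case: ifP => _; first exact: teich0 charK localK.
  exact: (teichB charK localK).
have : vge vK (\sum_(j < b.+1) d j * t ^- j) (1 - 0%N%:Z).
  rewrite /d -(sumE (fun j => x j - x' j)); under eq_bigr do rewrite mulrBl.
  by rewrite sumrB -yx -yx' subrr; exact: vge0.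
move/(polar_vge charK localK vt kd)/(_ i); rewrite ib => /(_ isT).
by rewrite /d gtn_eqF // => /subr0_eq.
Qed.

Lemma AS_psiE beta a : top_coef L p q b C t beta a -> AS_psi L p q b C t a = beta.
Proof.
move=> [Bb [x xb xa]]; rewrite /AS_psi.
have : [set beta0 | top_coef L p q b C t beta0 a]%classic beta.
  by split=> //; exists x.
move/(xgetI 0) => -[Bb' [x' xb' xa']]; set beta' := xget _ _ in Bb' xb' *.
have [z [zb zP]] := AS_B0_polar (AS_B0B Bb' Bb).
apply/subr0_eq/zP.
have : polar_expansion q b t (fun i => x' i - x i) (beta' - beta).
  case: xb xb' => kx bx [kx' bx']; split=> [i|].
    exact: (teichB charK localK).
  by rewrite bx bx' -sumrB; apply: eq_bigr => i _; rewrite mulrBl.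
have bb : (1 <= b <= b)%N by rewrite b1 leqnn.
move/(polar_expansion_uniq zb)/(_ bb) => ->.
by rewrite xa xa' subrr.
Qed.

End ArtinSchreierGroup.

(** * Moore determinants and the generator Y *)

Section Moore.
Variables (p n : nat) (F : fieldType).
Hypothesis charF : p \in [pchar F].

Let pp : prime p. Proof. exact: pcharf_prime charF. Qed.

(** Independence over the prime field, with coefficients written as natural numbers and a trivial
    coefficient as one divisible by p. *)
Definition Fp_free (x : 'I_n -> F) : Prop :=
  forall c : 'I_n -> nat, \sum_i x i *+ c i = 0 -> forall i, (p %| c i)%N.

Definition moore_mx (x : 'I_n -> F) : 'M[F]_n := \matrix_(m, i) x i ^+ (p ^ m).

Lemma Fp_freeX x : Fp_free x -> Fp_free (fun i => x i ^+ p).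
Proof.
move=> fx c s0; apply: fx; apply/eqP.
suff : (\sum_i x i *+ c i) ^+ p == 0 by rewrite expf_eq0 prime_gt0.
rewrite -[X in _ ^+ X]expn1 (expr_sum_pchar charF 1) -{2}s0; apply/eqP.
apply: eq_bigr => i _.
by rewrite -mulr_natl exprMn (natr_pchar charF) mulr_natl expn1.
Qed.

(** A row in the kernel gives an additive polynomial of degree at most p^(n-1) that vanishes at all
    p^n combinations of the x_i over the prime field, hence is zero. *)
Lemma moore_unit x : Fp_free x -> moore_mx x \in unitmx.
Proof.
move=> fx; rewrite -row_free_unit -kermx_eq0; apply/rowV0P => u /sub_kermxP u0.
pose D : {poly F} := \sum_(m < n) u 0 m *: 'X^(p ^ m).
have Dh z : D.[z] = \sum_(m < n) u 0 m * z ^+ (p ^ m).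
  by rewrite horner_sum; apply: eq_bigr => m _; rewrite hornerZ hornerXn.
have D0 i : D.[x i] = 0.
  have := congr1 (fun A : 'rV_n => A 0 i) u0; rewrite !mxE => <-.
  by rewrite Dh; apply: eq_bigr => m _; rewrite mxE.
pose comb (c : {ffun 'I_n -> 'I_p}) := \sum_i x i *+ c i.
have comb_inj : injective comb.
  move=> c d cd; apply/ffunP => i; apply: val_inj => /=.
  have s0 : \sum_i x i *+ (c i + (p - d i)) = 0.
    under eq_bigr => j _ do rewrite mulrnDr mulrnBr ?(ltnW (ltn_ord _)) //.
    rewrite big_split sumrB /= -/(comb c) -/(comb d) cd addrCA subrr addr0.
    by apply: big1 => j _; rewrite -mulr_natl (pcharf0 charF) mul0r.
  have /dvdnP[e eE] := fx _ s0 i.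
  have := ltn_ord (c i); have := ltn_ord (d i); clear -eE.
  by case: e eE => [|[|e]]; nia.
have [n0|n1] := posnP n; first by apply/rowP => m; have := ltn_ord m; lia.
have DE : D = 0.
  apply/eqP/contraT => nD.
  have := max_poly_roots (rs := [seq comb c | c : {ffun 'I_n -> 'I_p}]) nD.
  rewrite map_inj_uniq ?enum_uniq // size_map -cardE card_ffun !card_ord.
  have -> : all (root D) [seq comb c | c : {ffun 'I_n -> 'I_p}].
    apply/allP => _ /mapP[c _ ->]; rewrite /root Dh /comb.
    under eq_bigr => m _ do rewrite (expr_sum_pchar charF) mulr_sumr.
    rewrite exchange_big big1 //= => i _.
    transitivity (D.[x i] *+ c i); last by rewrite D0 mul0rn.
    rewrite Dh -sumrMnl; apply: eq_bigr => m _.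
    by rewrite -[x i *+ _]mulr_natl exprMn (natr_pchar charF) mulr_natl mulrnAr.
  move=> /(_ isT isT); rewrite ltnNge => /negP[]; apply: leq_trans (size_sum _ _ _) _.
  apply/bigmax_leqP => m _; apply: leq_trans (size_scale_leq _ _) _.
  by rewrite size_polyXn ltn_exp2l ?prime_gt1.
apply/rowP => m; rewrite mxE; have := congr1 (fun f : {poly F} => f`_(p ^ m)) DE.
rewrite coef0 => <-; rewrite coef_sum (bigD1 m) //= big1 => [|j jm].
  by rewrite coefZ coefXn eqxx mulr1 addr0.
rewrite coefZ coefXn eqn_exp2l ?prime_gt1 //.
by rewrite eq_sym (_ : (j : nat) == m = false) ?mulr0 //; apply: negbTE.
Qed.

Lemma moore_eq0 x (u : nat -> F) : Fp_free x ->
  (forall i, \sum_(m < n) u m * x i ^+ (p ^ m) = 0) ->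
  forall m, (m < n)%N -> u m = 0.
Proof.
move=> fx h m mn; pose U : 'rV[F]_n := \row_i u i.
have U0 : U *m moore_mx x = 0.
  apply/rowP => i; rewrite !mxE -[RHS](h i).
  by apply: eq_bigr => j _; rewrite !mxE.
have : U = 0 by rewrite -[U](mulmxK (moore_unit fx)) U0 mul0mx.
by move/rowP/(_ (Ordinal mn)); rewrite !mxE.
Qed.

Lemma moore_interpolation x (y : 'I_n -> F) : Fp_free x ->
  exists u : nat -> F, (forall m, (n <= m)%N -> u m = 0) /\
    forall i, y i = \sum_(m < n) u m * x i ^+ (p ^ m).
Proof.
move=> fx; pose U := (\row_i y i) *m invmx (moore_mx x).
exists (fun m => if insub m is Some i then U 0 i else 0); split=> [m nm|i].
  by case: insubP => // i; rewrite ltnNge nm.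
have := mulmxKV (moore_unit fx) (\row_i y i); rewrite -/U => /rowP/(_ i).
rewrite !mxE => <-; apply: eq_bigr => m _.
by rewrite valK !mxE.
Qed.

End Moore.

(* The relation satisfied by the constant term u_0 of the interpolating additive
   polynomial x_i |-> y_i = sum_m u_m x_i^(p^m): eliminate u_1, ..., u_n. *)
Lemma AS_additive_generator (p n : nat) (F : fieldType) (x y : 'I_n.+1 -> F)
    (a w : nat -> F) : p \in [pchar F] -> Fp_free p x ->
  (forall i, x i = \sum_(j < n.+1) a j * x i ^+ (p ^ (n.+1 - j))) ->
  (forall i, y i ^+ p - y i = \sum_(j < n.+1) w j * x i ^+ (p ^ (n.+1 - j))) ->
  a 0%N != 0 /\ exists Y, Y ^+ (p ^ n.+1) =
    \sum_(j < n.+1) (a j * Y + w j) ^+ (p ^ j).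
Proof.
move=> charF fx xE yE.
have rev (z : nat -> F) i : \sum_(j < n.+1) z j * x i ^+ (p ^ (n.+1 - j)) =
    \sum_(l < n.+1) z (n - l)%N * (x i ^+ p) ^+ (p ^ l).
  rewrite (reindex_inj rev_ord_inj); apply: eq_bigr => l _ /=.
  by rewrite subSS -exprM -expnS subSn ?leq_subr // subKn // -ltnS.
split.
  apply/eqP => a0.
  (* If a_0 = 0, the relation for x_i involves only the powers x_i^(p^m) with 1 <= m <= n. Together
     with - x_i it becomes a nontrivial kernel row of the Moore matrix. *)
  pose u m := if m == 0%N then -1 else a (n.+1 - m)%N.
  have h i : \sum_(m < n.+1) u m * x i ^+ (p ^ m) = 0.
    rewrite big_ord_recl /= expn0 expr1 mulN1r {1}xE rev big_ord_recr /= subnn a0.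
    rewrite mul0r addr0; apply/eqP; rewrite addrC subr_eq0; apply/eqP.
    by apply: eq_bigr => m _; rewrite /u /= /bump /= add1n subSS expnS exprM.
  have := moore_eq0 charF fx h (ltn0Sn n).
  by rewrite /u /= => /eqP; rewrite oppr_eq0 oner_eq0.
have [U [U0 yU]] := moore_interpolation charF y fx.
pose T j := a j * U 0%N + w j.
(* In y^p - y = psi(x) the summand U_0 x is rewritten through the relation for x. Everything is then
   additive in x^p, and the Moore matrix of the x_i^p permits comparison of coefficients. *)
have UE l : (l < n.+1)%N -> U l.+1 = U l ^+ p - T (n - l)%N.
  move=> ln; apply/esym/eqP; rewrite -subr_eq0; apply/eqP.
  apply: (moore_eq0 charF (Fp_freeX charF fx) (u := fun l => U l ^+ p - T (n - l)%N - U l.+1)) ln.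
  move=> i; have := yE i; rewrite rev => /eqP; rewrite -subr_eq0 => /eqP.
  have -> : y i ^+ p = \sum_(m < n.+1) U m ^+ p * (x i ^+ p) ^+ (p ^ m).
    rewrite yU -[X in _ ^+ X]expn1 (expr_sum_pchar charF 1) expn1.
    by apply: eq_bigr => m _; rewrite exprMn exprAC.
  have -> : y i = U 0%N * x i + \sum_(m < n.+1) U m.+1 * (x i ^+ p) ^+ (p ^ m).
    rewrite yU big_ord_recl [in RHS]big_ord_recr /= (U0 n.+1) // mul0r addr0 expr1.
    by congr (_ + _); apply: eq_bigr => m _; rewrite /bump /= add1n -exprM -expnS.
  have -> : U 0%N * x i = \sum_(m < n.+1) a (n - m)%N * U 0%N * (x i ^+ p) ^+ (p ^ m).
    by rewrite [in LHS]xE rev mulr_sumr; apply: eq_bigr => m _; ring.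
  move=> e; rewrite -[RHS]e opprD addrA -!sumrB; apply: eq_bigr => m _.
  by rewrite /T; ring.
exists (U 0%N).
have UX m : (m <= n.+1)%N ->
    U m = U 0%N ^+ (p ^ m) - \sum_(l < m) T (n - l)%N ^+ (p ^ (m - 1 - l)).
  elim: m => [|m IH] mn; first by rewrite big_ord0 subr0 expr1.
  rewrite UE // IH ?(ltnW mn) // (exprB1_pchar charF) -exprM -expnSr -addrA -opprD.
  congr (_ - _); rewrite big_ord_recr /= subSS subn0 subnn expr1; congr (_ + _).
  rewrite -[X in _ ^+ X]expn1 (expr_sum_pchar charF 1); apply: eq_bigr => l _.
  rewrite expn1 -exprM -expnSr; congr (_ ^+ (p ^ _)).
  by have := ltn_ord l; lia.
(* The interpolating polynomial has only n + 1 coefficients, so [U n.+1] = 0; this closes the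
   recursion into an equation for U_0. *)
have := UX n.+1 (leqnn _); rewrite (U0 n.+1) // => /esym/subr0_eq ->.
rewrite (reindex_inj rev_ord_inj); apply: eq_bigr => l _ /=.
by rewrite !subSS subn0 subKn // -ltnS.
Qed.

(** * Additive Hilbert 90 and independent elements of B_0 *)

Section Hilbert90.
Variables (K : fieldType) (L : splittingFieldType K).
Local Notation G := 'Gal({:L} / 1%AS)%g.

Lemma additive_Hilbert90 (chi : gal_of {:L} -> L) :
  (forall s t : gal_of {:L}, s \in G -> t \in G -> chi (s * t)%g = chi s + chi t) ->
  (forall s t : gal_of {:L}, s \in G -> t \in G -> s (chi t) = chi t) ->
  exists y, forall s : gal_of {:L}, s \in G -> s y = y + chi s.
Proof.
move=> chiM chi_fix.
have [|a _ tr0] := @gal_independent_contra _ _ {:L}%AS (mem G) (fun=> 1) 1%g (group1 _).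
  exact: oner_neq0.
set tr := \sum_(_ | _) _ in tr0.
have trE : tr = \sum_(s in G) s a by apply: eq_bigr => s _; rewrite mul1r.
(* The classical cocycle formula; independence of characters has supplied an element a of nonzero
   trace. *)
exists (- (\sum_(t in G) chi t * t a) / tr) => s sG.
have trs : s tr = tr.
  rewrite trE rmorph_sum [RHS](reindex_inj (mulIg s)) /=.
  by apply: eq_big => [t|t _]; [rewrite groupMr | rewrite galM ?memvf].
rewrite rmorphM fmorphV rmorphN /= trs.
have -> : s (\sum_(t in G) chi t * t a) = \sum_(t in G) chi t * t a - chi s * tr.
  rewrite rmorph_sum /=.
  have -> : \sum_(t in G) chi t * t a = \sum_(t in G) chi (t * s)%g * (t * s)%g a.
    rewrite [LHS](reindex_inj (mulIg s)) /=.
    by apply: eq_bigl => t; rewrite groupMr.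
  have -> : chi s * tr = \sum_(t in G) chi s * (t * s)%g a.
    rewrite -trs trE rmorph_sum mulr_sumr.
    by apply: eq_bigr => t _; rewrite galM ?memvf.
  rewrite -sumrB; apply: eq_bigr => t tG.
  by rewrite chiM // mulrDl addrK rmorphM /= chi_fix // galM ?memvf.
by rewrite opprB mulrBl mulfK // addrC mulNr.
Qed.

End Hilbert90.

Lemma natr_FpD (p : nat) (F : fieldType) (a c : 'F_p) : p \in [pchar F] ->
  ((a + c)%R : nat)%:R = (a : nat)%:R + (c : nat)%:R :> F.
Proof.
move=> charF; rewrite -natrD.
have modp m n : m = p -> (n %% m)%:R = n%:R :> F.
  by move=> ->; rewrite [in RHS](divn_eq n p) natrD natrM (pcharf0 charF) mulr0 add0r.
exact/modp/Fp_cast/(pcharf_prime charF).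
Qed.

Section ArtinSchreierBasis.
Variables (p q nu b : nat) (K : fieldType) (L : splittingFieldType K).
Variables (vK : K -> \bar int) (v : L -> \bar int).
Hypotheses (charK : p \in [pchar K]) (localK : local_field vK q).
Hypotheses (vv : normalized_valuation v).
Hypothesis ramLK : totally_ramified vK v.
Hypothesis galLK : galois 1%AS {:L}.
Hypothesis oG : #|'Gal({:L} / 1%AS)%g| = (p ^ nu.+1)%N.
Hypothesis abelG : abelian 'Gal({:L} / 1%AS)%g.
Hypotheses (b1 : (1 <= b)%N) (bp : (b <= p - 1)%N).
Hypothesis breakLK : single_break v b.

Let pp : prime p. Proof. exact: pcharf_prime charK. Qed.
Let charL : p \in [pchar L]. Proof. exact: pchar_ext. Qed.
Local Notation G := 'Gal({:L} / 1%AS)%g.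
Local Notation k := (@teichmuller K q).

Variables (piL : L) (t : K) (C : set K).
Hypotheses (vpi : v piL = 1%:E) (normt : t%:A = galNorm 1%AS {:L} piL).
Hypothesis complC : wp_complement p q C.

Let B0 := AS_B0 L p q C t.

Lemma AS_B0Mn beta n : B0 0 -> B0 beta -> B0 (beta *+ n).
Proof.
move=> B00 Bb; elim: n => [|n IH]; first by rewrite mulr0n.
have Bn := @AS_B0B p q K L vK charK localK t C complC.
have -> : beta *+ n.+1 = beta *+ n - (0 - beta) by rewrite sub0r opprK mulrSr.
exact: Bn _ _ IH (Bn _ _ B00 Bb).
Qed.

Lemma AS_B0_sum (I : finType) (beta : I -> K) : B0 0 ->
  (forall i, B0 (beta i)) -> B0 (\sum_i beta i).
Proof.
have Bn := @AS_B0B p q K L vK charK localK t C complC.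
move=> B00 Bb; elim/big_rec: _ => // i x _ Bx.
have -> : beta i + x = x - (0 - beta i) by rewrite sub0r opprK addrC.
exact: Bn _ _ Bx (Bn _ _ B00 (Bb i)).
Qed.

(** The coordinates of the isomorphism are characters into the prime field, and Hilbert 90 turns
    each into an Artin-Schreier root, then reduced modulo wp(K). A relation among the top
    coefficients forces the same relation among the beta_i, so the combination of roots lies in the
    prime field and is Galois invariant. *)
Lemma AS_basis :
  'Gal({:L} / 1%AS)%g \isog [set: 'rV['F_p]_nu.+1] ->
  exists (x : 'I_nu.+1 -> K) (y : 'I_nu.+1 -> L) (beta : 'I_nu.+1 -> K),
    [/\ forall i, y i ^+ p - y i = (beta i)%:A,
        forall i, top_coef L p q b C t (beta i) (x i) & Fp_free p x].
Proof.
case/isogP => f f_inj fG.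
have vt := val_norm localK vv ramLK galLK oG b1 breakLK vpi normt.
pose chi i (s : gal_of {:L}) : nat := f s 0 i.
have h90 i : exists y : L, forall s : gal_of {:L}, s \in G -> s y = y + (chi i s)%:R.
  apply: (@additive_Hilbert90 _ _ (fun s => (chi i s)%:R)) => [s1 s2 s1G s2G|s1 s2 _ _].
    by rewrite /chi morphM // mxE natr_FpD.
  by rewrite rmorph_nat.
have [y0 y0P] := choice h90.
have fixK (z : L) : (forall s : gal_of {:L}, s \in G -> s z = z) -> exists c : K, c%:A = z.
  move=> fz; have : z \in (1%AS : {vspace L}).
    by have /galois_fixedField <- := galLK; apply/fixedFieldP; rewrite ?memvf.
  by case/vlineP => c ->; exists c.
have h1 i : exists beta z : K, B0 (beta - wp p z) /\ beta%:A = y0 i ^+ p - y0 i.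
  have [|beta bE] := fixK (y0 i ^+ p - y0 i).
    move=> s sG; rewrite rmorphB rmorphXn /= y0P //.
    by rewrite (exprD1_pchar charL) (natr1_pchar charL); ring.
  have [z zP] := AS_reduction_ex charK localK vt complC beta.
  exists beta, z; split=> //; split; last exact: zP.
  apply/(@AS_splitP p K L charK); exists (y0 i - z%:A).
  rewrite (exprB1_pchar charL) /wp !scalerBl bE.
  by rewrite -[(z ^+ p)%:A]/(in_alg L (z ^+ p)) rmorphXn /=; ring.
have [beta0 {}h1] := choice h1; have [z h2] := choice h1.
pose beta i := beta0 i - wp p (z i); pose y i := y0 i - (z i)%:A.
have Bb i : B0 (beta i) by case: (h2 i).
have yE i : y i ^+ p - y i = (beta i)%:A.
  rewrite /y (exprB1_pchar charL) /beta /wp !scalerBl; case: (h2 i) => _ ->.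
  by rewrite -[(z i ^+ p)%:A]/(in_alg L (z i ^+ p)) rmorphXn /=; ring.
have yP i (s : gal_of {:L}) : s \in G -> s (y i) = y i + (chi i s)%:R.
  by move=> sG; rewrite rmorphB /= gal_alg y0P // addrAC.
clearbody y.
have B0P := AS_B0_polar charK localK vv ramLK galLK oG abelG b1 bp breakLK vpi normt complC.
have [X XP] := choice (fun i => B0P _ (Bb i)).
exists (fun i => X i b), y, beta; split=> // [i|].
  by split; [exact: Bb | exists (X i); case: (XP i)].
move=> c s0.
have B00 : B0 0.
  have := AS_B0B charK localK complC (Bb ord0) (Bb ord0).
  by rewrite subrr.
have Bs : B0 (\sum_i beta i *+ c i).
  by apply: AS_B0_sum => // i; apply: AS_B0Mn.
have bs0 : \sum_i beta i *+ c i = 0.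
  have [x [xE xP]] := B0P _ Bs; apply: xP.
  have bb : (1 <= b <= b)%N by rewrite b1 leqnn.
  have xE' : polar_expansion q b t (fun j => \sum_i X i j *+ c i) (\sum_i beta i *+ c i).
    split=> [j|].
      apply: (teich_sum charK localK) => i _; apply: (teichMn charK localK).
      by case: (XP i) => -[].
    under [RHS]eq_bigr do rewrite mulr_suml.
    rewrite exchange_big /=; apply: eq_bigr => i _.
    have [[_ bE] _] := XP i; rewrite [in LHS]bE -sumrMnl.
    by apply: eq_bigr => j _; rewrite mulrnAl.
  by rewrite (polar_expansion_uniq charK localK vv ramLK galLK oG b1 breakLK vpi
    normt xE xE' bb) s0.
pose Y := \sum_i y i *+ c i.
have [m _ YE] : exists2 m, (m < p)%N & Y = m%:R.
  have [m mp] : exists2 m, (m < p)%N & Y = 0 + m%:R.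
    apply: (AS_roots charL); rewrite expr0n gtn_eqF ?prime_gt0 // subrr.
    have -> : Y ^+ p - Y = (\sum_i beta i *+ c i)%:A; last by rewrite bs0 scale0r.
    rewrite -[X in _ ^+ X]expn1 (expr_sum_pchar charL 1) expn1 -sumrB scaler_suml.
    apply: eq_bigr => i _; rewrite -scalerMnl -yE mulrnBl; congr (_ - _).
    by rewrite -mulr_natl exprMn (natr1_pchar charL) mulr_natl.
  by rewrite add0r => ->; exists m.
move=> i.
(* The automorphism dual to the i-th coordinate moves Y by c_i alone. *)
have [s sG fs] : exists2 s, s \in G & f s = \row_j (j == i)%:R.
  have : (\row_j (j == i)%:R : 'rV['F_p]_nu.+1) \in (f @* G)%g by rewrite fG finset.inE.
  by case/morphimP => s _ sG fs; exists s.
have sY : s Y = Y + (c i)%:R.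
  rewrite rmorph_sum /= (eq_bigr (fun j => y j *+ c j + (j == i)%:R *+ c j)).
    rewrite big_split /=; congr (_ + _); rewrite (bigD1 i) //= eqxx big1 ?addr0 //.
    by move=> j /negPf ->; rewrite mul0rn.
  move=> j _; rewrite rmorphMn /= yP // mulrnDl /chi fs mxE.
  by case: (j == i).
move: sY; rewrite YE rmorph_nat -{1}[m%:R]addr0 => /addrI/esym/eqP.
by rewrite -(dvdn_pcharf charL).
Qed.

End ArtinSchreierBasis.

(** * Approximation by p^m-th powers *)

Section PowerApproximation.
Variables (p q : nat) (K : fieldType) (L : splittingFieldType K).
Variables (vK : K -> \bar int) (v : L -> \bar int).
Hypotheses (charK : p \in [pchar K]) (localK : local_field vK q).
Hypotheses (vv : normalized_valuation v).
Hypothesis ramLK : totally_ramified vK v.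

Let vvK : normalized_valuation vK. Proof. by case: localK. Qed.
Let pp : prime p. Proof. exact: pcharf_prime charK. Qed.
Let p0 : (0 < p)%N. Proof. exact: prime_gt0. Qed.
Let charL : p \in [pchar L]. Proof. exact: pchar_ext. Qed.
Local Notation k := (@teichmuller K q).
Local Notation N := (\dim {:L})%:Z.

Let N0 : 0 < N. Proof. by rewrite ltz_nat dim_fullv_gt0. Qed.

(** The precision e is absolute, which suits sums, since p^m-th powers form a field. Relative
    precision n is expressed by e = v(x) + n. *)
Definition power_approx (m : nat) (e : int) (x : L) : Prop :=
  exists y, vge v (x - y ^+ (p ^ m)) e.

Lemma power_approx0 m e x : vge v x e -> power_approx m e x.
Proof. by exists 0; rewrite (expr0_pchar charL) subr0. Qed.

Lemma power_approxD m e x y :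
  power_approx m e x -> power_approx m e y -> power_approx m e (x + y).
Proof.
move=> [a xa] [c yc]; exists (a + c).
by rewrite (exprD_pchar charL) opprD addrACA; apply: vgeD.
Qed.

Lemma power_approxN m e x : power_approx m e x -> power_approx m e (- x).
Proof.
move=> [a xa]; exists (- a).
by rewrite (exprN_pchar charL) -opprD; apply: vgeN.
Qed.

Lemma power_approx_sum m e (I : Type) (r : seq I) (Q : pred I) (f : I -> L) :
  (forall i, Q i -> power_approx m e (f i)) ->
  power_approx m e (\sum_(i <- r | Q i) f i).
Proof.
move=> h; elim/big_rec: _ => [|i x Qi]; first exact/power_approx0/vge0.
by apply/power_approxD/h.
Qed.

Lemma power_approxX m e x i : power_approx m e x -> 0 <= e ->
  power_approx (m + i) e (x ^+ (p ^ i)).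
Proof.
move=> [a xa] e0; exists a; rewrite expnD exprM -(exprB_pchar charL).
apply: vge_le (vgeX vv _ xa); have : (0 < p ^ i)%N by rewrite expn_gt0 p0.
nia.
Qed.

Lemma power_approx_le m m' e x : (m <= m')%N ->
  power_approx m' e x -> power_approx m e x.
Proof.
move=> mm' [a xa]; exists (a ^+ (p ^ (m' - m))).
by rewrite -exprM -expnD subnK.
Qed.

Lemma power_approx_vge m e e' x : e' <= e ->
  power_approx m e x -> power_approx m e' x.
Proof. by move=> ee' [a xa]; exists a; apply: vge_le xa. Qed.

Lemma power_approxZ m e c x : k c -> power_approx m e x -> power_approx m e (c *: x).
Proof.
move=> kc [a xa]; have [d kd dc] := teich_root charK localK m kc.
exists (d *: a); rewrite exprZn dc -scalerBr -mulr_algl.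
apply: vgeMl => //; apply/(vge_alg0 vvK vv ramLK).
exact: vge_teich charK localK _ kc.
Qed.

Lemma val_approx_root m e n x y : 1 <= n -> v x = e%:E ->
  vge v (x - y ^+ (p ^ m)) (e + n) -> v (y ^+ (p ^ m)) = e%:E.
Proof. by move=> n1 vx h; apply: (valB_eq vv vx); apply: vge_le h; lia. Qed.

(** The condition 1 <= n makes an approximating power share the valuation of its target, so relative
    precision passes to products. *)
Lemma rel_approxM m n e e' x x' : 1 <= n -> v x = e%:E -> v x' = e'%:E ->
  power_approx m (e + n) x -> power_approx m (e' + n) x' ->
  power_approx m (e + e' + n) (x * x').
Proof.
move=> n1 vx vx' [y xy] [y' xy']; exists (y * y').
have vy := val_approx_root n1 vx xy.
rewrite exprMn (_ : _ - _ = (x - y ^+ (p ^ m)) * x' +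
   y ^+ (p ^ m) * (x' - y' ^+ (p ^ m))); last by ring.
apply: vgeD => //.
  by apply: vge_le (vgeM vv xy (val_vge_refl vx')); lia.
by apply: vge_le (vgeM vv (val_vge_refl vy) xy'); lia.
Qed.

Lemma rel_approxX m n e x i : 1 <= n -> v x = e%:E ->
  power_approx m (e + n) x -> power_approx m (e * i%:Z + n) (x ^+ i).
Proof.
move=> n1 vx hx; elim: i => [|i IH].
  by exists 1; rewrite expr1n expr0 subrr; exact: vge0.
have := rel_approxM n1 vx (valX vv i vx) hx IH; rewrite -exprS.
by apply: power_approx_vge; rewrite -addn1 PoszD mulrDr mulr1; lia.
Qed.

(* An element of K of valuation prime to p that is close to a p^m-th power of L
   forces all of K to be as close, in the relative sense: products of its powers
   and of p^m-th powers realise every valuation. *)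
Lemma rel_approx_base m n x0 a : 1 <= n -> vK x0 = a%:E -> ~~ (p %| `|a|)%N ->
  power_approx m (N * a + n) x0%:A ->
  forall z e, vge vK z e -> power_approx m (N * e + n) z%:A.
Proof.
move=> n1 vx0 pa hx0 z e0 hz.
have [t0 vt0] := val_surj vvK.
have gex i : exists2 g, vK g = i%:E & power_approx m (N * i + n) g%:A.
  have cop : coprimez a (p ^ m)%N%:Z.
    have : coprime `|a|%N (p ^ m)%N by rewrite coprimeXr // coprime_sym prime_coprime.
    by move=> /eqP cop; rewrite /coprimez /gcdz absz_nat cop.
  have [u [w uw]] := Bezoutz a (p ^ m)%N%:Z.
  rewrite (eqP cop) in uw.
  have PZ0 : (p ^ m)%N%:Z != 0 by rewrite lt0r_neq0 // ltz_nat expn_gt0 p0.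
  (* The Bezout exponent of x0 is reduced modulo p^m to a natural number; the multiple of p^m
     removed goes into d, the exponent under the p^m-th power. *)
  have al0 := modz_ge0 (i * u) PZ0; have alE := divz_eq (i * u) (p ^ m)%N%:Z.
  set al := (_ %% _)%Z in al0 alE; set be := (_ %/ _)%Z in alE.
  pose d := i * w + be * a.
  have iE : i = a * `|al|%N%:Z + d * (p ^ m)%N%:Z.
    rewrite gez0_abs // /d mulrDl.
    have -> : al = i * u - be * (p ^ m)%N%:Z by rewrite alE addrC addKr.
    by rewrite -{1}[i]mulr1 -[X in i * X = _]uw; ring.
  have vx := valX vvK `|al|%N vx0.
  have vt := valX vvK (p ^ m) (valXz vvK d vt0).
  exists (x0 ^+ `|al|%N * (t0 ^ d) ^+ (p ^ m)).
    by rewrite (valMn vvK vx vt) mul1r -iE.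
  have vxL := val_alg ramLK vx; have vtL := val_alg ramLK vt.
  have -> : N * i + n = N * (a * `|al|%N%:Z) + N * (1 * d * (p ^ m)%N%:Z) + n.
    by rewrite {1}iE mul1r; ring.
  rewrite -[_%:A]/(in_alg L _) rmorphM /=; apply: rel_approxM => //.
    have := rel_approxX `|al|%N n1 (val_alg ramLK vx0) hx0.
    by rewrite -mulrA -[(_ ^+ _)%:A]/(in_alg L _) rmorphXn.
  exists (t0 ^ d)%:A; rewrite -[(_ ^+ _)%:A]/(in_alg L _) rmorphXn subrr.
  exact: vge0.
(* Each round strips a leading term c g and gains at least one unit of valuation in K; [d] bounds
   the rounds left until the remainder is negligible. *)
suff h (d : nat) (z' : K) e : e0 <= e -> e0 + n <= e + d%:Z -> vge vK z' e ->
    power_approx m (N * e0 + n) z'%:A.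
  by apply: (h `|n|%N z e0) => //; lia.
elim: d z' e => [|d IH] z' e le_e le_n hz'.
  apply/power_approx0/(vge_le _ ((vge_alg vvK vv ramLK _ _).1 hz')).
  nia.
have [g vg hg] := gex e.
have h0 : vge vK (z' / g) 0.
  by apply: vge_le (vgeM vvK hz' (val_vge_refl (valV vvK vg))); lia.
have [c kc hc] := teich_lift charK localK h0.
have g0 := val_neq0 vvK vg.
have hz1 : vge vK (z' - c * g) (e + 1).
  have -> : z' - c * g = (z' / g - c) * g by rewrite mulrBl divfK.
  by apply: vge_le (vgeM vvK hc (val_vge_refl vg)); lia.
rewrite -[z'](subrK (c * g)) scalerDl; apply: power_approxD.
  by apply: IH hz1; lia.
rewrite -scalerA; apply: power_approxZ => //.
by apply: power_approx_vge hg; nia.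
Qed.

(** A better approximation z would give (z - y)^(p^m) the valuation i, which is not divisible by
    p^m. *)
Lemma power_approx_sharp m e i x y : ~~ (p ^ m %| `|i|)%N -> v (x - y ^+ (p ^ m)) = i%:E ->
  power_approx m e x -> e <= i.
Proof.
move=> pi vxy [z xz]; rewrite leNgt; apply/negP => ie.
have h : vge v (x - y ^+ (p ^ m) - (z - y) ^+ (p ^ m)) (i + 1).
  rewrite (exprB_pchar charL) opprB addrA subrK.
  by apply: vge_le xz; lia.
have vzy := valB_eq vv vxy h.
have zy0 : z - y != 0.
  by have := val_neq0 vv vzy; apply: contraNneq => ->; rewrite (expr0_pchar charL).
have [a va] := val_ex vv zy0.
have := valX vv (p ^ m) va; rewrite vzy => -[] e'.
by case/negP: pi; rewrite e' abszM absz_nat dvdn_mull.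
Qed.

(** The terms before the first exponent not divisible by p^(j+1) add up to a p^(j+1)-th power, and
    that exponent is the valuation of the error, so no other power does better. *)
Lemma insep_index_eq (nu j : nat) (piK : K) (piL : L) (c : nat -> K) (H : int) :
  v piL = 1%:E -> insep_expansion v p q nu piK piL c ->
  power_approx j.+1 ((p ^ nu)%N%:Z + H) piK%:A ->
  ~ power_approx j.+1 ((p ^ nu)%N%:Z + H + 1) piK%:A ->
  insep_index p nu c j = H%:E.
Proof.
move=> vpi [kc cvg] hH nH.
pose Q h := (c h != 0) && (logn p (h + p ^ nu) <= j)%N.
have term h : vge v (c h *: piL ^+ (h + p ^ nu)) (h + p ^ nu)%N%:Z.
  rewrite -mulr_algl; apply: vgeMl => //.
    by apply/(vge_alg0 vvK vv ramLK)/(vge_teich charK localK).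
  by apply: val_vge_refl; rewrite (valX vv _ vpi) mul1r.
have low h : (forall i, (i < h)%N -> ~~ Q i) ->
    exists y, vge v (piK%:A - y ^+ (p ^ j.+1)) (h + p ^ nu)%N%:Z /\
      vge v (piK%:A - y ^+ (p ^ j.+1) - c h *: piL ^+ (h + p ^ nu)) (h + p ^ nu)%N.+1%:Z.
  move=> hQ.
  have hy i : exists y, (i < h)%N -> c i *: piL ^+ (i + p ^ nu) = y ^+ (p ^ j.+1).
    case: (ltnP i h) => [ih|_]; last by exists 0.
    have := hQ i ih; rewrite negb_and negbK; have [->|ci] := eqVneq (c i) 0.
      by move=> _; exists 0; rewrite scale0r (expr0_pchar charL).
    rewrite /= -ltnNge => lj.
    have : (p ^ j.+1 %| i + p ^ nu)%N.
      by rewrite pfactor_dvdn // addn_gt0 expn_gt0 p0 orbT.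
    case/dvdnP => d dE; have [e _ eE] := teich_root charK localK j.+1 (kc i).
    by exists (e *: piL ^+ d); rewrite exprZn eE dE exprM.
  have [y yE] := choice hy.
  exists (\sum_(i < h) y i).
  rewrite (expr_sum_pchar charL) (eq_bigr (fun i : 'I_h => c i *: piL ^+ (i + p ^ nu))).
    have [n0 n0P] := cvg (h + p ^ nu)%N.+1%:Z.
    set S := \sum_(i < h) _.
    have h2 : vge v (piK%:A - S - c h *: piL ^+ (h + p ^ nu)) (h + p ^ nu)%N.+1%:Z.
      pose n := maxn n0 h.+1.
      have := vgeBC vv (n0P n (leq_maxl _ _)).
      have -> : \sum_(i < n) c i *: piL ^+ (i + p ^ nu) = S + c h *: piL ^+ (h + p ^ nu)
          + \sum_(h.+1 <= i < n) c i *: piL ^+ (i + p ^ nu).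
        rewrite -(big_mkord xpredT (fun i => c i *: piL ^+ (i + p ^ nu))).
        rewrite (big_cat_nat _ (n := h.+1)) ?leq_maxr //=.
        by rewrite big_nat_recr //= big_mkord.
      rewrite opprD addrA opprD addrA => /(vgeD vv) h3.
      have : vge v (\sum_(h.+1 <= i < n) c i *: piL ^+ (i + p ^ nu)) (h + p ^ nu)%N.+1%:Z.
        rewrite big_nat_cond; apply: vge_sum => // i /andP[/andP[hi _] _].
        by apply: vge_le (term i); rewrite lez_nat -addSn leq_add2r.
      by move/h3; rewrite subrK.
    split=> //; rewrite -[X in vge v X _](subrK (c h *: piL ^+ (h + p ^ nu))).
    by apply: vgeD => //; apply: vge_le h2; rewrite lez_nat.
  by move=> i _; rewrite -yE.
(* Without such an index the partial sums would be powers approximating pi_K to any order, contrary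
   to [nH]. *)
have exQ : exists h, Q h.
  apply/not_existsP => nQ; apply: nH.
  have [|y [hy _]] := low `|H|.+1; first by move=> i _; apply/negP/nQ.
  by exists y; apply: vge_le hy; lia.
rewrite /insep_index; case: pselect => // exh; case: ex_minnP => h Qh hmin.
have [|y [hy1 hy2]] := low h.
  by move=> i ih; apply/negP => /hmin; rewrite leqNgt ih.
have /andP[ch lh] := Qh.
have vterm : v (c h *: piL ^+ (h + p ^ nu)) = (h + p ^ nu)%N%:Z%:E.
  rewrite -mulr_algl (valMn vv (val_alg ramLK (val_teich charK localK (kc h) ch)) (valX vv _ vpi)).
  by congr EFin; lia.
have vy : v (piK%:A - y ^+ (p ^ j.+1)) = (h + p ^ nu)%N%:Z%:E.
  rewrite -[X in v X](subrK (c h *: piL ^+ (h + p ^ nu))) addrC.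
  by apply: valD_eq => //; apply: vge_le hy2; lia.
have pnh : ~~ (p ^ j.+1 %| `|(h + p ^ nu)%N%:Z|)%N.
  by rewrite absz_nat pfactor_dvdn ?addn_gt0 ?expn_gt0 ?p0 ?orbT // -ltnNge ltnS.
have le1 := power_approx_sharp pnh vy hH.
have le2 : h%:Z <= H.
  rewrite leNgt; apply/negP => Hh; apply: nH; exists y.
  by apply: vge_le hy1; lia.
by congr EFin; lia.
Qed.

End PowerApproximation.

(** * The equation for Y and the best approximations of t^-b *)

Section NormalForm.
Variables (p q nu b : nat) (K : fieldType) (L : splittingFieldType K).
Variables (vK : K -> \bar int) (v : L -> \bar int).
Hypotheses (charK : p \in [pchar K]) (localK : local_field vK q).
Hypotheses (vv : normalized_valuation v).
Hypothesis ramLK : totally_ramified vK v.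
Hypothesis dimL : \dim {:L} = (p ^ nu.+1)%N.
Hypotheses (b1 : (1 <= b)%N) (bp : (b <= p - 1)%N).

Let vvK : normalized_valuation vK. Proof. by case: localK. Qed.
Let pp : prime p. Proof. exact: pcharf_prime charK. Qed.
Let p0 : (0 < p)%N. Proof. exact: prime_gt0. Qed.
Let charL : p \in [pchar L]. Proof. exact: pchar_ext. Qed.
Local Notation k := (@teichmuller K q).
Local Notation N := (p ^ nu.+1)%N%:Z.
Local Notation P := (p ^ nu)%N%:Z.
Local Notation papprox := (power_approx p v).

Let P0 : 0 < P. Proof. by rewrite ltz_nat expn_gt0 p0. Qed.
Let NP : N = p%:Z * P. Proof. by rewrite expnS PoszM. Qed.
Let PX0 j : 0 < (p ^ j)%N%:Z. Proof. by rewrite ltz_nat expn_gt0 p0. Qed.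

Variables (t : K) (a w : nat -> K) (Y : L).
Hypotheses (vt : vK t = 1%:E) (ka : forall j, k (a j)) (a0 : a 0%N != 0).
Hypothesis wa : forall j, vge vK (w j - a j * t ^- b) (1 - b%:Z).
Hypothesis vw : forall j, w j != 0 ->
  exists2 i : nat, (1 <= i <= b)%N & vK (w j) = (- i%:Z)%:E.
Hypothesis YE : Y ^+ (p ^ nu.+1) =
  \sum_(j < nu.+1) ((a j)%:A * Y + (w j)%:A) ^+ (p ^ j).

Let vtb : vK (t ^- b) = (- b%:Z)%:E.
Proof. by rewrite (valV vvK (valX vvK b vt)) mul1r. Qed.

Let w_ge j : vge vK (w j) (- b%:Z).
Proof.
have [->|/vw[i /andP[_ ib] vi]] := eqVneq (w j) 0; first exact: vge0.
by apply/(val_vge _ vi); rewrite lerN2 lez_nat.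
Qed.

Let a_ge j : vge v (a j)%:A 0.
Proof. by apply/(vge_alg0 vvK vv ramLK)/(vge_teich charK localK). Qed.

Let val_w j : a j != 0 -> vK (w j) = (- b%:Z)%:E.
Proof.
move=> aj; have va := val_teich charK localK (ka j) aj.
have vab : vK (a j * t ^- b) = (- b%:Z)%:E.
  by rewrite (valMn vvK va vtb) add0r.
by apply: (valB_eq vvK vab); apply: vgeBC => //; apply: vge_le (wa j); lia.
Qed.

(** The left side of the equation has exponent p P in Y, the right side at most P. With g a common
    lower bound for all a_j Y and w_j, a pole of order above b P would be too deep on the left. *)
Lemma vge_generator : vge v Y (- (b%:Z * P)).
Proof.
have [->|/(val_ex vv)[e ve]] := eqVneq Y 0; first exact: vge0.
apply/(val_vge _ ve); rewrite leNgt; apply/negP => elt.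
have bP0 : 0 <= b%:Z * P by rewrite mulr_ge0 // ltW.
have e0 : e < 0 by lia.
pose g := Num.min e (- (b%:Z * N)).
have ge : g <= e by rewrite ge_min lexx.
have gb : g <= - (b%:Z * N) by rewrite ge_min lexx orbT.
have h : vge v (Y ^+ (p ^ nu.+1)) (g * P).
  rewrite YE; apply: vge_sum => // j _.
  have hj : vge v ((a j)%:A * Y + (w j)%:A) g.
    apply: vgeD => //; first by apply: vgeMl => //; apply/(val_vge _ ve).
    have /(vge_alg vvK vv ramLK) := w_ge j; rewrite dimL.
    by apply: vge_le; rewrite mulrN mulrC.
  apply: vge_le (vgeX vv (p ^ j) hj).
  have : (p ^ j)%N%:Z <= P by rewrite lez_nat leq_exp2l ?prime_gt1 // -ltnS.
  have g0 : g <= 0 by lia.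
  move=> hP; rewrite -subr_ge0 -mulrBr; nia.
move/(val_vge _ (valX vv _ ve)): h.
rewrite NP mulrA ler_pM2r // /g.
have p2 := prime_gt1 pp.
case: (lerP e (- (b%:Z * N))) => [|_ h]; first by nia.
have : - (b%:Z * P) * p%:Z <= e * p%:Z by move: h; rewrite NP; lia.
by rewrite ler_pM2r ?ltz_nat // leNgt elt.
Qed.

Let wY_split j : (a j)%:A * Y + (w j)%:A =
  a j *: (Y + (t ^- b)%:A) + (w j - a j * t ^- b)%:A.
Proof.
rewrite scalerDr scalerA scalerBl mulr_algl -addrA; congr (_ + _).
by rewrite addrC subrK.
Qed.

(* If Z = Y + t^-b and the w_j - a_j t^-b are close to p^m-th powers, then so are
   all (a_j Y + w_j)^(p^j) with j > 0 to p^(m+1)-th powers, and the equation for Y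
   yields the case j = 0; w_0 being then close enough, rel_approx_base applies. *)
Lemma generator_approx m : (m <= nu.+1)%N ->
  papprox m 1 (Y + (t ^- b)%:A) /\
  forall x, vge vK x (1 - b%:Z) -> papprox m 1 x%:A.
Proof.
elim: m => [|m IH] mn.
  have h x : papprox 0 1 x by exists x; rewrite expr1 subrr; exact: vge0.
  by split=> [|x _]; exact: h.
have [IHZ IHx] := IH (ltnW mn).
have hw j : papprox m 1 ((a j)%:A * Y + (w j)%:A).
  rewrite wY_split; apply: power_approxD => //; last exact: IHx.
  exact: (power_approxZ charK localK).
have hw0 : papprox m.+1 1 ((a 0%N)%:A * Y + (w 0%N)%:A).
  have -> : (a 0%N)%:A * Y + (w 0%N)%:A = Y ^+ (p ^ nu.+1)
      - \sum_(j < nu) ((a j.+1)%:A * Y + (w j.+1)%:A) ^+ (p ^ j.+1).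
    by rewrite YE big_ord_recl /= expr1 addrK.
  apply: (power_approxD charK vv).
    exists (Y ^+ (p ^ (nu.+1 - m.+1))).
    by rewrite -exprM -expnD subnK // subrr; exact: vge0.
  apply: (power_approxN charK vv); apply: (power_approx_sum charK vv) => j _.
  apply: power_approx_le (power_approxX charK vv j.+1 (hw j.+1) _) => //.
  by rewrite addnS ltnS leq_addr.
have hx x : vge vK x (1 - b%:Z) -> papprox m.+1 1 x%:A.
  (* This n is chosen so that N (1 - b) + n = 1. For w_0 it asks for absolute precision 1 - N,
     within which a_0 Y is negligible because b P <= N - P. *)
  move=> hx; pose n := (b%:Z - 1) * N + 1.
  have n1 : 1 <= n by rewrite /n lerDr mulr_ge0 // subr_ge0 lez_nat.
  have bN : b%:Z * P + P <= N.
    by rewrite NP -{2}[P]mul1r -mulrDl ler_pM2r //; lia.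
  have pb : ~~ (p %| `|- b%:Z|)%N.
    by rewrite abszN absz_nat; apply/negP => /dvdn_leq; lia.
  have happ : papprox m.+1 ((\dim {:L})%:Z * - b%:Z + n) (w 0%N)%:A.
    rewrite -[(w 0%N)%:A](addKr ((a 0%N)%:A * Y)).
    apply: (power_approxD charK vv).
      apply/(power_approxN charK vv)/(power_approx0 charK).
      apply: vgeMl => //; apply: vge_le vge_generator.
      by rewrite dimL /n; lia.
    apply: power_approx_vge hw0; rewrite dimL /n.
    by lia.
  have := rel_approx_base charK localK vv ramLK n1 (val_w a0) pb happ hx.
  apply: power_approx_vge; rewrite dimL /n; lia.
split=> //.
rewrite -[X in papprox _ _ X](scalerK a0).
apply: (power_approxZ charK localK) => //; first exact: teichV.
have -> : a 0%N *: (Y + (t ^- b)%:A) = (a 0%N)%:A * Y + (w 0%N)%:A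
    - (w 0%N - a 0%N * t ^- b)%:A by rewrite wY_split addrK.
apply: (power_approxD charK vv) => //.
by apply/(power_approxN charK vv)/hx.
Qed.

(** The valuation of W_j comes from w_j alone: if a_j <> 0, then w_j has the full pole of order b N
    in L, deeper than that of a_j Y. A vanishing w_j forces a_j = 0, so W_j = 0 is a legitimate
    root. *)
Lemma generator_roots : exists W : nat -> L, forall j,
  [/\ vge v ((a j)%:A * Y + (w j)%:A - W j ^+ (p ^ nu.+1)) 1,
      w j = 0 -> W j = 0 & forall i, vK (w j) = i%:E -> v (W j) = i%:E].
Proof.
have [hZ hx] := generator_approx (leqnn _).
suff h j : exists z, [/\ vge v ((a j)%:A * Y + (w j)%:A - z ^+ (p ^ nu.+1)) 1,
    w j = 0 -> z = 0 & forall i, vK (w j) = i%:E -> v z = i%:E].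
  by have [W WP] := choice h; exists W.
have [w0|wj] := eqVneq (w j) 0.
  have aj : a j = 0.
    by apply/eqP/contraT => /val_w; rewrite w0 (Defs.val0 vvK).
  exists 0; split=> // [|i]; last by rewrite w0 (Defs.val0 vvK).
  by rewrite w0 aj !scale0r mul0r add0r (expr0_pchar charL) subr0; exact: vge0.
have [z hz] : papprox nu.+1 1 ((a j)%:A * Y + (w j)%:A).
  rewrite wY_split; apply: (power_approxD charK vv); last exact: hx.
  exact: (power_approxZ charK localK).
exists z; split=> // [w0|i vi]; first by rewrite w0 eqxx in wj.
have [i' /andP[i1 ib] vi'] := vw wj.
have vwL := val_alg ramLK vi; rewrite dimL in vwL.
have ii' : i = - i'%:Z by move: vi; rewrite vi' => -[].
have bN : b%:Z * P + P <= N.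
  by rewrite NP -{2}[P]mul1r -mulrDl ler_pM2r //; lia.
have vsum : v ((a j)%:A * Y + (w j)%:A) = (N * i)%:E.
  rewrite addrC; apply: valD_eq => //.
  have [->|aj] := eqVneq (a j) 0; first by rewrite scale0r mul0r; exact: vge0.
  have ib' : i = - b%:Z by move: vi; rewrite (val_w aj) => -[].
  apply: vgeMl => //; apply: vge_le vge_generator.
  rewrite ib'; nia.
have vzX : v (z ^+ (p ^ nu.+1)) = (N * i)%:E.
  by apply: (valB_eq vv vsum); apply: vge_le hz; have := PX0 nu.+1; nia.
have [e ve] : exists e, v z = e%:E.
  apply: (val_ex vv); apply/eqP => z0.
  by have := val_neq0 vv vzX; rewrite z0 (expr0_pchar charL) eqxx.
have := valX vv (p ^ nu.+1) ve; rewrite vzX => -[].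
by rewrite mulrC => /(mulIf (lt0r_neq0 (PX0 nu.+1))) ->.
Qed.

(** The terms with j > j0 are absorbed into the approximating power. The others have valuations of
    distinct p-adic valuation j <= j0, so no p^(j0+1)-th power can cancel any of them, in particular
    the smallest. *)
Lemma polar_approx j0 j1 (M i1 : int) : (j0 <= nu)%N -> (j1 <= j0)%N ->
  vK (w j1) = i1%:E -> M = (p ^ j1)%N%:Z * i1 ->
  (forall j i, (j <= j0)%N -> vK (w j) = i%:E -> M <= (p ^ j)%N%:Z * i) ->
  papprox j0.+1 M (t ^- b)%:A /\ ~ papprox j0.+1 (M + 1) (t ^- b)%:A.
Proof.
move=> j0nu j10 vw1 ME Mmin.
have [W WP] := generator_roots.
have M0 : M <= -1.
  have [i /andP[i0 _]] := vw (val_neq0 vvK vw1).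
  rewrite vw1 => -[ii]; rewrite ME ii; have := PX0 j1; nia.
have [[z hz] _] := generator_approx (leqnn _).
(* An N-th root of the equation for Y: the N-th power of the difference is the sum of the p^j-th
   powers of a_j Y + w_j - W_j^N. *)
have hR : vge v (Y - \sum_(j < nu.+1) W j ^+ (p ^ j)) 1.
  apply: (vge_rootX_gt0 vv (k := p ^ nu.+1)); first by rewrite expn_gt0 p0.
  rewrite (exprB_pchar charL) (expr_sum_pchar charL) YE -sumrB.
  apply: vge_sum => // j _; rewrite exprAC -(exprB_pchar charL).
  have [hj _ _] := WP j; apply: vge_le (vgeX vv (p ^ j) hj).
  by have := PX0 j; lia.
pose low (j : 'I_nu.+1) := if (j <= j0)%N then W j ^+ (p ^ j) else 0.
have split_sum : exists y, \sum_(j < nu.+1) W j ^+ (p ^ j) =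
    \sum_j low j + y ^+ (p ^ j0.+1).
  exists (\sum_(j < nu.+1) if (j <= j0)%N then 0 else W j ^+ (p ^ (j - j0.+1))).
  rewrite (expr_sum_pchar charL) -big_split; apply: eq_bigr => j _ /=.
  rewrite /low; case: leqP => jj; first by rewrite (expr0_pchar charL) addr0.
  by rewrite add0r -exprM -expnD subnK.
have [y1 y1E] := split_sum.
pose y2 := z ^+ (p ^ (nu.+1 - j0.+1)) - y1.
have tbE : vge v ((t ^- b)%:A - y2 ^+ (p ^ j0.+1) + \sum_j low j) 1.
  have := vgeB vv hz hR; congr (vge v _ _).
  rewrite y1E /y2 (exprB_pchar charL) -exprM -expnD subnK //.
  by ring.
have vlow (j : 'I_nu.+1) i : (j <= j0)%N -> vK (w j) = i%:E ->
    v (low j) = ((p ^ j)%N%:Z * i)%:E.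
  move=> jj vi; rewrite /low jj; have [_ _ /(_ _ vi) vW] := WP j.
  by rewrite (valX vv _ vW) mulrC.
have low0 (j : 'I_nu.+1) : low j != 0 ->
    (j <= j0)%N /\ exists2 i : nat, (1 <= i <= b)%N & vK (w j) = (- i%:Z)%:E.
  rewrite /low; case: leqP => [jj|_]; last by rewrite eqxx.
  move=> nz; split=> //; apply: vw; apply: contraNneq nz => w0.
  by have [_ /(_ w0) -> _] := WP j; rewrite (expr0_pchar charL).
have pi_ (i : nat) : (1 <= i <= b)%N -> ~~ (p %| i)%N.
  by move=> /andP[i0 ib]; apply/negP => /(dvdn_leq i0); lia.
split.
  exists y2; rewrite -[X in vge v X _](addrK (\sum_j low j)).
  apply: vgeB => //; first by apply: vge_le tbE; lia.
  apply: vge_sum => // j _; have [->|lj] := eqVneq (low j) 0; first exact: vge0.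
  have [jj [i ib vi]] := low0 j lj; apply/(val_vge _ (vlow j _ jj vi)).
  exact: Mmin jj vi.
move=> [y hy].
have hy2 : vge v ((y - y2) ^+ (p ^ j0.+1) + \sum_j low j) (M + 1).
  rewrite (exprB_pchar charL).
  have M1 : M + 1 <= 1 by lia.
  by have := vgeB vv (vge_le M1 tbE) hy; congr (vge v _ _); ring.
(* [None] carries the power by which a competing approximation differs from [y2]; it joins the
   family of terms that cannot cancel. *)
pose f (o : option 'I_nu.+1) := if o is Some j then low j else (y - y2) ^+ (p ^ j0.+1).
have logl (j : 'I_nu.+1) : low j != 0 -> exists2 e : int, v (low j) = e%:E &
    logn p `|e| = j /\ e != 0.
  move=> lj; have [jj [i ib vi]] := low0 j lj.
  exists ((p ^ j)%N%:Z * - i%:Z); first exact: vlow.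
  have i0 : (0 < i)%N by case/andP: ib.
  rewrite mulrN abszN -PoszM absz_nat lognM ?expn_gt0 ?p0 // pfactorK //.
  rewrite lognE pp i0 (negPf (pi_ i ib)) addn0; split=> //.
  by rewrite oppr_eq0 eqz_nat muln_eq0 negb_or -!lt0n expn_gt0 p0.
have dist_low (j : 'I_nu.+1) : low j != 0 -> v (low j) <> v (f None).
  move=> lj; have [e ve [le e0]] := logl j lj; have [jj _] := low0 j lj.
  rewrite ve /f; have [->|/(val_ex vv)[c vc]] := eqVneq (y - y2) 0.
    by rewrite (expr0_pchar charL) (Defs.val0 vv).
  rewrite (valX vv _ vc) => -[] ec.
  have : (p ^ j0.+1 %| `|e|)%N by rewrite ec abszM absz_nat dvdn_mull.
  by rewrite pfactor_dvdn ?absz_gt0 // le ltnNge jj.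
have dist (o1 o2 : option 'I_nu.+1) : o1 != o2 -> f o1 != 0 -> v (f o1) <> v (f o2).
  case: o1 o2 => [j|] [j'|] //=.
  - move=> jj' lj; have [e ve [le _]] := logl j lj.
    have [->|lj'] := eqVneq (low j') 0; first by rewrite (Defs.val0 vv) ve.
    have [e' ve' [le' _]] := logl j' lj'; rewrite ve ve' => -[] ee'.
    by case/eqP: jj'; congr Some; apply: val_inj; rewrite /= -le -le' ee'.
  - by move=> _; exact: dist_low.
  - move=> _ nz; have [->|lj'] := eqVneq (low j') 0.
      by rewrite (Defs.val0 vv); have [c ->] := val_ex vv nz.
    by move=> e; exact: (dist_low j' lj' (esym e)).
have hsum : vge v (\sum_o f o) (M + 1).
  rewrite (bigD1 None) //= (reindex_omap Some id) /=; last by case.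
  by move: hy2; congr (vge v (_ + _) _); apply: eq_bigl => j; rewrite eqxx.
have j1nu : (j1 < nu.+1)%N by rewrite ltnS (leq_trans j10).
have := vge_dominant vv dist hsum (Some (Ordinal j1nu)).
by move/(val_vge _ (vlow (Ordinal j1nu) _ j10 vw1)); rewrite /= -ME; lia.
Qed.

End NormalForm.

(** * The indices of inseparability from the w_j *)

Theorem theorem5p1
  (p q nu b : nat)
  (K : fieldType) (vK : K -> \bar int)
  (L : splittingFieldType K) (vL : L -> \bar int)
  (charK : p \in [pchar K])
  (localK : local_field vK q)
  (valL : normalized_valuation vL)
  (ramLK : totally_ramified vK vL)
  (galLK : galois 1%AS {:L})
  (nu_ge1 : (1 <= nu)%N)
  (gal_isog : 'Gal({:L} / 1%AS)%g \isog [set: 'rV['F_p]_nu])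
  (b_bounds : (1 <= b <= p - 1)%N)
  (breakLK : single_break vL b)
  (* data for the indices of inseparability *)
  (piK : K) (piL : L) (c : nat -> K)
  (unifK : uniformizer vK piK) (unifL : uniformizer vL piL)
  (expc : insep_expansion vL p q nu piK piL c)
  (* data for the w_j *)
  (piL' : L) (t : K) (C : set K) (w : 'I_nu -> K)
  (unifL' : uniformizer vL piL')
  (normt : t%:A = galNorm 1%AS {:L} piL')
  (complC : wp_complement p q C)
  (defw : AS_coefs L p q b C t w)
  (j : 'I_nu) :
  insep_index p nu c j =
    ((b * p ^ nu)%N%:Z%:E
     + \big[Order.min/+oo]_(j' < nu | (j' <= j)%N)
         ((p ^ j')%N%:Z%:E * vK (w j')))%E.
Proof.
case: nu nu_ge1 gal_isog expc w defw j => [//|n] _ isoG exc ww [wpol wpsi] j.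
have pp : prime p := pcharf_prime charK.
have vvK : normalized_valuation vK by case: localK.
have /andP[b1 bp] := b_bounds.
have charL : p \in [pchar L] by rewrite pchar_lalg.
have oG : #|'Gal({:L} / 1%AS)%g| = (p ^ n.+1)%N.
  by rewrite (card_isog isoG) cardsT card_mx card_Fp // mul1n.
have abG : abelian 'Gal({:L} / 1%AS)%g by rewrite (isog_abelian isoG) FinRing.zmod_abelian.
have vt := val_norm localK valL ramLK galLK oG b1 breakLK unifL' normt.
have dimL := dim_ext galLK oG.
have [x [y [beta [yE xtop xfree]]]] := AS_basis charK localK valL ramLK galLK oG abG
  b1 bp breakLK unifL' normt complC isoG.
have bE i : beta i = \sum_(l < n.+1) ww l * x i ^+ (p ^ (n.+1 - l)).
  rewrite -wpsi; last by exists (beta i).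
  by rewrite (AS_psiE charK localK valL ramLK galLK oG abG b1 bp breakLK unifL'
    normt complC (xtop i)).
have [om omP] := choice wpol.
have kx i : teichmuller q (x i) by have [_ [X [kX _] <-]] := xtop i; exact: kX.
(* Comparison of the coefficients of t^-b in psi(x_i): on the left it is x_i itself. *)
have xE i : x i = \sum_(l < n.+1) om l b * x i ^+ (p ^ (n.+1 - l)).
  have [_ [X XP Xb]] := xtop i.
  have bb : (1 <= b <= b)%N by rewrite b1 leqnn.
  rewrite -{1}Xb; pose X' m := \sum_(l < n.+1) om l m * x i ^+ (p ^ (n.+1 - l)).
  have X'P : polar_expansion q b t X' (beta i).
    split=> [m|].
      apply: (teich_sum charK localK) => l _; apply: teichM; last exact: teichX.
      by have [] := omP l.
    rewrite bE; under [RHS]eq_bigr do rewrite mulr_suml.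
    rewrite exchange_big /=; apply: eq_bigr => l _.
    have [_ {1}->] := omP l; rewrite mulr_suml.
    by apply: eq_bigr => m _; rewrite mulrAC.
  exact: (polar_expansion_uniq charK localK valL ramLK galLK oG b1 breakLK unifL'
    normt XP X'P bb).
(* Padding by zero turns families on ordinals into sequences; the padded entries w = a = 0 still
   satisfy the hypotheses on coefficients. *)
pose ext (f : 'I_n.+1 -> K) m := if insub m is Some i then f i else 0.
have extE f (i : 'I_n.+1) : ext f i = f i by rewrite /ext valK.
pose w := ext ww; pose a := ext (fun l => om l b).
have [a0 [Y YE]] : (a 0%N)%:A != 0 :> L /\ exists Y : L, Y ^+ (p ^ n.+1) =
    \sum_(l < n.+1) ((a l)%:A * Y + (w l)%:A) ^+ (p ^ l).
  apply: (@AS_additive_generator p n L (fun i => (x i)%:A) y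
    (fun l => (a l)%:A) (fun l => (w l)%:A)) => // [d s0 i|i|i].
  - apply: (xfree d); apply: (fmorph_inj (in_alg L)); rewrite rmorph0 -[RHS]s0.
    by rewrite rmorph_sum; apply: eq_bigr => l _; rewrite rmorphMn.
  - rewrite {1}xE -[LHS]/(in_alg L _) rmorph_sum; apply: eq_bigr => l _.
    by rewrite rmorphM rmorphXn /= /a extE.
  - rewrite yE bE -[LHS]/(in_alg L _) rmorph_sum; apply: eq_bigr => l _.
    by rewrite rmorphM rmorphXn /= /w extE.
have {}a0 : a 0%N != 0 by apply: contraNneq a0 => ->; rewrite scale0r.
have ext_or m : (exists l, w m = ww l /\ a m = om l b) \/ (w m = 0 /\ a m = 0).
  by rewrite /w /a /ext; case: insub => [l|]; [left; exists l | right].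
have ka m : teichmuller q (a m).
  have [[l [_ ->]]|[_ ->]] := ext_or m; last exact: (teich0 charK localK).
  by have [] := omP l.
have wa m : vge vK (w m - a m * t ^- b) (1 - b%:Z).
  have [[l [-> ->]]|[-> ->]] := ext_or m; last by rewrite mul0r subrr; exact: vge0.
  have [kom ->] := omP l; rewrite big_nat_recr //= addrK big_nat_cond.
  apply: vge_sum => // i /andP[/andP[_ ib] _].
  by apply: vge_le (vge_monom charK localK vt i (kom i)); lia.
have vw m : w m != 0 -> exists2 i : nat, (1 <= i <= b)%N & vK (w m) = (- i%:Z)%:E.
  have [[l [-> _]]|[-> _]] := ext_or m; last by rewrite eqxx.
  by have [kom ->] := omP l; exact: (polar_val_ex charK localK vt).
pose F (l : 'I_n.+1) : \bar int := ((p ^ l)%N%:Z%:E * vK (ww l))%E.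
have FE l i : vK (ww l) = i%:E -> F l = ((p ^ l)%N%:Z * i)%:E by rewrite /F => ->.
case: (@arg_minP _ _ _ j (fun l : 'I_n.+1 => (l <= j)%N) F (leqnn j)) => j1 j1j j1min.
(* Since a_0 <> 0, also w_0 <> 0; as index 0 always competes, the minimum is finite. *)
have w00 : w 0%N != 0.
  apply/eqP => w00; have := wa 0%N; rewrite w00 sub0r => /(vgeN vvK).
  have va := val_teich charK localK (ka 0%N) a0.
  rewrite opprK => /(val_vge _ (valMn vvK va (valV vvK (valX vvK b vt)))).
  by rewrite mul1r; lia.
have wj1 : ww j1 != 0.
  apply/eqP => w1; have := j1min ord0 (leq0n _).
  have [i _ vi] := vw 0%N w00; have vi' : vK (ww ord0) = (- i%:Z)%:E by rewrite -extE.
  rewrite {1}/F w1 (Defs.val0 vvK) gt0_muley; first by rewrite (FE _ _ vi').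
  by rewrite lte_fin ltz_nat expn_gt0 prime_gt0.
have [i1 vi1] := val_ex vvK wj1.
pose M := (p ^ j1)%N%:Z * i1.
have minE : \big[Order.min/+oo%E]_(l < n.+1 | (l <= j)%N) F l = M%:E.
  apply/eqP; rewrite eq_le -(FE _ _ vi1) bigmin_le_cond //=.
  by apply: le_bigmin => //; exact: leey.
rewrite minE.
have Mmin l i : (l <= j)%N -> vK (w l) = i%:E -> M <= (p ^ l)%N%:Z * i.
  move=> lj; have ln : (l < n.+1)%N := leq_ltn_trans lj (ltn_ord j).
  rewrite -[l]/(nat_of_ord (Ordinal ln)) /w extE => vi.
  by have := j1min (Ordinal ln) lj; rewrite (FE _ _ vi1) (FE _ _ vi) lee_fin.
have vw1 : vK (w j1) = i1%:E by rewrite /w extE.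
have jn : (j <= n)%N by rewrite -ltnS.
have [tb1 tb2] := polar_approx charK localK valL ramLK dimL b1 bp vt ka a0 wa vw YE
  jn j1j vw1 (erefl _) Mmin.
have vtb : vK (t ^- b) = (- b%:Z)%:E by rewrite (valV vvK (valX vvK b vt)) mul1r.
pose H := (b * p ^ n.+1)%N%:Z + M.
have pb : ~~ (p %| `|- b%:Z|)%N.
  by rewrite abszN absz_nat; apply/negP => /dvdn_leq; have := prime_gt0 pp; lia.
(* H is the relative precision of t^-b at absolute precision M. It is positive because j1 < n + 1
   makes p^j1 i <= b p^j1 smaller than b N. *)
have H1 : 1 <= H.
  have [i /andP[i0 ib] vi] := vw j1 (val_neq0 vvK vw1).
  have i1E : i1 = - i%:Z by move: vi; rewrite vw1 => -[].
  have : (p ^ j1 * i < b * p ^ n.+1)%N.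
    have j1n : (j1 < n.+1)%N := ltn_ord j1.
    apply: (@leq_ltn_trans (b * p ^ j1)%N); first by rewrite mulnC leq_mul2r ib orbT.
    by rewrite ltn_pmul2l // ltn_exp2l ?prime_gt1.
  by rewrite /H /M i1E; lia.
have NE : (\dim {:L})%:Z * - b%:Z = - (b * p ^ n.+1)%N%:Z by rewrite dimL; lia.
have tbH : power_approx p vL j.+1 ((\dim {:L})%:Z * - b%:Z + H) (t ^- b)%:A.
  by rewrite NE /H addKr.
have piK1 : vge vK piK 1 by apply: val_vge_refl.
(* Relative precision H passes from t^-b to pi_K, as b is prime to p. *)
have hH := rel_approx_base charK localK valL ramLK H1 vtb pb tbH piK1.
rewrite mulr1 dimL in hH.
rewrite (insep_index_eq charK localK valL ramLK unifL exc hH) // => hH1.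
(* Conversely, relative precision H + 1 for pi_K, whose valuation is 1, would return to t^-b and
   contradict the optimality of M. *)
apply: tb2; have p1 : ~~ (p %| `|1|)%N by rewrite dvdn1 gtn_eqF ?prime_gt1.
have H2 : 1 <= H + 1 by lia.
rewrite -addrA -[(p ^ n.+1)%N%:Z]mulr1 -dimL in hH1.
have := rel_approx_base charK localK valL ramLK H2 unifK p1 hH1 (val_vge_refl vtb).
by rewrite NE /H -addrA addKr.
Qed.
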